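(* Let $f,g\in L_2(\mathbb{R}_+)$ have Mellin transforms $f^*,g^*$ satisfying $s f^*(s),\ s g^*(s)\in L_2(\sigma)$. If $f*g=0$, then either $f=0$ or $g=0$ (as elements of $L_2(\mathbb{R}_+)$, i.e. almost everywhere on $\mathbb{R}_+$).
   Context: $\mathbb{R}_+=(0,\infty)$; functions are complex-valued. $\sigma=\{s\in\mathbb{C}:\mathrm{Re}\,s=1/2\}$, with $L_2(\sigma)$ taken with respect to $|ds|$; integrals over $\sigma$ run from $\frac12-i\infty$ to $\frac12+i\infty$. The Mellin transform of $f\in L_2(\mathbb{R}_+)$ is $f^*(s)=\int_0^\infty f(t)t^{s-1}dt$, $s\in\sigma$ (convergence in mean square in $L_2(\sigma)$). The convolution of $f$ and $g$ is $$(f*g)(x)=\frac{\sqrt{x}}{(2\pi i)^2}\int_{\sigma}\int_{\sigma}\left[\frac{\Gamma(s)\Gamma(1-s)\Gamma(w)\Gamma(1-w)}{\Gamma(s+w-1/2)\Gamma(3/2-s-w)}\right]^2 f^*(s)g^*(w)\,x^{-s-w}\,ds\,dw,\quad x>0.$$ *)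

(* Defs.v *)
From HB Require Import structures.
From mathcomp Require Import all_boot all_order all_algebra.
From mathcomp Require Export complex.
From mathcomp Require Export all_classical all_reals all_analysis.
Import Order.TTheory GRing.Theory Num.Theory.
Import numFieldNormedType.Exports.

Set Implicit Arguments.
Unset Strict Implicit.
Unset Printing Implicit Defensive.

Local Open Scope classical_set_scope.
Local Open Scope ring_scope.

(* Integrals and measurability of R[i]-valued functions are taken componentwise:
   R[i] carries no canonical measurable structure. *)
Definition cmeasurable_fun (R : realType) (A : set R) (f : R -> R[i]) : Prop :=
  measurable_fun A (fun t => complex.Re (f t)) /\
  measurable_fun A (fun t => complex.Im (f t)).

Definition cintegral (R : realType) (A : set R) (f : R -> R[i]) : R[i] :=
  ((\int[@lebesgue_measure R]_(t in A) complex.Re (f t)) +i*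
   (\int[@lebesgue_measure R]_(t in A) complex.Im (f t)))%C.

(* The values are those of the squared L_2(A) norm, so +oo is allowed. *)
Definition sqnorm2 (R : realType) (A : set R) (f : R -> R[i]) : \bar R :=
  (\int[@lebesgue_measure R]_(t in A) ((Normc.normc (f t) ^+ 2)%:E))%E.

Definition L2_on (R : realType) (A : set R) (f : R -> R[i]) : Prop :=
  cmeasurable_fun A f /\ (sqnorm2 A f < +oo)%E.

Definition Rplus (R : realType) : set R := [set x | 0 < x].

(* x ^ z = exp (z ln x), meant for 0 < x *)
Definition cpow (R : realType) (x : R) (z : R[i]) : R[i] :=
  (expR (complex.Re z * ln x))%:C%C *
  (cos (complex.Im z * ln x) +i* sin (complex.Im z * ln x))%C.

(* Euler's integral, which is the Gamma function on the half-plane 0 < Re z. *)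
Definition Gamma (R : realType) (z : R[i]) : R[i] :=
  cintegral (@Rplus R) (fun t => cpow t (z - 1) * (expR (- t))%:C%C).

(* The critical line Re s = 1/2, parametrized by arc length upwards, so that
   |ds| = dtau and ds = i dtau. *)
Definition sigma (R : realType) (tau : R) : R[i] := (2^-1 +i* tau)%C.

Definition L2_sigma (R : realType) (F : R[i] -> R[i]) : Prop :=
  L2_on setT (fun tau : R => F (sigma tau)).

Definition int_sigma (R : realType) (F : R[i] -> R[i]) : R[i] :=
  (0 +i* 1)%C * cintegral setT (fun tau : R => F (sigma tau)).

Definition trunc_mellin (R : realType) (f : R -> R[i]) (a : R) (s : R[i]) : R[i] :=
  cintegral `[a^-1, a] (fun t => f t * cpow t (s - 1)).

(* F represents the Mellin transform f^* : only its class modulo null subsets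
   of the line is determined. *)
Definition is_mellin (R : realType) (f : R -> R[i]) (F : R[i] -> R[i]) : Prop :=
  L2_sigma F /\
  (sqnorm2 setT (fun tau : R => (F (sigma tau) - trunc_mellin f a (sigma tau))%R)
     @[a --> +oo%R] --> 0%E).

Definition conv_kernel (R : realType) (s w : R[i]) : R[i] :=
  ((Gamma s * Gamma (1 - s) * Gamma w * Gamma (1 - w)) /
   (Gamma (s + w - 1 / 2) * Gamma (3 / 2 - s - w))) ^+ 2.

(* f * g, in terms of (representatives of) the Mellin transforms F = f^* and
   G = g^*. *)
Definition mellin_conv (R : realType) (F G : R[i] -> R[i]) (x : R) : R[i] :=
  (Num.sqrt x)%:C%C / ((2 * pi)%:C%C * (0 +i* 1)%C) ^+ 2 *
  int_sigma (fun w : R[i] => int_sigma (fun s : R[i] =>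
    conv_kernel s w * F s * G w * cpow x (- s - w))).

Definition ae_eq0 (R : realType) (f : R -> R[i]) : Prop :=
  {ae @lebesgue_measure R, forall x, Rplus x -> f x = 0}.

(* Main.v *)
From HB Require Import structures.
From mathcomp Require Import all_boot all_order all_algebra.
From mathcomp Require Import all_classical all_reals all_analysis.
From mathcomp Require Import measurable_realfun complex ring lra.
Require Import Defs.
Import Order.TTheory GRing.Theory Num.Theory.
Import numFieldNormedType.Exports.

(** On the critical line [Gamma (1/2 + i tau) * Gamma (1/2 - i tau)] equals
    [sechpi tau = pi / cosh (pi tau)] ([Gamma_reflection]), so for
    [s = 1/2 + i tau] and [w = 1/2 + i eta] the kernel of the convolution is the
    real number [(sechpi tau * sechpi eta / sechpi (tau + eta)) ^ 2]
    ([conv_kernel_sigma]), which is bounded by [(2 pi) ^ 2] because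
    [cosh (a + b) <= 2 cosh a cosh b].  As [s F s] and [s G s] are square
    integrable on the line, [F] and [G] are integrable on it, and [mellin_conv F G x]
    is, up to a nonzero factor, the value at [u = - ln x] of the Fourier transform of
    [H (tau, eta) = kernel * F * G] along the direction [tau + eta].  It vanishes for
    almost every [u], hence for every [u] by continuity.

    The denominator of the kernel is then removed.  The function [sechpi] is itself the
    Fourier transform of an integrable function, [1 / (2 cosh (y / 2))], so by Fubini the
    vanishing of the transform of [H] along [tau + eta] for all frequencies survives
    multiplication of [H] by [sechpi (tau + eta)] ([charf_mul_sechpi]).  Multiplying twice
    leaves [phi tau * psi eta] with [phi = F sechpi ^ 2] and [psi = G sechpi ^ 2], and
    the hypothesis says that the product of the Fourier transforms of [phi] and [psi]
    vanishes identically ([charf_kernel_prod]).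

    Both [phi] and [psi] decay exponentially, so their transforms are analytic in a strip.
    If the transform of [phi] is nonzero at one point, it is nonzero nearby, so that the
    transform of [psi] vanishes near that point, hence everywhere
    ([charf_unique_continuation]).  By uniqueness of the Fourier transform
    ([charf_eq0_ae]) [F] or [G] vanishes almost everywhere on the line.

    It remains to see that a function [f] whose Mellin transform vanishes is zero
    ([mellin_injective]).  With [h t = f t / sqrt t], the truncated Mellin transforms of
    [f] are the Fourier transforms, along [ln t], of the truncations of [h].  They tend
    to zero in the mean, so pairing them with the function whose transform is
    [sechpi (lam (ln t - c))] gives that [h] is orthogonal to all these test functions.

    Both uniqueness statements, for the Fourier and for the Mellin transform, end in the
    same way: the functions [lam * sechpi (lam (x - c))], integrated over [c] in an
    interval, approximate the indicator of that interval as [lam] grows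
    ([sechpi_tests_vanish_itv]), and a function whose integral over every interval
    vanishes is zero almost everywhere. *)

Set Implicit Arguments.
Unset Strict Implicit.
Unset Printing Implicit Defensive.
Local Open Scope classical_set_scope.
Local Open Scope ring_scope.

(** * Integrals over the line and the half-line *)

Section real_integrable.
Context d (T : measurableType d) (R : realType) (mu : {measure set T -> \bar R}).
Variables (D : set T) (mD : measurable D).
Implicit Types f g : T -> R.

Lemma rintegrableZl (c : R) f : mu.-integrable D (EFin \o f) ->
  mu.-integrable D (EFin \o (fun x => c * f x)).
Proof. by move=> h; exact: (@integrableZl _ _ _ mu D mD c (EFin \o f) h). Qed.

Lemma rintegrableD f g : mu.-integrable D (EFin \o f) -> mu.-integrable D (EFin \o g) ->
  mu.-integrable D (EFin \o (fun x => f x + g x)).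
Proof. by move=> h k; exact: (@integrableD _ _ _ mu D mD _ _ h k). Qed.

Lemma rintegrableB f g : mu.-integrable D (EFin \o f) -> mu.-integrable D (EFin \o g) ->
  mu.-integrable D (EFin \o (fun x => f x - g x)).
Proof. by move=> h k; exact: (@integrableB _ _ _ mu D mD _ _ h k). Qed.

Lemma rintegrable_le f g : measurable_fun D f -> (forall x, D x -> `|f x| <= g x) ->
  mu.-integrable D (EFin \o g) -> mu.-integrable D (EFin \o f).
Proof.
move=> mf fg ig; apply: le_integrable ig => //; first exact/measurable_EFinP.
by move=> x Dx /=; rewrite lee_fin (le_trans (fg _ Dx)) // ler_norm.
Qed.

Lemma rintegrable_measurable f : mu.-integrable D (EFin \o f) -> measurable_fun D f.
Proof. by move=> /(measurable_int _) /measurable_EFinP. Qed.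

End real_integrable.

Section line.
Context {R : realType}.
Local Notation mu := (@lebesgue_measure R).

(** An exhaustion of the line, used to pass from compact intervals to improper
    integrals. *)
Definition symitv (n : nat) : set R := `[- n%:R, n%:R]%classic.

Lemma bigcup_symitv : \bigcup_n symitv n = [set: R].
Proof.
apply/seteqP; split => // x _.
exists (Num.truncn `|x|).+1 => //=; rewrite /symitv /= in_itv /= -ler_norml.
by rewrite ltW // truncnS_gt.
Qed.

Lemma nondecreasing_symitv :
  {homo symitv : n m / (n <= m)%N >-> (n <= m)%O}.
Proof.
move=> n m nm; apply/subsetPset => x; rewrite /symitv /= !in_itv /= => /andP[h1 h2].
by rewrite (le_trans _ h1) ?lerN2 ?ler_nat //= (le_trans h2) ?ler_nat.
Qed.

Lemma integral_itv_line (f F : R -> R) (n : nat) : continuous f ->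
  (forall x : R, is_derive x 1 F (f x)) ->
  (\int[mu]_(x in `[(- n.+1%:R)%R, n.+1%:R%R]) (f x)%:E)%E = (F n.+1%:R - F (- n.+1%:R))%:E.
Proof.
move=> cf dF.
have cF : continuous F.
  by move=> x; apply/differentiable_continuous/derivable1_diffP; case: (dF x).
rewrite (continuous_FTC2 (F := F)) //.
- by rewrite (@lt_trans _ _ 0) // ?oppr_lt0 ltr0n.
- exact: continuous_subspaceT.
- split; first by move=> x _; case: (dF x).
  + exact/cvg_at_right_filter/cF.
  + exact/cvg_at_left_filter/cF.
- by move=> x _; rewrite derive1E; case: (dF x).
Qed.

(** Monotone convergence along [symitv]: the partial integrals are at most [2 M]. *)
Lemma integrable_FTC_line (f F : R -> R) (M : R) : continuous f ->
  (forall x, 0 <= f x) -> (forall x : R, is_derive x 1 F (f x)) ->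
  (forall x, `|F x| <= M) -> mu.-integrable setT (EFin \o f).
Proof.
move=> cf f0 dF FM.
have mf : measurable_fun setT f by exact: continuous_measurable_fun.
apply/integrableP; split; first exact/measurable_EFinP.
under eq_integral do rewrite /= ger0_norm //.
suff : (\int[mu]_x (f x)%:E <= (2 * M)%:E)%E by move/le_lt_trans; apply; rewrite ltry.
have := @ge0_nondecreasing_set_cvg_integral _ (measurableTypeR R) R
  symitv (EFin \o f) mu nondecreasing_symitv
  (fun n => measurable_itv _) _ _.
rewrite bigcup_symitv => h.
have {}h : (\int[mu]_(x in `[(- n%:R)%R, n%:R%R]) (f x)%:E)%E @[n --> \oo] -->
   (\int[mu]_x (f x)%:E)%E.
  apply: h; last by move=> n x _; rewrite lee_fin.
  by move=> n; apply/measurable_EFinP/measurable_funTS.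
rewrite -(cvg_lim _ h) //; apply: lime_le; first by apply/cvg_ex; exists (\int[mu]_x (f x)%:E)%E.
exists 1%N => // -[//|n] _; rewrite (integral_itv_line _ _ dF) // lee_fin.
by rewrite (le_trans (ler_norm _)) // (le_trans (ler_normB _ _)) // mulr2n mulrDl mul1r lerD.
Qed.

Lemma cvg_Rintegral_line (f : R -> R) : mu.-integrable setT (EFin \o f) ->
  (\int[mu]_(x in `[- n.+1%:R, n.+1%:R]) f x)%R @[n --> \oo] --> (\int[mu]_x f x)%R.
Proof.
move=> intf.
apply: fine_cvg; rewrite fineK; last exact: integrable_fin_num.
under eq_fun do rewrite integral_mkcond.
apply: (@dominated_cvg _ _ _ mu setT measurableT _ _ (fun x => `|(f x)%:E|%E)).
- move=> n; apply/(measurable_restrictT _ _).1 => //.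
  by apply: measurable_funS (measurable_int _ intf).
- move=> x _ /=; apply: cvg_near_cst.
  exists (Num.truncn `|x|).+1 => //= n /= nx.
  rewrite patchE mem_set //= in_itv /= -ler_norml.
  rewrite ltW // (lt_le_trans (truncnS_gt _)) // ler_nat.
  exact: leq_trans nx _.
- by move=> x _.
- exact: integrable_abse.
- by move=> n x _ /=; rewrite patchE; case: ifP => // _; rewrite abse0.
Qed.

Lemma FTC_line (f F : R -> R) (l l' : R) : continuous f ->
  (forall x : R, is_derive x 1 F (f x)) -> mu.-integrable setT (EFin \o f) ->
  F n.+1%:R @[n --> \oo] --> l -> F (- n.+1%:R) @[n --> \oo] --> l' ->
  (\int[mu]_x f x)%R = l - l'.
Proof.
move=> cf dF intf Fl Fl'.
have h := cvg_Rintegral_line intf.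
rewrite -(cvg_lim _ h) //; apply/cvg_lim => //.
under eq_fun do rewrite /Rintegral (integral_itv_line _ cf dF) /=.
exact: cvgB.
Qed.

Lemma ge0_integral_affine (G : R -> R) (a c : R) : 0 < a -> continuous G ->
  (forall x, 0 <= G x) ->
  (\int[mu]_x (G x)%:E = \int[mu]_x (G (a * x + c) * a)%:E)%E.
Proof.
move=> a0 cG G0.
have dF (x : R) : is_derive x 1 (fun x : R => a * x + c) a.
  apply: is_derive_eq; rewrite /GRing.scale /=; ring.
have dE : derive1 (fun x : R => a * x + c) = cst a.
  by apply/funext => x; rewrite derive1E; case: (dF x).
rewrite (@increasing_ge0_integration_by_substitutionT _ (fun x => a * x + c) G) //.
- by apply: eq_integral => x _; rewrite dE.
- by move=> x y xy; rewrite ltrD2r ltr_pM2l.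
- by rewrite dE; exact: cst_continuous.
- by rewrite dE; exact: is_cvg_cst.
- by rewrite dE; exact: is_cvg_cst.
- apply/cvgrNyPle => A; near=> x.
  rewrite -lerBrDr -ler_pdivlMl //; near: x; exact: nbhs_ninfty_le.
- apply/cvgryPge => A; near=> x.
  rewrite -lerBlDr -ler_pdivrMl //; near: x; exact: nbhs_pinfty_ge.
Unshelve. all: by end_near. Qed.

(** Applied to the positive and to the negative part separately, the nonnegative case
    covers all signed integrands, integrable or not. *)
Lemma integral_affine (G : R -> R) (a c : R) : 0 < a -> continuous G ->
  (\int[mu]_x (G x)%:E = \int[mu]_x (G (a * x + c) * a)%:E)%E.
Proof.
move=> a0 cG; rewrite [LHS]integralE [RHS]integralE.
have cmax (H : R -> R) : continuous H -> continuous (fun x => Num.max (H x) 0).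
  by move=> cH x; apply: (@continuous_max _ _ H (cst 0)); [exact: cH|exact: cst_continuous].
congr (_ - _)%E.
- under eq_integral do rewrite funeposE -EFin_max.
  rewrite (ge0_integral_affine c a0) //; last by move=> x; rewrite le_max lexx orbT.
  + by apply: eq_integral => x _; rewrite funeposE -EFin_max maxr_pMl ?mul0r // ltW.
  + exact: cmax.
- under eq_integral do rewrite funenegE -EFinN -EFin_max.
  rewrite (ge0_integral_affine c a0) //; last by move=> x; rewrite le_max lexx orbT.
  + by apply: eq_integral => x _; rewrite funenegE -EFinN -EFin_max maxr_pMl ?mul0r ?mulNr // ltW.
  + by apply: cmax => x; apply: cvgN; exact: cG.
Qed.

Lemma integral_oppr (G : R -> R) : measurable_fun setT G ->
  (\int[mu]_x (G x)%:E = \int[mu]_x (G (- x))%:E)%E.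
Proof.
move=> mG.
have h (H : R -> \bar R) : measurable_fun setT H -> (forall x, 0 <= H x)%E ->
    (\int[mu]_x H x = \int[mu]_x H (- x)%R)%E.
  move=> mH H0.
  rewrite (@eq_measure_integral _ _ _ _ (pushforward lebesgue_measure (-%R%R : R -> measurableTypeR R))); last first.
    by move=> A mA _; exact/esym/lebesgue_measureN.
  by rewrite ge0_integral_pushforward.
rewrite [LHS]integralE [RHS]integralE; congr (_ - _)%E.
- rewrite h //; last exact/measurable_funepos/measurable_EFinP.
  by apply: eq_integral => x _; rewrite !funeposE.
- rewrite h //; last exact/measurable_funeneg/measurable_EFinP.
  by apply: eq_integral => x _; rewrite !funenegE.
Qed.

Lemma measurable_Rplus : measurable (@Rplus R).
Proof.
by rewrite (_ : @Rplus R = `]0, +oo[%classic) //; apply/seteqP; split => x /=; rewrite in_itv /= andbT.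
Qed.

Lemma open_Rplus : open (@Rplus R).
Proof. exact: open_gt. Qed.

Lemma measurable_fun_Rplus (G : R -> R) :
  (forall x, 0 < x -> {for x, continuous G}) -> measurable_fun (@Rplus R) G.
Proof.
move=> cG; apply: open_continuous_measurable_fun; first exact: open_Rplus.
by move=> x; rewrite inE => x0; exact: cG.
Qed.

Lemma bigcup_expR_itv :
  \bigcup_n `[expR (- n%:R), expR n%:R]%classic = @Rplus R.
Proof.
apply/seteqP; split => x.
  by move=> [n _] /=; rewrite in_itv /= /Rplus /= => /andP[h _]; rewrite (lt_le_trans _ h) ?expR_gt0.
rewrite /Rplus /= => x0; exists (Num.truncn `|ln x|).+1 => //=.
have xE : expR (ln x) = x by rewrite lnK // posrE.
by rewrite in_itv /= -xE !ler_expR -ler_norml ltW // expRK truncnS_gt.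
Qed.

(** The substitution [t = exp x] on [[exp (- n), exp n]], followed by monotone
    convergence in [n]. *)
Lemma ge0_integral_Rplus_expR (G : R -> R) : (forall x, 0 <= G x) ->
  (forall x, 0 < x -> {for x, continuous G}) ->
  (\int[mu]_(x in @Rplus R) (G x)%:E = \int[mu]_x (G (expR x) * expR x)%:E)%E.
Proof.
move=> G0 cG.
have mG := measurable_fun_Rplus cG.
have cH : continuous (fun x => G (expR x) * expR x).
  move=> x; apply: cvgM; last exact: continuous_expR.
  by apply: continuous_comp; [exact: continuous_expR | apply: cG; rewrite expR_gt0].
have dE : derive1 (@expR R) = expR by apply/funext => x; rewrite derive1E; case: (is_derive_expR x).
have h1 := @ge0_nondecreasing_set_cvg_integral _ (measurableTypeR R) R
  symitv (fun x => (G (expR x) * expR x)%:E) mu nondecreasing_symitv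
  (fun n => measurable_itv _).
rewrite bigcup_symitv in h1.
have h2 := @ge0_nondecreasing_set_cvg_integral _ (measurableTypeR R) R
  (fun n => `[expR (- n%:R), expR n%:R]%classic) (fun x => (G x)%:E) mu.
rewrite bigcup_expR_itv in h2.
apply: (@cvg_unique _ _ _ _ _ _ (h2 _ _ _ _) _); first exact: ereal_hausdorff.
- move=> n m nm; apply/subsetPset => x /=; rewrite !in_itv /= => /andP[a1 a2].
  by rewrite (le_trans _ a1) ?ler_expR ?lerN2 ?ler_nat //= (le_trans a2) ?ler_expR ?ler_nat.
- by move=> n; exact: measurable_itv.
- move=> n; apply/measurable_EFinP; apply: measurable_funS mG; first exact: measurable_Rplus.
  by rewrite -bigcup_expR_itv => x xn; exists n.
- by move=> n x _; rewrite lee_fin.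
have -> : (fun n : nat => \int[mu]_(x in `[expR (- n%:R)%R, expR n%:R]) (G x)%:E)%E =
   (fun n : nat => \int[mu]_(x in symitv n) (G (expR x) * expR x)%:E)%E.
  apply/funext => n.
  rewrite (@integration_by_substitution_increasing _ expR G) //.
  + by rewrite dE.
  + by rewrite (@le_trans _ _ 0) // oppr_le0.
  + by move=> x y _ _; rewrite ltr_expR.
  + by rewrite dE => x _; exact: continuous_expR.
  + by rewrite dE; apply/cvg_ex; eexists; exact/cvg_at_right_filter/continuous_expR.
  + by rewrite dE; apply/cvg_ex; eexists; exact/cvg_at_left_filter/continuous_expR.
  + split; first by move=> x _.
      exact/cvg_at_right_filter/continuous_expR.
    exact/cvg_at_left_filter/continuous_expR.
  + apply: continuous_in_subspaceT => x; rewrite inE /= in_itv /= => /andP[xn _].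
    by apply: cG; rewrite (lt_le_trans _ xn) ?expR_gt0.
have mH : measurable_fun setT (fun x => G (expR x) * expR x) by exact: continuous_measurable_fun.
apply: h1.
- by move=> n; apply/measurable_EFinP; apply: measurable_funTS.
- by move=> n x _; rewrite lee_fin mulr_ge0 ?expR_ge0.
Qed.

Lemma integral_Rplus_expR (G : R -> R) :
  (forall x, 0 < x -> {for x, continuous G}) ->
  (\int[mu]_(x in @Rplus R) (G x)%:E = \int[mu]_x (G (expR x) * expR x)%:E)%E.
Proof.
move=> cG; rewrite [LHS]integralE [RHS]integralE.
have cmax (H : R -> R) x : {for x, continuous H} ->
    {for x, continuous (fun x => Num.max (H x) 0)}.
  by move=> cH; apply: (@continuous_max _ _ H (cst 0)); [exact: cH|exact: cst_continuous].
congr (_ - _)%E.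
- under eq_integral do rewrite funeposE -EFin_max.
  rewrite ge0_integral_Rplus_expR //; last 2 first.
  + by move=> x; rewrite le_max lexx orbT.
  + by move=> x x0; apply: cmax; exact: cG.
  by apply: eq_integral => x _; rewrite funeposE -EFin_max maxr_pMl ?mul0r // expR_ge0.
- under eq_integral do rewrite funenegE -EFinN -EFin_max.
  rewrite (@ge0_integral_Rplus_expR (fun x => Num.max (- G x) 0)) //; last 2 first.
  + by move=> x; rewrite le_max lexx orbT.
  + by move=> x x0; apply: cmax; apply: cvgN; exact: cG.
  by apply: eq_integral => x _; rewrite funenegE -EFinN -EFin_max maxr_pMl ?mul0r ?mulNr // expR_ge0.
Qed.
End line.

(** * The Fourier transform of the hyperbolic secant *)

Section sech.
Context {R : realType}.
Local Notation mu := (@lebesgue_measure R).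
Implicit Types x y t tau theta : R.

(** This is [1 / (2 cosh (y / 2))]. *)
Definition sechk y : R := expR (y / 2) / (1 + expR y).

Lemma oneDexpR_gt0 y : 0 < 1 + expR y.
Proof. by rewrite addr_gt0 // expR_gt0. Qed.

Lemma expR_half y : expR y = expR (y / 2) ^+ 2.
Proof. by rewrite expr2 -expRD -splitr. Qed.

Lemma sechk_gt0 y : 0 < sechk y.
Proof. by rewrite divr_gt0 ?expR_gt0 ?oneDexpR_gt0. Qed.

Lemma continuous_of_derive (f df : R -> R) :
  (forall x : R, is_derive x 1 f (df x)) -> continuous f.
Proof. by move=> h x; apply/differentiable_continuous/derivable1_diffP; case: (h x). Qed.

Lemma continuous_sechk : continuous sechk.
Proof.
move=> y; apply: cvgM.
  by apply: continuous_comp; [apply: cvgM; [exact: cvg_id|exact: cvg_cst]|exact: continuous_expR].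
apply: cvgV; first by rewrite gt_eqF ?oneDexpR_gt0.
by apply: cvgD; [exact: cvg_cst|exact: continuous_expR].
Qed.

Lemma sechk_le_expR y : sechk y <= expR (y / 2).
Proof. by rewrite ler_pdivrMr ?oneDexpR_gt0 // ler_peMr ?expR_ge0 // lerDl expR_ge0. Qed.

Lemma sechkN y : sechk (- y) = sechk y.
Proof.
rewrite /sechk mulNr !expRN (expR_half y).
have := expR_gt0 (y / 2); set X := expR _ => X0.
by field; rewrite !gt_eqF // addr_gt0 // exprn_gt0.
Qed.

Lemma atan_bound x : `|atan x| <= pi / 2.
Proof. by rewrite ler_norml !ltW ?atan_gtNpi2 ?atan_ltpi2. Qed.

Lemma integrable_sechk : mu.-integrable setT (EFin \o sechk).
Proof.
apply: (@integrable_FTC_line _ _ (fun y => 2 * atan (expR (y / 2))) pi).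
- exact: continuous_sechk.
- by move=> y; exact/ltW/sechk_gt0.
- move=> y; apply: is_derive_eq; rewrite /GRing.scale /= /sechk (expR_half y).
  have := expR_gt0 (y / 2); set X := expR _ => X0.
  by field; rewrite gt_eqF // addr_gt0 // exprn_gt0.
- by move=> y; rewrite normrM gtr0_norm // mulrC -ler_pdivlMr // atan_bound.
Qed.

Lemma sechk_nat_cvg0 : sechk n.+1%:R @[n --> \oo] --> (0 : R).
Proof.
apply: (@squeeze_cvgr _ _ _ _ (cst 0) (fun n : nat => expR (- (n.+1%:R / 2)))).
- near=> n; rewrite ltW ?sechk_gt0 //= -sechkN; apply: (le_trans (sechk_le_expR _)).
  by rewrite mulNr.
- exact: cvg_cst.
- apply: (@cvg_comp _ _ _ (fun n : nat => n.+1%:R / 2 : R) (fun x => expR (- x)) _ +oo%R); last exact: cvgr_expR.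
  apply/cvgryPge => A; exists (Num.truncn `|A * 2|) => // n /= hn.
  by rewrite ler_pdivlMr // (le_trans (ler_norm _)) // ltW // (lt_le_trans (truncnS_gt _)) // ler_nat.
Unshelve. all: by end_near. Qed.

Lemma norm_sin_le x : `|sin x| <= `|x|.
Proof.
wlog x0 : x / 0 <= x.
  move=> h; have [/h//|/ltW x0] := leP 0 x.
  by rewrite -normrN -sinN -[leRHS]normrN h // oppr_ge0.
have [c _] := @MVT_segment R sin cos 0 x x0 (fun x _ => is_derive_sin x)
  (continuous_subspaceT (@continuous_sin R)).
rewrite sin0 !subr0 => ->; rewrite normrM ler_piMl //; exact: cos_max.
Qed.

Lemma one_sub_cos_le x : 1 - cos x <= x ^+ 2 / 2.
Proof.
have -> : 1 - cos x = 2 * sin (x / 2) ^+ 2.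
  have {1}-> : x = (x / 2) *+ 2 by rewrite -mulr_natr; field.
  by rewrite cos_mulr2n sin2cos2 -mulr_natr; ring.
have := norm_sin_le (x / 2); rewrite -ler_sqr ?nnegrE // !real_normK ?num_real //.
by lra.
Qed.

(** That is, [y ^ 2 / 4 <= 4 sinh (y / 2) ^ 2]. *)
Lemma expR_sub_ge y : y ^+ 2 / 4 <= (expR (y / 2) - expR (- (y / 2))) ^+ 2.
Proof.
wlog y0 : y / 0 <= y.
  move=> h; have [/h//|/ltW x0] := leP 0 y.
  have := h (- y); rewrite sqrrN oppr_ge0 mulNr opprK => /(_ x0).
  by rewrite -[X in _ -> _ <= X]sqrrN opprB.
have h1 := expR_ge1Dx (y / 2).
have h2 : expR (- (y / 2)) <= 1 by rewrite expR_le1 oppr_le0 divr_ge0.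
have -> : y ^+ 2 / 4 = (y / 2) ^+ 2 by field.
rewrite ler_sqr ?nnegrE; lra.
Qed.

(** The inequality compares [1 - cos (tau y)], which is [O (y ^ 2)] and bounded, with
    [tanh (y / 2) ^ 2]. It is what keeps the estimate of [one_sub_cos_ctrW] uniform as
    the contour approaches the pole at [i pi]. *)
Lemma one_sub_cos_sech_bound tau y :
  (1 - cos (tau * y)) * (1 + expR y) ^+ 2 <= (2 + 8 * tau ^+ 2) * (1 - expR y) ^+ 2.
Proof.
have h1 := one_sub_cos_le (tau * y).
have h2 := cos_geN1 (tau * y).
have := expR_sub_ge y; rewrite expRN (expR_half y).
have := expR_gt0 (y / 2); set X := expR _ => X0 h3.
have {h3} h3 : y ^+ 2 / 4 * X ^+ 2 <= (1 - X ^+ 2) ^+ 2.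
  have -> : (1 - X ^+ 2) ^+ 2 = (X - X^-1) ^+ 2 * X ^+ 2 by field; rewrite gt_eqF.
  by rewrite ler_wpM2r // exprn_ge0 // ltW.
have -> : (1 - cos (tau * y)) * (1 + X ^+ 2) ^+ 2 =
  (1 - cos (tau * y)) * (1 - X ^+ 2) ^+ 2 + 4 * ((1 - cos (tau * y)) * X ^+ 2) by ring.
have h4 : (1 - cos (tau * y)) * (1 - X ^+ 2) ^+ 2 <= 2 * (1 - X ^+ 2) ^+ 2.
  by rewrite ler_wpM2r ?sqr_ge0 //; lra.
have h5 : (1 - cos (tau * y)) * X ^+ 2 <= (tau * y) ^+ 2 / 2 * X ^+ 2.
  by rewrite ler_wpM2r ?sqr_ge0.
have h6 : tau ^+ 2 * (y ^+ 2 / 4 * X ^+ 2) <= tau ^+ 2 * (1 - X ^+ 2) ^+ 2.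
  by rewrite ler_wpM2l ?sqr_ge0.
have h7 : (tau * y) ^+ 2 / 2 * X ^+ 2 = 2 * (tau ^+ 2 * (y ^+ 2 / 4 * X ^+ 2)) by field.
lra.
Qed.

(** With [z = y + i theta], this is [|1 + exp z| ^ 2], the square of the modulus of the
    denominator of [exp (i tau z) * exp (z / 2) / (1 + exp z)]; the real and the
    imaginary part of this holomorphic function are [ctrRe] and [ctrIm], and [dctrIm] is
    the derivative of the latter in [y]. *)
Definition ctrN theta y : R := 1 + 2 * cos theta * expR y + expR y ^+ 2.

Definition ctrRe tau theta y : R := expR (y / 2 - tau * theta) *
  (cos (tau * y + theta / 2) + expR y * cos (tau * y - theta / 2)) / ctrN theta y.

Definition ctrIm tau theta y : R := expR (y / 2 - tau * theta) *
  (sin (tau * y + theta / 2) + expR y * sin (tau * y - theta / 2)) / ctrN theta y.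

Definition dctrIm tau theta y : R := expR (y / 2 - tau * theta) *
  (((sin (tau * y + theta / 2) + expR y * sin (tau * y - theta / 2)) / 2 +
    tau * (cos (tau * y + theta / 2) + expR y * cos (tau * y - theta / 2)) +
    expR y * sin (tau * y - theta / 2)) / ctrN theta y -
   (sin (tau * y + theta / 2) + expR y * sin (tau * y - theta / 2)) *
   (2 * cos theta * expR y + 2 * expR y ^+ 2) / ctrN theta y / ctrN theta y).

Lemma ctrN_ge theta y : (1 + cos theta) / 2 * (1 + expR y) ^+ 2 <= ctrN theta y.
Proof.
rewrite /ctrN; have := cos_le1 theta; have := expR_gt0 y; set E := expR y => E0 h.
have -> : 1 + 2 * cos theta * E + E ^+ 2 = (1 + cos theta) / 2 * (1 + E) ^+ 2 +
   (1 - cos theta) / 2 * (1 - E) ^+ 2 by field.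
by rewrite lerDl mulr_ge0 ?sqr_ge0 // divr_ge0 // subr_ge0.
Qed.

Lemma cos_gtN1 theta : - pi < theta < pi -> -1 < cos theta.
Proof.
move=> /andP[h1 h2]; rewrite -(cospi R) -(cos_norm theta) ltr_cos ?in_itv //=.
- by rewrite ltr_norml h1.
- by rewrite normr_ge0 /= ltW // ltr_norml h1.
- by rewrite pi_ge0 lexx.
Qed.

Lemma ctrN_gt0 theta y : - pi < theta < pi -> 0 < ctrN theta y.
Proof.
move=> /cos_gtN1 h; apply: lt_le_trans (ctrN_ge _ _).
by rewrite mulr_gt0 ?exprn_gt0 ?oneDexpR_gt0 // divr_gt0 // -ltrBlDl sub0r.
Qed.

Lemma is_derive_ctrIm tau theta y : - pi < theta < pi ->
  is_derive y 1 (ctrIm tau theta) (dctrIm tau theta y).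
Proof.
move=> h; have N0 : ctrN theta y != 0 by rewrite gt_eqF // ctrN_gt0.
have dN : is_derive y 1 (ctrN theta) (2 * cos theta * expR y + 2 * expR y ^+ 2).
  by rewrite /ctrN; apply: is_derive_eq; rewrite /GRing.scale /=; ring.
have dV := is_deriveV N0 dN.
rewrite /ctrIm; apply: is_derive_eq; rewrite /GRing.scale /= /dctrIm; by field.
Qed.

(** With [is_derive_ctrIm], this is a Cauchy-Riemann equation: the derivative of the
    real part across the strip is minus the derivative of the imaginary part along
    it. *)
Lemma is_derive_ctrRe tau theta y : - pi < theta < pi ->
  is_derive theta 1 (fun t => ctrRe tau t y) (- dctrIm tau theta y).
Proof.
move=> h; have N0 : ctrN theta y != 0 by rewrite gt_eqF // ctrN_gt0.
have dN : is_derive theta 1 (fun t => ctrN t y) (- (2 * sin theta * expR y)).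
  by rewrite /ctrN; apply: is_derive_eq; rewrite /GRing.scale /=; ring.
have dV := @is_deriveV _ (fun t => ctrN t y) _ _ _ N0 dN.
have e1 : sin (tau * y - theta / 2) = sin (tau * y + theta / 2) * cos theta -
    cos (tau * y + theta / 2) * sin theta.
  by rewrite -sinB; congr sin; field.
have e2 : sin (tau * y + theta / 2) = sin (tau * y - theta / 2) * cos theta +
    cos (tau * y - theta / 2) * sin theta.
  by rewrite -sinD; congr sin; field.
(* The vectors (cosine, sine) of [tau y + theta / 2] and of [tau y - theta / 2] differ
   by a rotation of angle [theta]. *)
have key : sin (tau * y - theta / 2) * ctrN theta y +
  sin theta * (cos (tau * y + theta / 2) + expR y * cos (tau * y - theta / 2)) -
  (sin (tau * y + theta / 2) + expR y * sin (tau * y - theta / 2)) * (cos theta + expR y) = 0.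
  move/eqP: e1; rewrite -subr_eq0 => /eqP e1; move/eqP: e2; rewrite eq_sym -subr_eq0 => /eqP e2.
  rewrite -[RHS](addr0) -{1}e1 -(mulr0 (expR y)) -e2 /ctrN; ring.
rewrite /ctrRe; apply: is_derive_eq; rewrite /GRing.scale /= /dctrIm.
move: key N0; set sa := sin (tau * y + theta / 2); set sb := sin (tau * y - theta / 2).
set ca := cos (tau * y + theta / 2); set cb := cos (tau * y - theta / 2); set N := ctrN _ _; set st := sin theta; set ct := cos theta.
set E := expR y; set X := expR _ => key N0.
apply/eqP; rewrite -subr_eq0; apply/eqP.
transitivity (2 * E * X / N ^+ 2 * (sb * N + st * (ca + E * cb) - (sa + E * sb) * (ct + E))).
  by field.
by rewrite key mulr0.
Qed.

Lemma sechk_ctrN_bound theta y : - pi < theta < pi ->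
  expR (y / 2) * (1 + expR y) / ctrN theta y <= sechk y * (2 / (1 + cos theta)).
Proof.
move=> h; have c0 : 0 < 1 + cos theta by rewrite -ltrBlDl sub0r cos_gtN1.
have N0 := ctrN_gt0 y h; have := ctrN_ge theta y.
rewrite /sechk; have := oneDexpR_gt0 y; set F := 1 + expR y => F0 hN.
rewrite ler_pdivrMr //.
have -> : expR (y / 2) / F * (2 / (1 + cos theta)) * ctrN theta y =
   expR (y / 2) * (ctrN theta y * (2 / (1 + cos theta)) / F) by field; rewrite !gt_eqF.
rewrite ler_pM2l ?expR_gt0 // ler_pdivlMr // -expr2 -ler_pdivrMr ?divr_gt0 // invf_div.
by rewrite mulrC.
Qed.

(** On each line of the open strip [|theta| < pi] every function at hand is dominated by
    [sechk], with a constant that is locally bounded in [theta]. *)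
Lemma ctr_bound tau theta y T : - pi < theta < pi -> `|T| <= 1 + expR y ->
  `|expR (y / 2 - tau * theta) * T / ctrN theta y| <=
  sechk y * (2 / (1 + cos theta)) * expR `|tau * theta|.
Proof.
move=> h hT; have N0 := ctrN_gt0 y h.
apply: (@le_trans _ _ (expR (y / 2) * (1 + expR y) / ctrN theta y * expR (- (tau * theta)))).
  rewrite !normrM normfV (gtr0_norm N0) gtr0_norm ?expR_gt0 // expRD.
  rewrite [leLHS](_ : _ = expR (y / 2) * expR (- (tau * theta)) / ctrN theta y * `|T|); last by ring.
  rewrite [leRHS](_ : _ = expR (y / 2) * expR (- (tau * theta)) / ctrN theta y * (1 + expR y)); last by ring.
  by rewrite ler_wpM2l // divr_ge0 ?mulr_ge0 ?expR_ge0 // ltW.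
apply: ler_pM; rewrite ?expR_ge0 ?divr_ge0 ?mulr_ge0 ?expR_ge0 ?(ltW (oneDexpR_gt0 y)) ?(ltW N0) //.
  exact: sechk_ctrN_bound.
by rewrite ler_expR -normrN ler_norm.
Qed.

Lemma ctrRe_bound tau theta y : - pi < theta < pi ->
  `|ctrRe tau theta y| <= sechk y * (2 / (1 + cos theta)) * expR `|tau * theta|.
Proof.
move=> h; apply: ctr_bound => //.
rewrite (le_trans (ler_normD _ _)) // lerD ?cos_max // normrM (gtr0_norm (expR_gt0 _)).
by rewrite ler_piMr ?expR_ge0 // cos_max.
Qed.

Lemma ctrIm_bound tau theta y : - pi < theta < pi ->
  `|ctrIm tau theta y| <= sechk y * (2 / (1 + cos theta)) * expR `|tau * theta|.
Proof.
move=> h; apply: ctr_bound => //.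
rewrite (le_trans (ler_normD _ _)) // lerD ?sin_max // normrM (gtr0_norm (expR_gt0 _)).
by rewrite ler_piMr ?expR_ge0 // sin_max.
Qed.

Lemma dctrIm_bound tau theta y : - pi < theta < pi ->
  `|dctrIm tau theta y| <=
  (2 + `|tau| + 4 / (1 + cos theta)) * (sechk y * (2 / (1 + cos theta)) * expR `|tau * theta|).
Proof.
move=> h; have N0 := ctrN_gt0 y h.
have c0 : 0 < 1 + cos theta by rewrite -ltrBlDl sub0r cos_gtN1.
set sa := sin (tau * y + theta / 2); set sb := sin (tau * y - theta / 2).
set ca := cos (tau * y + theta / 2); set cb := cos (tau * y - theta / 2).
have -> : dctrIm tau theta y = ctrIm tau theta y / 2 + tau * ctrRe tau theta y +
    expR (y / 2 - tau * theta) * (expR y * sb) / ctrN theta y -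
    ctrIm tau theta y * ((2 * cos theta * expR y + 2 * expR y ^+ 2) / ctrN theta y).
  rewrite /dctrIm /ctrIm /ctrRe -/sa -/sb -/ca -/cb; field; exact: lt0r_neq0.
have h1 := ctrIm_bound tau y h; have h2 := ctrRe_bound tau y h.
have h3 : `|expR (y / 2 - tau * theta) * (expR y * sb) / ctrN theta y| <=
  sechk y * (2 / (1 + cos theta)) * expR `|tau * theta|.
  apply: ctr_bound => //; rewrite normrM (gtr0_norm (expR_gt0 _)).
  by rewrite (@le_trans _ _ (expR y)) ?lerDr // ler_piMr ?expR_ge0 // sin_max.
have h4 : `|(2 * cos theta * expR y + 2 * expR y ^+ 2) / ctrN theta y| <= 4 / (1 + cos theta).
  rewrite normrM normfV (gtr0_norm N0) ler_pdivrMr //.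
  rewrite (@le_trans _ _ (2 * (1 + expR y) ^+ 2)) //.
    have := expR_gt0 y; set E := expR y => E0.
    have c1 : 0 <= (1 - cos theta) * E by rewrite mulr_ge0 ?(ltW E0) // subr_ge0 cos_le1.
    have c2 : 0 <= (1 + cos theta) * E by rewrite mulr_ge0 ?(ltW E0) // ltW.
    have E2 : 0 <= E ^+ 2 by rewrite sqr_ge0.
    by rewrite ler_norml; apply/andP; split; lra.
  rewrite mulrAC ler_pdivlMr //; have := ctrN_ge theta y; lra.
set B := sechk y * _ * _ in h1 h2 h3 *.
have B0 : 0 <= B by apply: le_trans h1.
rewrite (le_trans (ler_normB _ _)) // [leRHS]mulrDl lerD //; last first.
  by rewrite normrM mulrC ler_pM.
rewrite (le_trans (ler_normD _ _)) // (_ : (2 + `|tau|) * B = (B + `|tau| * B) + B); last by ring.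
rewrite lerD // (le_trans (ler_normD _ _)) // lerD //; last by rewrite normrM ler_wpM2l.
by rewrite normrM (@ger0_norm _ 2^-1) ?invr_ge0 // ler_pdivrMr // (le_trans h1) // ler_peMr // ler1n.
Qed.

Lemma continuous_ctrRe tau theta : - pi < theta < pi -> continuous (ctrRe tau theta).
Proof.
move=> h y; have N0 : ctrN theta y != 0 by rewrite gt_eqF // ctrN_gt0.
apply: differentiable_continuous; apply/derivable1_diffP.
have dN : is_derive y 1 (ctrN theta) (2 * cos theta * expR y + 2 * expR y ^+ 2).
  by rewrite /ctrN; apply: is_derive_eq; rewrite /GRing.scale /=; ring.
have dV := is_deriveV N0 dN.
by rewrite /ctrRe; apply: ex_derive.
Qed.

Lemma continuous_dctrIm tau theta : - pi < theta < pi -> continuous (dctrIm tau theta).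
Proof.
move=> h y; have N0 : ctrN theta y != 0 by rewrite gt_eqF // ctrN_gt0.
apply: differentiable_continuous; apply/derivable1_diffP.
have dN : is_derive y 1 (ctrN theta) (2 * cos theta * expR y + 2 * expR y ^+ 2).
  by rewrite /ctrN; apply: is_derive_eq; rewrite /GRing.scale /=; ring.
have dV := is_deriveV N0 dN.
by rewrite /dctrIm; apply: ex_derive.
Qed.

Lemma integrable_le_sechk (f : R -> R) (C : R) : measurable_fun setT f ->
  (forall y, `|f y| <= C * sechk y) -> mu.-integrable setT (EFin \o f).
Proof.
move=> mf fC; apply: (@rintegrable_le _ _ _ mu _ _ _ (fun y => C * sechk y)) => //.
exact/rintegrableZl/integrable_sechk.
Qed.

Lemma integrable_ctrRe tau theta : - pi < theta < pi ->
  mu.-integrable setT (EFin \o ctrRe tau theta).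
Proof.
move=> h; apply: (@integrable_le_sechk _ (2 / (1 + cos theta) * expR `|tau * theta|)).
  by apply: continuous_measurable_fun; exact: continuous_ctrRe.
by move=> y; rewrite mulrC mulrA ctrRe_bound.
Qed.

(** The integrand is the derivative of [ctrIm], which tends to zero at both ends. *)
Lemma integral_dctrIm tau theta : - pi < theta < pi -> (\int[mu]_y dctrIm tau theta y)%R = 0.
Proof.
move=> h; rewrite -(subrr 0).
have hb y : `|ctrIm tau theta y| <= sechk y * ((2 / (1 + cos theta)) * expR `|tau * theta|).
  by rewrite mulrA ctrIm_bound.
have c0 : sechk n.+1%:R * ((2 / (1 + cos theta)) * expR `|tau * theta|) @[n --> \oo] --> (0 : R).
  rewrite -(mul0r ((2 / (1 + cos theta)) * expR `|tau * theta|)).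
  by apply: cvgM; [exact: sechk_nat_cvg0|exact: cvg_cst].
have c0' (u : nat -> R) : (forall n, `|u n| <= sechk n.+1%:R * ((2 / (1 + cos theta)) * expR `|tau * theta|)) ->
    u n @[n --> \oo] --> (0 : R).
  move=> hu; apply/norm_cvg0P.
  by apply: (@squeeze_cvgr _ _ _ _ (cst 0) _ _ _ _ (cvg_cst _) c0); apply: nearW => n; rewrite normr_ge0 hu.
apply: (@FTC_line _ (dctrIm tau theta) (ctrIm tau theta) 0 0).
- exact: continuous_dctrIm.
- by move=> y; exact: is_derive_ctrIm.
- apply: (@integrable_le_sechk _ ((2 + `|tau| + 4 / (1 + cos theta)) * (2 / (1 + cos theta) * expR `|tau * theta|))).
    by apply: continuous_measurable_fun; exact: continuous_dctrIm.
  by move=> y; rewrite (le_trans (dctrIm_bound tau y h)) // le_eqVlt; apply/orP; left; apply/eqP; ring.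
- exact: c0'.
- by apply: c0' => n; rewrite (le_trans (hb _)) // sechkN.
Qed.

(** By parity of [sechk] this is its whole Fourier transform, not just the cosine
    part. *)
Definition sechFT tau : R := (\int[mu]_y (cos (tau * y) * sechk y))%R.

(** The shift of contour from the real line to the line [Im z = theta], done without
    contour integrals: the derivative of the integral in [theta] is [- \int dctrIm],
    which vanishes. *)
Lemma integral_ctrRe tau theta : - pi < theta < pi ->
  (\int[mu]_y ctrRe tau theta y)%R = sechFT tau.
Proof.
move=> hth.
have -> : sechFT tau = (\int[mu]_y ctrRe tau 0 y)%R.
  apply: eq_Rintegral => y _; rewrite /ctrRe /ctrN /sechk !mul0r !mulr0 !subr0 addr0 cos0.
  have := oneDexpR_gt0 y; set E := expR y => E0.
  have -> : 1 + 2 * 1 * E + E ^+ 2 = (1 + E) ^+ 2 by ring.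
  by field; rewrite gt_eqF.
(* A closed strip inside [|theta| < pi], on which the constants of [dctrIm_bound] are
   uniform. *)
pose t := (`|theta| + pi) / 2.
have thpi : `|theta| < pi by rewrite ltr_norml.
have th_t : `|theta| < t by rewrite /t; lra.
have tpi : t < pi by rewrite /t; lra.
have t0 : 0 < t by apply: le_lt_trans th_t.
have It x : `]- t, t[%classic x -> - pi < x < pi.
  by rewrite /= in_itv /= => /andP[? ?]; apply/andP; split; lra.
have cost x : `]- t, t[%classic x -> cos t <= cos x.
  rewrite /= in_itv /= => /andP[xt1 xt2]; rewrite -(cos_norm x) ltW // ltr_cos ?in_itv /= ?normr_ge0 /=.
  - by rewrite ltr_norml xt1.
  - by rewrite ltW // (lt_trans _ tpi) // ltr_norml xt1.
  - by rewrite !ltW.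
have ct0 : 0 < 1 + cos t.
  by rewrite -ltrBlDl sub0r cos_gtN1 // tpi andbT; lra.
pose J th := (\int[mu]_y ctrRe tau th y)%R.
pose C := (2 + `|tau| + 4 / (1 + cos t)) * (2 / (1 + cos t) * expR (`|tau| * pi)).
have dJ x : `]- t, t[%classic x -> is_derive x 1 J 0.
  move=> Ix.
  have dE z y : `]- t, t[%classic z -> partial1of2 (ctrRe tau) z y = - dctrIm tau z y.
    move=> Iz; rewrite partial1of2E; have [_ <-] := is_derive_ctrRe tau y (It z Iz); by [].
  have H1 z : `]- t, t[%classic z -> mu.-integrable setT (EFin \o ctrRe tau z).
    by move=> Iz; exact/integrable_ctrRe/It.
  have H2 z y : `]- t, t[%classic z -> setT y -> derivable (fun u => ctrRe tau u y) z 1.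
    by move=> Iz _; have [] := is_derive_ctrRe tau y (It z Iz).
  have G0 y : 0 <= C * sechk y.
    by rewrite !mulr_ge0 ?addr_ge0 ?divr_ge0 ?(ltW ct0) ?expR_ge0 // ltW // sechk_gt0.
  have intG : mu.-integrable setT (EFin \o (fun y => C * sechk y)).
    apply: (@integrable_le_sechk _ C).
      by apply: continuous_measurable_fun => y; apply: cvgM; [exact: cvg_cst|exact: continuous_sechk].
    by move=> y; rewrite ger0_norm.
  have GU z y : `]- t, t[%classic z -> setT y -> `|partial1of2 (ctrRe tau) z y| <= C * sechk y.
    move=> Iz _; rewrite dE // normrN (le_trans (dctrIm_bound tau y (It z Iz))) //.
    have cz := cost z Iz.
    have cz0 : 0 < 1 + cos z by lra.
    have z2 : 2 / (1 + cos z) <= 2 / (1 + cos t) by rewrite ler_pM2l // lef_pV2 ?posrE //; lra.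
    have z4 : 4 / (1 + cos z) <= 4 / (1 + cos t) by rewrite ler_pM2l // lef_pV2 ?posrE //; lra.
    rewrite [leRHS](_ : _ = (2 + `|tau| + 4 / (1 + cos t)) *
      (sechk y * (2 / (1 + cos t)) * expR (`|tau| * pi))); last by rewrite /C; ring.
    apply: ler_pM.
    - by rewrite !addr_ge0 // divr_ge0 // ltW.
    - by rewrite !mulr_ge0 ?expR_ge0 ?invr_ge0 ?(ltW cz0) ?(ltW (sechk_gt0 _)).
    - by rewrite lerD2l.
    apply: ler_pM; rewrite ?expR_ge0 //.
    - by rewrite !mulr_ge0 ?invr_ge0 ?(ltW cz0) ?(ltW (sechk_gt0 _)).
    - by rewrite ler_pM2l ?sechk_gt0.
    - rewrite ler_expR normrM ler_wpM2l // ltW //; move/It : Iz; by rewrite ltr_norml.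
  apply: DeriveDef.
    exact: (derivable_under_integral measurableT Ix H1 H2 G0 intG GU).
  rewrite -derive1E (differentiation_under_integral measurableT Ix H1 H2 G0 intG GU).
  transitivity (\int[mu]_y (- 1 * dctrIm tau x y))%R.
    by apply: eq_Rintegral => y _; rewrite dE // mulN1r.
  rewrite RintegralZl //; first by rewrite integral_dctrIm ?mulr0 //; exact: It.
  have -> : EFin \o dctrIm tau x = (fun y => (-1)%:E * (EFin \o (fun y => partial1of2 (ctrRe tau) x y)) y)%E.
    by apply/funext => y /=; rewrite dE // -EFinM mulN1r opprK.
  apply: integrableZl => //.
  apply: le_integrable intG => //.
  - apply/measurable_EFinP.
    rewrite (_ : (fun y => _) = (fun y => - dctrIm tau x y)); last by apply/funext => y; exact: dE.
    apply: measurableT_comp => //; apply: continuous_measurable_fun.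
    by apply: continuous_dctrIm; exact: It.
  - by move=> y _ /=; rewrite lee_fin (le_trans (GU x y Ix I)) // ler_norm.
have JE a b : a <= b -> `]- t, t[%classic a -> `]- t, t[%classic b -> J a = J b.
  move=> ab Ia Ib.
  have sub z : z \in `[a, b] -> `]- t, t[%classic z.
    move: Ia Ib; rewrite /= !in_itv /= => /andP[? ?] /andP[? ?] /andP[? ?]; apply/andP; split; lra.
  have [c _] := @MVT_segment R J (cst 0) a b ab
    (fun z zi => dJ z (sub z (subset_itv_oo_cc zi)))
    (derivable_within_continuous (fun z zi => @ex_derive _ _ _ _ _ _ _ (dJ z (sub z zi)))).
  by rewrite mul0r => /eqP; rewrite subr_eq0 => /eqP.
have I0 : `]- t, t[%classic (0 : R) by rewrite /= in_itv /= oppr_lt0 t0.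
have Ith : `]- t, t[%classic theta by rewrite /= in_itv /= -ltr_norml.
by have [h|/ltW h] := leP theta 0; [exact: JE|apply/esym; exact: JE].
Qed.

(** The real part of [1 / (2 cosh (z / 2))] on the line [Im z = theta]. It has the
    constant mass [pi] and concentrates at [y = 0] as [theta] tends to [pi]. *)
Definition ctrW theta y : R := cos (theta / 2) * (expR (y / 2) * (1 + expR y)) / ctrN theta y.

Lemma ctrNE theta y : ctrN theta y = (1 - expR y) ^+ 2 + 4 * cos (theta / 2) ^+ 2 * expR y.
Proof.
rewrite /ctrN; have {1}-> : theta = (theta / 2) *+ 2 by rewrite -mulr_natr; field.
by rewrite cos_mulr2n -mulr_natr; ring.
Qed.

Lemma cos_half_gt0 theta : - pi < theta < pi -> 0 < cos (theta / 2).
Proof. by move=> /andP[? ?]; apply: cos_gt0_pihalf; apply/andP; split; lra. Qed.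

Lemma is_derive_ctrW theta y : - pi < theta < pi ->
  is_derive y 1 (fun y => atan ((expR (y / 2) - expR (- (y / 2))) / (2 * cos (theta / 2))))
  (ctrW theta y).
Proof.
move=> h; have e0 := cos_half_gt0 h.
apply: is_derive_eq; rewrite /GRing.scale /= /ctrW ctrNE expRN (expR_half y).
have := expR_gt0 (y / 2); set X := expR _ => X0; set e := cos _ in e0 *.
have N0 : 0 < (1 - X ^+ 2) ^+ 2 + 4 * e ^+ 2 * X ^+ 2.
  by rewrite ltr_wpDl ?sqr_ge0 // !mulr_gt0 ?exprn_gt0.
field; rewrite !gt_eqF //=.
Qed.

Lemma ctrW_ge0 theta y : - pi < theta < pi -> 0 <= ctrW theta y.
Proof.
move=> h; rewrite divr_ge0 ?(ltW (ctrN_gt0 y h)) // !mulr_ge0 ?expR_ge0 //.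
exact/ltW/cos_half_gt0.
Qed.

Lemma continuous_ctrW theta : - pi < theta < pi -> continuous (ctrW theta).
Proof.
move=> h y; have N0 : ctrN theta y != 0 by rewrite gt_eqF // ctrN_gt0.
apply: differentiable_continuous; apply/derivable1_diffP.
have dN : is_derive y 1 (ctrN theta) (2 * cos theta * expR y + 2 * expR y ^+ 2).
  by rewrite /ctrN; apply: is_derive_eq; rewrite /GRing.scale /=; ring.
have dV := is_deriveV N0 dN.
by rewrite /ctrW; apply: ex_derive.
Qed.

Lemma integrable_ctrW theta : - pi < theta < pi -> mu.-integrable setT (EFin \o ctrW theta).
Proof.
move=> h; apply: (integrable_FTC_line (continuous_ctrW h)).
- by move=> y; exact: ctrW_ge0.
- by move=> y; exact: is_derive_ctrW.
- by move=> y /=; exact: atan_bound.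
Qed.

Lemma integral_ctrW theta : - pi < theta < pi -> (\int[mu]_y ctrW theta y)%R = pi.
Proof.
move=> h; have e0 := cos_half_gt0 h.
have lim : atan ((expR (n.+1%:R / 2) - expR (- (n.+1%:R / 2))) / (2 * cos (theta / 2)))
    @[n --> \oo] --> (pi / 2 : R).
  apply: (@cvg_comp _ _ _ (fun n : nat => (expR (n.+1%:R / 2) - expR (- (n.+1%:R / 2))) / (2 * cos (theta / 2)))
    (@atan R) _ +oo%R); last exact: cvgy_atan.
  apply/cvgryPge => A; exists (Num.truncn `|A * (2 * cos (theta / 2)) * 2|) => // n /= hn.
  rewrite ler_pdivlMr ?mulr_gt0 //.
  have h1 := expR_ge1Dx (n.+1%:R / 2 : R).
  have h2 : expR (- (n.+1%:R / 2)) <= 1 :> R by rewrite expR_le1 oppr_le0 divr_ge0.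
  have h3 : A * (2 * cos (theta / 2)) * 2 <= n.+1%:R.
    by rewrite (le_trans (ler_norm _)) // ltW // (lt_le_trans (truncnS_gt _)) // ler_nat.
  by lra.
(* The primitive is [atan (sinh (y / 2) / cos (theta / 2))]. *)
transitivity (pi / 2 - - (pi / 2) : R); last by field.
apply: (@FTC_line _ (ctrW theta)
  (fun y => atan ((expR (y / 2) - expR (- (y / 2))) / (2 * cos (theta / 2)))) (pi / 2) (- (pi / 2))).
- exact: continuous_ctrW.
- by move=> y; exact: is_derive_ctrW.
- exact: integrable_ctrW.
- exact: lim.
- under eq_fun => n do rewrite mulNr opprK -opprB mulNr atanN.
  exact: cvgN.
Qed.

(** The weights cancel the modulus [exp (- tau theta)] of [exp (i tau z)]; adding the
    contributions of the two conjugate lines then replaces [1 / (2 cosh (z / 2))] by its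
    real part. *)
Lemma ctrRe_sym tau theta y :
  ctrRe tau theta y * expR (tau * theta) + ctrRe tau (- theta) y * expR (- (tau * theta)) =
  2 * (cos (tau * y) * ctrW theta y).
Proof.
rewrite /ctrRe /ctrW /ctrN cosN mulrN opprK expRD (expRD (y / 2) (tau * theta)).
rewrite !mulNr opprK expRN.
have := expR_gt0 (tau * theta); set X := expR (tau * theta) => X0.
rewrite cosD cosB.
set N := 1 + _ + _.
have [->|N0] := eqVneq N 0; first by rewrite !invr0 !mulr0 !mul0r addr0.
by field; rewrite N0 gt_eqF.
Qed.

(** The factor [cos (theta / 2)], which tends to zero as [theta] tends to [pi], shows
    that only the value of [cos (tau y)] at [y = 0] survives in the limit. *)
Lemma one_sub_cos_ctrW tau theta y : - pi < theta < pi ->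
  (1 - cos (tau * y)) * ctrW theta y <= cos (theta / 2) * (2 + 8 * tau ^+ 2) * sechk y.
Proof.
move=> h; have N0 := ctrN_gt0 y h; have e0 := cos_half_gt0 h.
have E0 := expR_gt0 y.
have F0 := oneDexpR_gt0 y.
have hN : (1 - expR y) ^+ 2 <= ctrN theta y.
  by rewrite ctrNE lerDl !mulr_ge0 ?sqr_ge0 // ltW.
have hb := one_sub_cos_sech_bound tau y.
have hC : (1 - cos (tau * y)) * (1 + expR y) ^+ 2 <= (2 + 8 * tau ^+ 2) * ctrN theta y.
  by rewrite (le_trans hb) // ler_wpM2l // addr_ge0 // mulr_ge0 // sqr_ge0.
rewrite /ctrW /sechk.
rewrite [leLHS](_ : _ = cos (theta / 2) * expR (y / 2) * (((1 - cos (tau * y)) * (1 + expR y) ^+ 2) / ctrN theta y) / (1 + expR y)); last first.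
  by field; rewrite !gt_eqF.
rewrite [leRHS](_ : _ = cos (theta / 2) * expR (y / 2) * (2 + 8 * tau ^+ 2) / (1 + expR y)); last by ring.
rewrite ler_pM2r ?invr_gt0 // ler_pM2l ?mulr_gt0 ?expR_gt0 //.
by rewrite ler_pdivrMr.
Qed.

(** This is [pi / cosh (pi tau)]. *)
Definition sechpi tau : R := 2 * pi / (expR (pi * tau) + expR (- (pi * tau))).

Lemma integrable_cos_ctrW tau theta : - pi < theta < pi ->
  mu.-integrable setT (EFin \o (fun y => cos (tau * y) * ctrW theta y)).
Proof.
move=> h; apply: le_integrable (integrable_ctrW h) => //.
  apply/measurable_EFinP; apply: continuous_measurable_fun => y; apply: cvgM.
    by apply: continuous_comp; [apply: cvgM; [exact: cvg_cst|exact: cvg_id]|exact: continuous_cos].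
  exact: continuous_ctrW.
by move=> y _ /=; rewrite lee_fin normrM ler_piMl ?normr_ge0 // cos_max.
Qed.

Lemma integral_cos_ctrW tau theta : - pi < theta < pi ->
  (\int[mu]_y (cos (tau * y) * ctrW theta y))%R =
  sechFT tau * ((expR (tau * theta) + expR (- (tau * theta))) / 2).
Proof.
move=> h; have hN : - pi < - theta < pi by rewrite ltrN2 ltrNl andbC.
have e := integral_ctrRe tau h; have eN := integral_ctrRe tau hN.
transitivity (\int[mu]_y (expR (tau * theta) / 2 * ctrRe tau theta y +
   expR (- (tau * theta)) / 2 * ctrRe tau (- theta) y))%R.
  apply: eq_Rintegral => y _; rewrite -[LHS](mulKf (_ : (2 : R) != 0)) // -ctrRe_sym; ring.
have i1 := integrable_ctrRe tau h; have i2 := integrable_ctrRe tau hN.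
rewrite RintegralD //=.
- by rewrite !RintegralZl // e eN; field.
- exact: rintegrableZl.
- exact: rintegrableZl.
Qed.

(** The integral of [cos (tau y) * ctrW theta y] equals [sechFT tau * cosh (tau theta)]
    by the shift of contour, and tends to [pi] as [theta] tends to [pi] because [ctrW]
    is an approximate identity of mass [pi]. *)
Lemma sechFTE tau : sechFT tau = sechpi tau.
Proof.
have cosh_gt0 x : 0 < expR x + expR (- x) by rewrite addr_gt0 ?expR_gt0.
pose K := (\int[mu]_y sechk y)%R.
pose g theta := pi - sechFT tau * ((expR (tau * theta) + expR (- (tau * theta))) / 2).
pose h theta := cos (theta / 2) * ((2 + 8 * tau ^+ 2) * K).
have gh theta : - pi < theta < pi -> 0 <= g theta <= h theta.
  move=> hth; rewrite /g -integral_cos_ctrW // -(integral_ctrW hth) -RintegralB //; last 2 first.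
  - exact: integrable_ctrW.
  - exact: integrable_cos_ctrW.
  have e y : ctrW theta y - cos (tau * y) * ctrW theta y = (1 - cos (tau * y)) * ctrW theta y by ring.
  apply/andP; split.
    by apply: Rintegral_ge0 => y _; rewrite e mulr_ge0 ?ctrW_ge0 // subr_ge0 cos_le1.
  rewrite /h mulrA -RintegralZl //; last exact: integrable_sechk.
  apply: le_Rintegral => //.
  - by apply: rintegrableB => //; [exact: integrable_ctrW|exact: integrable_cos_ctrW].
  - by apply: rintegrableZl => //; exact: integrable_sechk.
  - by move=> y _; rewrite e one_sub_cos_ctrW.
have cg : g x @[x --> pi^'-] --> g pi.
  apply: cvg_at_left_filter; apply: differentiable_continuous; apply/derivable1_diffP.
  by rewrite /g; apply: ex_derive.
have ch : h x @[x --> pi^'-] --> (0 : R).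
  have -> : 0 = h pi by rewrite /h cos_pihalf mul0r.
  apply: cvg_at_left_filter; apply: differentiable_continuous; apply/derivable1_diffP.
  by rewrite /h; apply: ex_derive.
have cg0 : g x @[x --> pi^'-] --> (0 : R).
  apply: (@squeeze_cvgr _ _ _ _ (cst 0) h) => //; last exact: cvg_cst.
  near=> x; apply: gh; apply/andP; split; last by near: x; exact: nbhs_left_lt.
  rewrite (@lt_trans _ _ 0) // ?oppr_lt0 ?pi_gt0 //; near: x; apply: nbhs_left_gt; exact: pi_gt0.
have g0 : g pi = 0 by exact: (cvg_unique _ cg cg0).
rewrite /sechpi; move/eqP: g0; rewrite subr_eq0 => /eqP g0.
rewrite {1}g0 (mulrC tau) ; field.
by rewrite gt_eqF.
Unshelve. all: by end_near. Qed.

End sech.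

(** * Complex-valued integrals *)

Section complex_basics.
Context {R : realType}.
Implicit Types z w : R[i].

Lemma cReM z w : complex.Re (z * w) = complex.Re z * complex.Re w - complex.Im z * complex.Im w.
Proof. by case: z => a b; case: w. Qed.

Lemma cImM z w : complex.Im (z * w) = complex.Re z * complex.Im w + complex.Im z * complex.Re w.
Proof. by case: z => a b; case: w. Qed.

Lemma complexP z w : complex.Re z = complex.Re w -> complex.Im z = complex.Im w -> z = w.
Proof. by case: z => a b; case: w => c d /= -> ->. Qed.

Lemma normc_sqrtE z : Normc.normc z = Num.sqrt (complex.Re z ^+ 2 + complex.Im z ^+ 2).
Proof. by case: z. Qed.

Lemma normc_ge0 z : 0 <= Normc.normc z.
Proof. by rewrite normc_sqrtE sqrtr_ge0. Qed.

Lemma norm_Re_le z : `|complex.Re z| <= Normc.normc z.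
Proof. by rewrite normc_sqrtE -sqrtr_sqr ler_wsqrtr // lerDl sqr_ge0. Qed.

Lemma norm_Im_le z : `|complex.Im z| <= Normc.normc z.
Proof. by rewrite normc_sqrtE -sqrtr_sqr ler_wsqrtr // lerDr sqr_ge0. Qed.

Lemma normc_le z : Normc.normc z <= `|complex.Re z| + `|complex.Im z|.
Proof.
rewrite normc_sqrtE -(ger0_norm (addr_ge0 (normr_ge0 (complex.Re z)) (normr_ge0 (complex.Im z)))).
rewrite -sqrtr_sqr ler_wsqrtr // sqrrD !real_normK ?num_real // -addrA.
by rewrite lerD2l lerDr mulrn_wge0 // mulr_ge0.
Qed.

Lemma normc_real (x : R) : Normc.normc x%:C%C = `|x|.
Proof. by rewrite normc_sqrtE /= expr0n addr0 sqrtr_sqr. Qed.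

(** This is [exp (i x)]. *)
Definition ce (x : R) : R[i] := (cos x +i* sin x)%C.

Lemma ceD x y : ce (x + y) = ce x * ce y.
Proof. by apply: complexP; rewrite ?cReM ?cImM /= ?cosD ?sinD //; ring. Qed.

Lemma normc_ce x : Normc.normc (ce x) = 1.
Proof. by rewrite normc_sqrtE /= cos2Dsin2 sqrtr1. Qed.

End complex_basics.

Section cint.
Context d (T : measurableType d) (R : realType) (mu : {measure set T -> \bar R}).
Implicit Types f g : T -> R[i].

Definition cint f : R[i] :=
  ((\int[mu]_t complex.Re (f t))%R +i* (\int[mu]_t complex.Im (f t))%R)%C.

Definition cmeas f : Prop :=
  measurable_fun setT (fun t => complex.Re (f t)) /\
  measurable_fun setT (fun t => complex.Im (f t)).

Definition cintegrable f : Prop :=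
  mu.-integrable setT (EFin \o (fun t => complex.Re (f t))) /\
  mu.-integrable setT (EFin \o (fun t => complex.Im (f t))).

Lemma eq_cint f g : f =1 g -> cint f = cint g.
Proof. by move=> fg; rewrite /cint; congr (_ +i* _)%C; apply: eq_Rintegral => t _; rewrite fg. Qed.

Lemma cintegrable_cmeas f : cintegrable f -> cmeas f.
Proof. by move=> [h1 h2]; split; [exact: rintegrable_measurable h1|exact: rintegrable_measurable h2]. Qed.

Lemma cmeas_real (f : T -> R) : measurable_fun setT f -> cmeas (fun t => (f t)%:C%C).
Proof. by move=> mf; split => //=; exact: measurable_cst. Qed.

Lemma cmeasM f g : cmeas f -> cmeas g -> cmeas (fun t => f t * g t).
Proof.
move=> [f1 f2] [g1 g2]; split.
  under eq_fun do rewrite cReM.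
  by apply: measurable_funB; apply: measurable_funM.
under eq_fun do rewrite cImM.
by apply: measurable_funD; apply: measurable_funM.
Qed.

Lemma cmeas_ce (u : T -> R) : measurable_fun setT u -> cmeas (fun t => ce (u t)).
Proof.
move=> mu_; split => /=; (apply: measurableT_comp => //; apply: continuous_measurable_fun).
  exact: continuous_cos.
exact: continuous_sin.
Qed.

Lemma measurable_normc f : cmeas f -> measurable_fun setT (fun t => Normc.normc (f t)).
Proof.
move=> [f1 f2]; under eq_fun do rewrite normc_sqrtE.
apply: (@measurableT_comp _ _ _ _ _ _ (@Num.sqrt R)).
  by apply: continuous_measurable_fun; exact: sqrt_continuous.
by apply: measurable_funD; apply: measurable_funX.
Qed.

Lemma cintegrable_le f (g : T -> R) : cmeas f -> (forall t, Normc.normc (f t) <= g t) ->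
  mu.-integrable setT (EFin \o g) -> cintegrable f.
Proof.
move=> [f1 f2] fg ig; split.
  by apply: rintegrable_le ig => // t _; rewrite (le_trans (norm_Re_le _)).
by apply: rintegrable_le ig => // t _; rewrite (le_trans (norm_Im_le _)).
Qed.

Lemma cintegrable_normc f : cintegrable f ->
  mu.-integrable setT (EFin \o (fun t => Normc.normc (f t))).
Proof.
move=> fi; have mf := cintegrable_cmeas fi; case: fi => f1 f2.
apply: (@rintegrable_le _ _ _ mu _ _ _ (fun t => `|complex.Re (f t)| + `|complex.Im (f t)|)) => //.
- exact: measurable_normc.
- by move=> t _; rewrite ger0_norm ?normc_ge0 // normc_le.
- by apply: rintegrableD => //; exact: integrable_norm.
Qed.

Lemma cintZl c f : cintegrable f -> cint (fun t => c * f t) = c * cint f.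
Proof.
move=> [f1 f2]; apply: complexP; rewrite ?cReM ?cImM /=.
  under eq_Rintegral do rewrite cReM.
  by rewrite RintegralB // ?RintegralZl //; exact: rintegrableZl.
under eq_Rintegral do rewrite cImM.
by rewrite RintegralD // ?RintegralZl //; exact: rintegrableZl.
Qed.

Lemma cintegrableM f g (C : R) : cmeas f -> (forall t, Normc.normc (f t) <= C) ->
  cintegrable g -> cintegrable (fun t => f t * g t).
Proof.
move=> mf fC ig; apply: (@cintegrable_le _ (fun t => C * Normc.normc (g t))).
- by apply: cmeasM => //; exact: cintegrable_cmeas.
- by move=> t; rewrite Normc.normcM ler_wpM2r // normc_ge0.
- by apply: rintegrableZl => //; exact: cintegrable_normc.
Qed.

Lemma cintegrable_ce f (u : T -> R) : measurable_fun setT u -> cintegrable f ->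
  cintegrable (fun t => f t * ce (u t)).
Proof.
move=> mu_ fi; under eq_fun do rewrite mulrC.
apply: (@cintegrableM _ _ 1) => //; first exact: cmeas_ce.
by move=> t; rewrite normc_ce.
Qed.

Lemma cint_real (f : T -> R) : cint (fun t => (f t)%:C%C) = (\int[mu]_t f t)%R%:C%C.
Proof. by apply: complexP => //=; rewrite Rintegral_cst //= mul0r. Qed.

End cint.

(** Fubini is stated for extended-real inner integrals; an integrable function is finite
    almost everywhere, so that they may be replaced by their real parts. *)
Lemma fine_integrable d (T : measurableType d) (R : realType) (mu : {measure set T -> \bar R})
    (F : T -> \bar R) : mu.-integrable setT F ->
  mu.-integrable setT (EFin \o (fun x => fine (F x))) /\
  (\int[mu]_x fine (F x))%R = fine (\int[mu]_x F x)%E.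
Proof.
move=> iF.
have mF : measurable_fun setT (fun x => fine (F x)).
  apply: (@measurableT_comp _ _ _ _ _ _ (@fine R)); first exact: fine_measurable.
  exact: measurable_int iF.
split.
  apply: le_integrable iF => //; first exact/measurable_EFinP.
  by move=> x _ /=; case: (F x) => [r||] /=; rewrite ?normr0 ?leey.
rewrite /Rintegral; congr fine; apply: ae_eq_integral => //.
- exact/measurable_EFinP.
- exact: measurable_int iF.
- have := integrable_ae measurableT iF; apply: filterS => x /(_ I) h _.
  by rewrite fineK.
Qed.

Section cfubini.
Context d1 d2 (T1 : measurableType d1) (T2 : measurableType d2) (R : realType).
Variable m1 : {sigma_finite_measure set T1 -> \bar R}.
Variable m2 : {sigma_finite_measure set T2 -> \bar R}.
Local Notation m12 := (m1 \x m2)%E.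

Lemma Rfubini12 (f : T1 * T2 -> R) : m12.-integrable setT (EFin \o f) ->
  m1.-integrable setT (EFin \o (fun x => \int[m2]_y f (x, y))%R) /\
  (\int[m1]_x \int[m2]_y f (x, y) = \int[m12]_z f z)%R.
Proof.
move=> fi; have [h1 h2] := fine_integrable (integrable_fubini_F fi); split; first exact: h1.
by rewrite [LHS]h2 /Rintegral -(integral12_prod_meas1 fi).
Qed.

Lemma integrable_fubini_G2 (f : T1 * T2 -> \bar R) : m12.-integrable setT f ->
  m2.-integrable setT (fubini_G m1 f).
Proof.
move=> fi; apply/integrableP; split; first exact: measurable_fubini_G fi.
have mf := measurable_int _ fi.
apply: le_lt_trans ((integrable21ltyP m1 m2 mf).1 fi); apply: ge0_le_integral => //.
- by apply: measurableT_comp => //; exact: measurable_fubini_G fi.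
- apply: (measurable_fun_fubini_tonelli_G (abse \o f)) => //.
  + exact: measurableT_comp.
  + by move=> x; exact: abse_ge0.
- move=> y _; apply: le_abse_integral => //.
  exact: measurableT_comp.
Qed.

Lemma Rfubini21 (f : T1 * T2 -> R) : m12.-integrable setT (EFin \o f) ->
  m2.-integrable setT (EFin \o (fun y => \int[m1]_x f (x, y))%R) /\
  (\int[m2]_y \int[m1]_x f (x, y) = \int[m12]_z f z)%R.
Proof.
move=> fi; have [h1 h2] := fine_integrable (integrable_fubini_G2 fi); split; first exact: h1.
by rewrite [LHS]h2 /Rintegral -(integral21_prod_meas1 fi).
Qed.

Lemma cfubini12 (f : T1 * T2 -> R[i]) : cintegrable m12 f ->
  cintegrable m1 (fun x => cint m2 (fun y => f (x, y))) /\
  cint m1 (fun x => cint m2 (fun y => f (x, y))) = cint m12 f.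
Proof.
move=> [/Rfubini12[f1 e1] /Rfubini12[f2 e2]]; split; first by split.
by apply: complexP.
Qed.

Lemma cfubini21 (f : T1 * T2 -> R[i]) : cintegrable m12 f ->
  cintegrable m2 (fun y => cint m1 (fun x => f (x, y))) /\
  cint m2 (fun y => cint m1 (fun x => f (x, y))) = cint m12 f.
Proof.
move=> [/Rfubini21[f1 e1] /Rfubini21[f2 e2]]; split; first by split.
by apply: complexP.
Qed.

Lemma rintegrable_prod (f : T1 -> R) (g : T2 -> R) :
  m1.-integrable setT (EFin \o f) -> m2.-integrable setT (EFin \o g) ->
  m12.-integrable setT (EFin \o (fun z => f z.1 * g z.2)).
Proof.
move=> fi gi.
have mf := rintegrable_measurable fi; have mg := rintegrable_measurable gi.
have mfg : measurable_fun setT (fun z : T1 * T2 => f z.1 * g z.2).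
  by apply: measurable_funM; [exact: measurableT_comp mf _|exact: measurableT_comp mg _].
apply/(integrable12ltyP m1 m2); first exact/measurable_EFinP.
rewrite (eq_integral (fun x => `|f x|%:E * (\int[m2]_y `|g y|%:E))%E); last first.
  move=> x _; rewrite /=; under eq_integral do rewrite normrM EFinM.
  rewrite ge0_integralZl //.
    by apply/measurable_EFinP; exact: measurableT_comp.
rewrite ge0_integralZr //.
- move/integrableP : fi => [_ fi]; move/integrableP : gi => [_ gi].
  apply: lte_mul_pinfty => //; first exact: integral_ge0.
  by rewrite ge0_fin_numE //; exact: integral_ge0.
- by apply/measurable_EFinP; exact: measurableT_comp.
- exact: integral_ge0.
Qed.

Lemma cintegrable_prod_le (h : T1 * T2 -> R[i]) (f : T1 -> R) (g : T2 -> R) :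
  cmeas h -> (forall x y, Normc.normc (h (x, y)) <= f x * g y) ->
  m1.-integrable setT (EFin \o f) -> m2.-integrable setT (EFin \o g) ->
  cintegrable m12 h.
Proof.
move=> mh hfg fi gi; apply: cintegrable_le mh _ (rintegrable_prod fi gi).
by move=> [x y] /=.
Qed.

End cfubini.

Section fourier_swap.
Context d (T : measurableType d) (R : realType) (mu : {sigma_finite_measure set T -> \bar R}).
Local Notation leb := (@lebesgue_measure R).

(** The multiplication formula for the Fourier transform, with a weight [H] on an
    arbitrary measure space and phases [y * th t]. *)
Lemma fourier_swap (k : R -> R[i]) (H : T -> R[i]) (th : T -> R) :
  cintegrable leb k -> cintegrable mu H -> measurable_fun setT th ->
  cint leb (fun y => k y * cint mu (fun t => H t * ce (y * th t))) =
  cint mu (fun t => H t * cint leb (fun y => k y * ce (y * th t))).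
Proof.
move=> ik iH mth.
have mk := cintegrable_cmeas ik; have mH := cintegrable_cmeas iH.
pose h (z : measurableTypeR R * T) : R[i] := k z.1 * (H z.2 * ce (z.1 * th z.2)).
have ih : cintegrable (leb \x mu)%E h.
  apply: (@cintegrable_prod_le _ _ (measurableTypeR R) T R leb mu h
    (fun y => Normc.normc (k y)) (fun t => Normc.normc (H t))).
  - apply: cmeasM; first by case: mk => k1 k2; split; [exact: measurableT_comp k1 _|exact: measurableT_comp k2 _].
    apply: cmeasM; first by case: mH => k1 k2; split; [exact: measurableT_comp k1 _|exact: measurableT_comp k2 _].
    apply: cmeas_ce; apply: measurable_funM => //.
    exact: measurableT_comp mth _.
  - by move=> y t; rewrite /h /= !Normc.normcM normc_ce mulr1.
  - exact: cintegrable_normc.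
  - exact: cintegrable_normc.
have [_ e1] := cfubini12 ih; have [_ e2] := cfubini21 ih.
transitivity (cint leb (fun y => cint mu (fun t => h (y, t)))).
  apply: eq_cint => y; rewrite -cintZl //.
  by apply: cintegrable_ce => //; apply: measurable_funM.
rewrite e1 -e2; apply: eq_cint => t; rewrite -cintZl.
  by apply: eq_cint => y; rewrite /h /=; ring.
apply: cintegrable_ce => //.
exact: measurable_funM.
Qed.

End fourier_swap.

(** * The Gamma function on the critical line *)

Section gamma.
Context {R : realType}.
Local Notation leb := (@lebesgue_measure R).
Implicit Types x y a b tau lam : R.

Lemma realcM (x y : R) : (x * y)%:C%C = x%:C%C * y%:C%C.
Proof. by apply: complexP; rewrite ?cReM ?cImM /=; ring. Qed.

Lemma cint_affine (f : R -> R[i]) (a c : R) : 0 < a ->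
  continuous (fun x => complex.Re (f x)) -> continuous (fun x => complex.Im (f x)) ->
  cint leb f = cint leb (fun x => f (a * x + c) * a%:C%C).
Proof.
move=> a0 cR cI; apply: complexP => /=.
  rewrite /Rintegral (integral_affine c a0 cR); congr fine.
  by apply: eq_integral => x _; rewrite cReM /= mulr0 subr0.
rewrite /Rintegral (integral_affine c a0 cI); congr fine.
by apply: eq_integral => x _; rewrite cImM /= mulr0 add0r.
Qed.

(** Dilated so that its Fourier transform is [sechpi (lam x)]. *)
Definition sechks lam y : R := sechk (y / lam) / lam.

Lemma continuous_sechks lam : continuous (sechks lam).
Proof.
move=> y; apply: cvgM; last exact: cvg_cst.
apply: (@continuous_comp _ _ _ (fun y : R => y / lam) sechk); last exact: continuous_sechk.
by apply: cvgM; [exact: cvg_id|exact: cvg_cst].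
Qed.

Lemma sechks_ge0 lam y : 0 < lam -> 0 <= sechks lam y.
Proof. by move=> l0; rewrite divr_ge0 ?(ltW l0) // ltW // sechk_gt0. Qed.

Lemma integrable_sechks lam : 0 < lam -> leb.-integrable setT (EFin \o sechks lam).
Proof.
move=> l0; apply/integrableP; split.
  by apply/measurable_EFinP; apply: continuous_measurable_fun; exact: continuous_sechks.
under eq_integral do rewrite /= ger0_norm ?sechks_ge0 //.
rewrite (integral_affine 0 l0 (@continuous_sechks lam)).
have /integrableP[_] := @integrable_sechk R; apply: le_lt_trans.
rewrite le_eqVlt; apply/orP; left; apply/eqP; apply: eq_integral => y _ /=.
rewrite ger0_norm ?(ltW (sechk_gt0 _)) // addr0 /sechks; congr (_%:E).
by rewrite mulfVK ?gt_eqF // mulrC mulKf // gt_eqF.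
Qed.

Lemma continuous_cos_mul x : continuous (fun y : R => cos (y * x)).
Proof. by move=> y; apply: continuous_comp; [apply: cvgM; [exact: cvg_id|exact: cvg_cst]|exact: continuous_cos]. Qed.

Lemma continuous_sin_mul x : continuous (fun y : R => sin (y * x)).
Proof. by move=> y; apply: continuous_comp; [apply: cvgM; [exact: cvg_id|exact: cvg_cst]|exact: continuous_sin]. Qed.

Lemma cint_sechk x : cint leb (fun y => (sechk y)%:C%C * ce (y * x)) = (sechpi x)%:C%C.
Proof.
apply: complexP => /=.
  rewrite -sechFTE; apply: eq_Rintegral => y _; rewrite mul0r subr0 mulrC.
  by rewrite (mulrC y).
rewrite (_ : (\int[leb]_y _)%R = (\int[leb]_y (sechk y * sin (y * x)))%R); last first.
  by apply: eq_Rintegral => y _; rewrite mul0r addr0.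
have mf : measurable_fun setT (fun y : R => sechk y * sin (y * x)).
  apply: continuous_measurable_fun => y; apply: cvgM; [exact: continuous_sechk|exact: continuous_sin_mul].
have si : leb.-integrable setT (EFin \o (fun y : R => sechk y * sin (y * x))).
  apply: (@integrable_le_sechk _ _ 1) => // y.
  by rewrite mul1r normrM ger0_norm ?(ltW (sechk_gt0 _)) // ler_piMr ?(ltW (sechk_gt0 _)) // sin_max.
have : (\int[leb]_y (sechk y * sin (y * x)))%R = - (\int[leb]_y (sechk y * sin (y * x)))%R.
  rewrite {1}/Rintegral (integral_oppr mf) -mulN1r -RintegralZl //.
  rewrite /Rintegral; congr fine; apply: eq_integral => y _.
  by rewrite sechkN mulNr sinN mulrN mulN1r.
set I0 := (\int[leb]_y _)%R; lra.
Qed.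

Lemma cint_sechks lam x : 0 < lam ->
  cint leb (fun y => (sechks lam y)%:C%C * ce (y * x)) = (sechpi (lam * x))%:C%C.
Proof.
move=> l0; rewrite -cint_sechk (cint_affine 0 l0); last 2 first.
- under eq_fun do rewrite cReM /= mul0r subr0.
  by move=> y; apply: cvgM; [exact: continuous_sechks|exact: continuous_cos_mul].
- under eq_fun do rewrite cImM /= mul0r addr0.
  by move=> y; apply: cvgM; [exact: continuous_sechks|exact: continuous_sin_mul].
apply: eq_cint => y; rewrite addr0 (_ : lam * y * x = y * (lam * x)); last by ring.
rewrite mulrAC -realcM /sechks; congr (_%:C%C * _).
by rewrite mulfVK ?gt_eqF // mulrC mulKf // gt_eqF.
Qed.

(** The integrand of [Gamma (1/2)] after the substitution [t = exp a], Jacobian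
    included. *)
Definition gamma_pull a : R := expR (a / 2 - expR a).

(** This is [exp (- E) <= 1 / (1 + E)] with [E = exp a]; it supplies all the
    integrability needed for [Gamma] on the critical line. *)
Lemma gamma_pull_le a : gamma_pull a <= sechk a.
Proof.
rewrite /gamma_pull /sechk expRD ler_pM2l ?expR_gt0 // expRN lef_pV2 ?posrE ?expR_gt0 ?oneDexpR_gt0 //.
exact: expR_ge1Dx.
Qed.

Lemma continuous_gamma_pull : continuous gamma_pull.
Proof.
move=> y; apply: continuous_comp; last exact: continuous_expR.
by apply: cvgB; [apply: cvgM; [exact: cvg_id|exact: cvg_cst]|exact: continuous_expR].
Qed.

Lemma gamma_pull_ge0 a : 0 <= gamma_pull a.
Proof. exact: expR_ge0. Qed.

Lemma integrable_gamma_pull : leb.-integrable setT (EFin \o gamma_pull).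
Proof.
apply: (@integrable_le_sechk _ _ 1).
  by apply: continuous_measurable_fun; exact: continuous_gamma_pull.
by move=> y; rewrite mul1r ger0_norm ?gamma_pull_ge0 // gamma_pull_le.
Qed.

Lemma Gamma_sigma tau : Gamma (sigma tau) = cint leb (fun a => (gamma_pull a)%:C%C * ce (a * tau)).
Proof.
have c1 x : 0 < x -> {for x, continuous (fun t : R => expR (- 2^-1 * ln t))}.
  move=> x0; apply: (@continuous_comp _ _ _ (fun t : R => - 2^-1 * ln t)); last exact: continuous_expR.
  by apply: cvgM; [exact: cvg_cst|exact: continuous_ln].
have c2 : continuous (fun t : R => expR (- t)).
  by move=> x; apply: continuous_comp; [exact: cvgN|exact: continuous_expR].
have half : 2^-1 - 1 = - 2^-1 :> R by field.
have e1 a : expR (- 2^-1 * a) * expR (- expR a) * expR a = gamma_pull a.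
  by rewrite -!expRD; congr expR; field.
apply: complexP => /=.
- rewrite (_ : (\int[leb]_(t in Rplus (R:=R)) _)%R = (\int[leb]_(t in Rplus (R:=R)) (expR (- 2^-1 * ln t) * cos (tau * ln t) * expR (- t)))%R); last first.
    by apply: eq_Rintegral => t _; rewrite half !mul0r !mulr0 !subr0.
  rewrite /Rintegral integral_Rplus_expR.
    congr fine; apply: eq_integral => a _; rewrite expRK mul0r subr0 -e1 (mulrC a); congr EFin; ring.
  move=> x x0; apply: cvgM; last exact: c2.
  apply: cvgM; first exact: c1.
  apply: (@continuous_comp _ _ _ (fun t : R => tau * ln t)); last exact: continuous_cos.
  by apply: cvgM; [exact: cvg_cst|exact: continuous_ln].
- rewrite (_ : (\int[leb]_(t in Rplus (R:=R)) _)%R = (\int[leb]_(t in Rplus (R:=R)) (expR (- 2^-1 * ln t) * sin (tau * ln t) * expR (- t)))%R); last first.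
    by apply: eq_Rintegral => t _; rewrite half !mul0r !mulr0 !subr0 ?addr0 ?add0r.
  rewrite /Rintegral integral_Rplus_expR.
    congr fine; apply: eq_integral => a _; rewrite expRK mul0r addr0 -e1 (mulrC a); congr EFin; ring.
  move=> x x0; apply: cvgM; last exact: c2.
  apply: cvgM; first exact: c1.
  apply: (@continuous_comp _ _ _ (fun t : R => tau * ln t)); last exact: continuous_sin.
  by apply: cvgM; [exact: cvg_cst|exact: continuous_ln].
Qed.

Lemma expRN_nat_cvg0 : expR (- n.+1%:R) @[n --> \oo] --> (0 : R).
Proof. by rewrite (cvg_shiftS (fun n : nat => expR (- n%:R) : R)); exact: cvgn_expR. Qed.

Lemma integrable_gamma_pullD b : leb.-integrable setT (EFin \o (fun y => gamma_pull (y + b))).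
Proof.
apply/integrableP; split.
  apply/measurable_EFinP; apply: continuous_measurable_fun => y.
  apply: (@continuous_comp _ _ _ (fun y : R => y + b) gamma_pull); last exact: continuous_gamma_pull.
  by apply: cvgD; [exact: cvg_id|exact: cvg_cst].
have /integrableP[_] := integrable_gamma_pull; apply: le_lt_trans.
rewrite le_eqVlt; apply/orP; left; apply/eqP.
under [RHS]eq_integral do rewrite /= ger0_norm ?gamma_pull_ge0 //.
rewrite (integral_affine b ltr01 continuous_gamma_pull).
by apply: eq_integral => y _ /=; rewrite ger0_norm ?gamma_pull_ge0 // mul1r mulr1.
Qed.

(** Put [E = exp b]: the product is [exp (y / 2) * E * exp (- E (1 + exp y))], and its
    integral in [b] is elementary. *)
Lemma is_derive_gamma_pull_shift y b :
  is_derive b 1 (fun b => - sechk y * expR (- (expR b * (1 + expR y))))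
   (gamma_pull b * gamma_pull (y + b)).
Proof.
apply: is_derive_eq; rewrite /GRing.scale /= /sechk /gamma_pull.
have F0 := oneDexpR_gt0 y.
rewrite -expRD.
rewrite (_ : b / 2 - expR b + ((y + b) / 2 - expR (y + b)) = (y / 2 + b) + - (expR b * (1 + expR y))); last first.
  by rewrite expRD; field.
rewrite expRD (expRD (y / 2) b).
set X := expR (- _); set F := 1 + expR y in F0 *; field; exact: lt0r_neq0.
Qed.

Lemma continuous_gamma_pull_shift y : continuous (fun b => gamma_pull b * gamma_pull (y + b)).
Proof.
move=> b; apply: cvgM; first exact: continuous_gamma_pull.
apply: (@continuous_comp _ _ _ (fun b : R => y + b) gamma_pull); last exact: continuous_gamma_pull.
by apply: cvgD; [exact: cvg_cst|exact: cvg_id].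
Qed.

Lemma gamma_pull_le1 a : gamma_pull a <= 1.
Proof.
rewrite /gamma_pull -[leRHS]expR0 ler_expR; have := expR_ge1Dx a.
have [a0|a0] := leP 0 a; first by lra.
by have := expR_gt0 a; lra.
Qed.

Lemma integrable_gamma_pull_shift y :
  leb.-integrable setT (EFin \o (fun b => gamma_pull b * gamma_pull (y + b))).
Proof.
apply: (@integrable_le_sechk _ _ 1).
  by apply: continuous_measurable_fun; exact: continuous_gamma_pull_shift.
move=> b; rewrite mul1r ger0_norm ?mulr_ge0 ?gamma_pull_ge0 //.
apply: le_trans (gamma_pull_le b).
by rewrite ler_piMr ?gamma_pull_ge0 ?gamma_pull_le1.
Qed.

(** The autocorrelation of [gamma_pull] is the hyperbolic secant; this is the Beta
    integral behind the reflection formula on the critical line. *)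
Lemma integral_gamma_pull_shift y : (\int[leb]_b (gamma_pull b * gamma_pull (y + b)))%R = sechk y.
Proof.
have F0 := oneDexpR_gt0 y.
rewrite -[RHS](_ : 0 - (- sechk y) = sechk y); last by rewrite sub0r opprK.
apply: (@FTC_line _ _ (fun b => - sechk y * expR (- (expR b * (1 + expR y))))).
- exact: continuous_gamma_pull_shift.
- by move=> b; exact: is_derive_gamma_pull_shift.
- exact: integrable_gamma_pull_shift.
- rewrite -(mulr0 (- sechk y)); apply: cvgM; first exact: cvg_cst.
  apply: (@squeeze_cvgr _ _ _ _ (cst 0) (fun n : nat => expR (- n.+1%:R))).
  + near=> n; rewrite expR_ge0 /= ler_expR lerN2.
    have h1 := expR_ge1Dx (n.+1%:R : R).
    have h2 := expR_gt0 y; have h3 := expR_gt0 (n.+1%:R : R).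
    by rewrite mulrDr mulr1; have : 0 < expR n.+1%:R * expR y by [exact: mulr_gt0]; lra.
  + exact: cvg_cst.
  + exact: expRN_nat_cvg0.
- rewrite -{2}(mulr1 (- sechk y)); apply: cvgM; first exact: cvg_cst.
  suff h : expR (- (expR (- n.+1%:R) * (1 + expR y))) @[n --> \oo] --> expR (- (0 * (1 + expR y))).
    by move: h; rewrite mul0r oppr0 expR0.
  apply: (@cvg_comp _ _ _ (fun n : nat => - (expR (- n.+1%:R) * (1 + expR y))) expR); last exact: continuous_expR.
  by apply: cvgN; apply: cvgM; [exact: expRN_nat_cvg0|exact: cvg_cst].
Unshelve. all: by end_near. Qed.

(** Both factors are Fourier transforms of [gamma_pull], at [tau] and [- tau], so that
    the product is the Fourier transform of its autocorrelation [sechk]. *)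
Lemma Gamma_reflection tau : Gamma (sigma tau) * Gamma (sigma (- tau)) = (sechpi tau)%:C%C.
Proof.
have ig x : cintegrable leb (fun a => (gamma_pull a)%:C%C * ce (a * x)).
  apply: cintegrable_ce; first exact: measurable_funM.
  split; first exact: integrable_gamma_pull.
  exact: integrable0.
(* The change of variable [a = y + b] in the transform at [tau], for [b] the variable of
   the transform at [- tau]. *)
have shift b : cint leb (fun a => (gamma_pull a)%:C%C * ce (a * tau)) =
    cint leb (fun y => (gamma_pull (y + b))%:C%C * ce ((y + b) * tau)).
  rewrite (@cint_affine _ 1 b) //; last 2 first.
  - by move=> y; rewrite /=; apply: cvgB; apply: cvgM; [exact: continuous_gamma_pull|exact: continuous_cos_mul|exact: cvg_cst|exact: continuous_sin_mul].
  - by move=> y; rewrite /=; apply: cvgD; apply: cvgM; [exact: continuous_gamma_pull|exact: continuous_sin_mul|exact: cvg_cst|exact: continuous_cos_mul].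
  by apply: eq_cint => y; rewrite mul1r mulr1.
pose h (z : measurableTypeR R * measurableTypeR R) : R[i] := (gamma_pull z.1 * gamma_pull (z.2 + z.1))%:C%C * ce (z.2 * tau).
have mh : measurable_fun setT (fun z : measurableTypeR R * measurableTypeR R => gamma_pull z.1 * gamma_pull (z.2 + z.1)).
  have mg : measurable_fun setT gamma_pull by apply: continuous_measurable_fun; exact: continuous_gamma_pull.
  apply: measurable_funM; first exact: (@measurableT_comp _ _ _ _ _ _ gamma_pull).
  by apply: (@measurableT_comp _ _ _ _ _ _ gamma_pull) => //; apply: measurable_funD.
have ih : cintegrable (leb \x leb)%E h.
  apply: cintegrable_ce; first exact: measurable_funM.
  split; last exact: integrable0.
  apply/(integrable21ltyP leb leb); first exact/measurable_EFinP.
  have /integrableP[_] := @integrable_sechk R; apply: le_lt_trans.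
  apply: ge0_le_integral => //.
  - by move=> x _; exact: integral_ge0.
  - apply: (@measurable_fun_fubini_tonelli_G _ _ (measurableTypeR R) (measurableTypeR R) R leb (fun z => `|gamma_pull z.1 * gamma_pull (z.2 + z.1)|%:E)) => //.
    by apply/measurable_EFinP; exact: measurableT_comp.
  - by apply/measurable_EFinP; apply: measurableT_comp => //; apply: continuous_measurable_fun; exact: continuous_sechk.
  - move=> y _ /=; rewrite ger0_norm ?(ltW (sechk_gt0 _)) // -integral_gamma_pull_shift /Rintegral fineK.
      rewrite le_eqVlt; apply/orP; left; apply/eqP; apply: eq_integral => b _ /=.
      by rewrite ger0_norm // mulr_ge0 ?gamma_pull_ge0.
    by apply: integrable_fin_num => //; exact: integrable_gamma_pull_shift.
have [_ e1] := cfubini12 ih; have [_ e2] := cfubini21 ih.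
rewrite !Gamma_sigma mulrC [in LHS]mulrC -cintZl // -cint_sechk.
transitivity (cint leb (fun b => cint leb (fun y => h (b, y)))).
  apply: eq_cint => b; rewrite (shift b) mulrC -cintZl; last first.
    apply: cintegrable_ce; last by split; [exact: integrable_gamma_pullD|exact: integrable0].
    by apply: measurable_funM => //; apply: measurable_funD.
  apply: eq_cint => y; rewrite /h /= realcM.
  rewrite (_ : y * tau = b * - tau + (y + b) * tau); last by ring.
  by rewrite (ceD (b * - tau)); ring.
rewrite [LHS]e1 -e2; apply: eq_cint => y.
rewrite -integral_gamma_pull_shift -cint_real mulrC -cintZl.
  by apply: eq_cint => b; rewrite mulrC.
by split; [exact: integrable_gamma_pull_shift|exact: integrable0].
Qed.

End gamma.

(** * Fourier transforms along a function, and unique continuation *)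

Section moments.
Context {R : realType}.
Local Notation leb := (@lebesgue_measure R).
Implicit Types (a : R -> R) (x h : R).

Lemma series_exp_le x n : 0 <= x -> series (exp_coeff x) n <= expR x.
Proof.
move=> x0; apply: nondecreasing_cvgn_le; last exact: is_cvg_series_exp_coeff.
by apply: nondecreasing_series => i _ _; exact: exp_coeff_ge0.
Qed.

(** One term of the exponential series is at most its sum. *)
Lemma expn_le_expR x n : 0 <= x -> x ^+ n <= n`!%:R * expR x.
Proof.
move=> x0; rewrite mulrC -ler_pdivrMr ?ltr0n ?fact_gt0 //.
apply: le_trans (series_exp_le n.+1 x0).
rewrite /series /= big_nat_recr //= lerDr; apply: sumr_ge0 => i _; exact: exp_coeff_ge0.
Qed.

Lemma measurable_fun_expRnorm (c : R) : measurable_fun setT (fun y : R => expR (c * `|y|)).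
Proof.
apply: measurableT_comp => //; apply: measurable_funM => //.
Qed.

Lemma integrable_moment a n : measurable_fun setT a ->
  leb.-integrable setT (EFin \o (fun y => `|a y| * expR `|y|)) ->
  leb.-integrable setT (EFin \o (fun y => a y * y ^+ n)).
Proof.
move=> ma ia.
apply: (@rintegrable_le _ _ _ leb _ _ _ (fun y => n`!%:R * (`|a y| * expR `|y|))) => //.
- by apply: measurable_funM => //; apply: measurable_funX.
- move=> y _; rewrite normrM mulrCA ler_wpM2l // normrX.
  exact: expn_le_expR.
- exact: rintegrableZl.
Qed.

(** Every partial sum of [L (h y)] integrates to zero against [a]; they are all
    dominated by [exp |y|] when the coefficients are at most [1 / n!] and [|h| <= 1], so
    that the limit integrates to zero. *)
Lemma moments_vanish_pseries a (c : nat -> R) (L : R -> R) h : measurable_fun setT a ->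
  leb.-integrable setT (EFin \o (fun y => `|a y| * expR `|y|)) ->
  (forall n, (\int[leb]_y (a y * y ^+ n))%R = 0) ->
  (forall n, `|c n| <= (n`!%:R)^-1) ->
  (forall x, series (fun n => c n * x ^+ n) @ \oo --> L x) ->
  `|h| <= 1 -> (\int[leb]_y (a y * L (h * y)))%R = 0.
Proof.
move=> ma ia a0 cb cL h1.
pose f n y := a y * series (fun n => c n * (h * y) ^+ n) n.
have fS n y : f n.+1 y = f n y + c n * h ^+ n * (a y * y ^+ n).
  by rewrite /f seriesSr mulrDr exprMn; congr (_ + _); ring.
have iint n : leb.-integrable setT (EFin \o f n) /\ (\int[leb]_y f n y)%R = 0.
  elim: n => [|n [IH1 IH2]].
    have -> : f 0%N = cst 0 by apply/funext => y; rewrite /f /series /= big_geq // mulr0.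
    by split; [exact: integrable0|rewrite Rintegral_cst // mul0r].
  have -> : f n.+1 = (fun y => f n y + c n * h ^+ n * (a y * y ^+ n)) by apply/funext => y.
  have im := integrable_moment n ma ia.
  split; first by apply: rintegrableD => //; exact: rintegrableZl.
  by rewrite RintegralD //; [rewrite RintegralZl // IH2 a0 mulr0 addr0|exact: rintegrableZl].
have fb n y : `|f n y| <= `|a y| * expR `|y|.
  rewrite normrM ler_wpM2l // (@le_trans _ _ (expR `|h * y|)) //; last first.
    by rewrite ler_expR normrM ler_piMl.
  apply: le_trans (series_exp_le n (normr_ge0 _)).
  rewrite /series /= (le_trans (ler_norm_sum _ _ _)) //; apply: ler_sum => i _.
  by rewrite /exp_coeff /= normrM normrX mulrC ler_wpM2l // exprn_ge0.
have := @dominated_cvg _ _ _ leb setT measurableT (fun n => EFin \o f n)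
   (EFin \o (fun y => a y * L (h * y))) (EFin \o (fun y => `|a y| * expR `|y|)).
move=> /(_ (fun n => measurable_int _ (iint n).1)).
have cv y : setT y -> (EFin \o f n) y @[n --> \oo] --> (EFin \o (fun y => a y * L (h * y))) y.
  move=> _ /=; apply: cvg_EFin; first by apply: nearW.
  by apply: cvgM; [exact: cvg_cst|exact: cL].
move=> /(_ cv (fun _ _ => isT) ia) H.
have {}H : (\int[leb]_x (EFin \o f n) x)%E @[n --> \oo] --> (\int[leb]_x (EFin \o (fun y => (a y * L (h * y))%R)) x)%E.
  by apply: H => n y _ /=; rewrite lee_fin.
have H0 : (\int[leb]_x (EFin \o f n) x)%E @[n --> \oo] --> 0%E.
  rewrite (_ : (fun n => _) = cst 0%E); first exact: cvg_cst.
  apply/funext => n; have [i1 i2] := iint n.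
  by rewrite /cst -[RHS]/(0%:E) -i2 /Rintegral fineK //; exact: integrable_fin_num.
by rewrite /Rintegral (cvg_unique _ H H0).
Qed.

Lemma moments_vanish_cos a h : measurable_fun setT a ->
  leb.-integrable setT (EFin \o (fun y => `|a y| * expR `|y|)) ->
  (forall n, (\int[leb]_y (a y * y ^+ n))%R = 0) ->
  `|h| <= 1 -> (\int[leb]_y (a y * cos (h * y)))%R = 0.
Proof.
move=> ma ia a0 h1; apply: (@moments_vanish_pseries a (fun n => (~~ odd n)%:R * (-1) ^+ n./2 * (n`!%:R)^-1) (@cos R) h ma ia a0 _ _ h1).
- move=> n; rewrite !normrM normrX normrN1 expr1n mulr1 normfV !normr_nat.
  by rewrite ler_piMl // lern1 leq_b1.
- move=> x; rewrite -cos_coeffE unlock; exact: is_cvg_series_cos_coeff.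
Qed.

Lemma moments_vanish_sin a h : measurable_fun setT a ->
  leb.-integrable setT (EFin \o (fun y => `|a y| * expR `|y|)) ->
  (forall n, (\int[leb]_y (a y * y ^+ n))%R = 0) ->
  `|h| <= 1 -> (\int[leb]_y (a y * sin (h * y)))%R = 0.
Proof.
move=> ma ia a0 h1; apply: (@moments_vanish_pseries a (fun n => (odd n)%:R * (-1) ^+ n.-1./2 * (n`!%:R)^-1) (@sin R) h ma ia a0 _ _ h1).
- move=> n; rewrite !normrM normrX normrN1 expr1n mulr1 normfV !normr_nat.
  by rewrite ler_piMl // lern1 leq_b1.
- move=> x; rewrite -sin_coeffE unlock; exact: is_cvg_series_sin_coeff.
Qed.

End moments.

Section char_fun.
Context d (T : measurableType d) (R : realType) (mu : {sigma_finite_measure set T -> \bar R}).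
Implicit Types (H : T -> R[i]) (th : T -> R) (u : R).

(** The Fourier transform of the image of [H mu] under [th], used with [th] the
    identity, the logarithm and the sum of two coordinates. *)
Definition charf H th u : R[i] := cint mu (fun t => H t * ce (u * th t)).

Lemma continuous_charf H th : cintegrable mu H -> measurable_fun setT th ->
  continuous (fun u => complex.Re (charf H th u)) /\ continuous (fun u => complex.Im (charf H th u)).
Proof.
move=> iH mth.
have iF u : cintegrable mu (fun t => H t * ce (u * th t)).
  by apply: cintegrable_ce => //; exact: measurable_funM.
have hb u t : Normc.normc (H t * ce (u * th t)) <= Normc.normc (H t).
  by rewrite Normc.normcM normc_ce mulr1.
have cc t : continuous (fun u : R => cos (u * th t)) by exact: continuous_cos_mul.
have cs t : continuous (fun u : R => sin (u * th t)) by exact: continuous_sin_mul.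
split=> u.
- apply: (@continuity_under_integral _ _ _ mu (fun u t => complex.Re (H t * ce (u * th t))) setT measurableT
    (u - 1) (u + 1) _ _ _ (cintegrable_normc iH)).
  + by move=> x _; exact: (iF x).1.
  + apply: aeW => t _ v _; rewrite /=; under eq_fun do rewrite cReM /=.
    by apply: cvgB; apply: cvgM; [exact: cvg_cst|exact: cc|exact: cvg_cst|exact: cs].
  + move=> x _; apply: aeW => t _; exact: le_trans (norm_Re_le _) (hb _ _).
  + by rewrite inE /= in_itv /=; apply/andP; split; lra.
- apply: (@continuity_under_integral _ _ _ mu (fun u t => complex.Im (H t * ce (u * th t))) setT measurableT
    (u - 1) (u + 1) _ _ _ (cintegrable_normc iH)).
  + by move=> x _; exact: (iF x).2.
  + apply: aeW => t _ v _; rewrite /=; under eq_fun do rewrite cImM /=.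
    by apply: cvgD; apply: cvgM; [exact: cvg_cst|exact: cs|exact: cvg_cst|exact: cc].
  + move=> x _; apply: aeW => t _; exact: le_trans (norm_Im_le _) (hb _ _).
  + by rewrite inE /= in_itv /=; apply/andP; split; lra.
Qed.

Lemma charf_neq0_near H th u : cintegrable mu H -> measurable_fun setT th ->
  charf H th u != 0 -> \forall v \near u, charf H th v != 0.
Proof.
move=> iH mth; have [cR cI] := continuous_charf iH mth.
have [R0|R0] := eqVneq (complex.Re (charf H th u)) 0; last first.
  move=> _; have := cR u; move=> /cvgr_neq0 /(_ R0).
  by apply: filterS => v; apply: contra_neq => ->.
have [I0|I0] := eqVneq (complex.Im (charf H th u)) 0.
  by move/eqP; case; exact: complexP.
move=> _; have := cI u; move=> /cvgr_neq0 /(_ I0).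
by apply: filterS => v; apply: contra_neq => ->.
Qed.

Lemma is_derive_charf H th u : cintegrable mu H -> measurable_fun setT th ->
  cintegrable mu (fun t => H t * (th t)%:C%C) ->
  is_derive u 1 (fun v => complex.Re (charf H th v))
    (- complex.Im (charf (fun t => H t * (th t)%:C%C) th u)) /\
  is_derive u 1 (fun v => complex.Im (charf H th v))
    (complex.Re (charf (fun t => H t * (th t)%:C%C) th u)).
Proof.
move=> iH mth iH1.
have iF v : cintegrable mu (fun t => H t * ce (v * th t)).
  by apply: cintegrable_ce => //; exact: measurable_funM.
have iF1 v : cintegrable mu (fun t => H t * (th t)%:C%C * ce (v * th t)).
  by apply: cintegrable_ce => //; exact: measurable_funM.
have hb v t : Normc.normc (H t * (th t)%:C%C * ce (v * th t)) <= Normc.normc (H t * (th t)%:C%C).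
  by rewrite Normc.normcM normc_ce mulr1.
have dR (v : R) (t : T) : is_derive v 1 (fun v => complex.Re (H t * ce (v * th t)))
    (- complex.Im (H t * (th t)%:C%C * ce (v * th t))).
  under eq_fun do rewrite cReM /=.
  by apply: is_derive_eq; rewrite /GRing.scale /= cImM cReM cImM /=; ring.
have dI (v : R) (t : T) : is_derive v 1 (fun v => complex.Im (H t * ce (v * th t)))
    (complex.Re (H t * (th t)%:C%C * ce (v * th t))).
  under eq_fun do rewrite cImM /=.
  by apply: is_derive_eq; rewrite /GRing.scale /= cReM cReM cImM /=; ring.
have Iu : `]u - 1, u + 1[%classic u by rewrite /= in_itv /=; apply/andP; split; lra.
have ig := cintegrable_normc iH1.
have ng t : 0 <= Normc.normc (H t * (th t)%:C%C) by exact: normc_ge0.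
split.
- have dE v t : partial1of2 (fun v t => complex.Re (H t * ce (v * th t))) v t =
    - complex.Im (H t * (th t)%:C%C * ce (v * th t)).
    by rewrite partial1of2E; have [_ <-] := dR v t.
  have h1 x : `]u - 1, u + 1[%classic x -> mu.-integrable setT (EFin \o (fun t => complex.Re (H t * ce (x * th t)))).
    by move=> _; exact: (iF x).1.
  have h2 x t : `]u - 1, u + 1[%classic x -> setT t -> derivable (fun v : R => complex.Re (H t * ce (v * th t))) x 1.
    by move=> _ _; case: (dR x t).
  have h3 x t : `]u - 1, u + 1[%classic x -> setT t ->
     `|partial1of2 (fun v t => complex.Re (H t * ce (v * th t))) x t| <= Normc.normc (H t * (th t)%:C%C).
    by move=> _ _; rewrite dE normrN (le_trans (norm_Im_le _)).
  apply: DeriveDef; first exact: (derivable_under_integral measurableT Iu h1 h2 ng ig h3).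
  rewrite -derive1E (differentiation_under_integral measurableT Iu h1 h2 ng ig h3) /charf /=.
  rewrite -mulN1r -RintegralZl //; last exact: (iF1 u).2.
  by apply: eq_Rintegral => t _; rewrite dE mulN1r.
- have dE v t : partial1of2 (fun v t => complex.Im (H t * ce (v * th t))) v t =
    complex.Re (H t * (th t)%:C%C * ce (v * th t)).
    by rewrite partial1of2E; have [_ <-] := dI v t.
  have h1 x : `]u - 1, u + 1[%classic x -> mu.-integrable setT (EFin \o (fun t => complex.Im (H t * ce (x * th t)))).
    by move=> _; exact: (iF x).2.
  have h2 x t : `]u - 1, u + 1[%classic x -> setT t -> derivable (fun v : R => complex.Im (H t * ce (v * th t))) x 1.
    by move=> _ _; case: (dI x t).
  have h3 x t : `]u - 1, u + 1[%classic x -> setT t ->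
     `|partial1of2 (fun v t => complex.Im (H t * ce (v * th t))) x t| <= Normc.normc (H t * (th t)%:C%C).
    by move=> _ _; rewrite dE (le_trans (norm_Re_le _)).
  apply: DeriveDef; first exact: (derivable_under_integral measurableT Iu h1 h2 ng ig h3).
  rewrite -derive1E (differentiation_under_integral measurableT Iu h1 h2 ng ig h3) /charf /=.
  by apply: eq_Rintegral => t _; rewrite dE.
Qed.

Lemma charf_near0_deriv H th u : cintegrable mu H -> measurable_fun setT th ->
  cintegrable mu (fun t => H t * (th t)%:C%C) ->
  (\forall v \near u, charf H th v = 0) -> charf (fun t => H t * (th t)%:C%C) th u = 0.
Proof.
move=> iH mth iH1 h0; have [dR dI] := is_derive_charf u iH mth iH1.
have dc : is_derive u 1 (cst 0 : R -> R) 0 by exact: is_derive_cst.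
have nR : \forall v \near u, cst 0 v = complex.Re (charf H th v).
  by apply: filterS h0 => v ->.
have nI : \forall v \near u, cst 0 v = complex.Im (charf H th v).
  by apply: filterS h0 => v ->.
have [_ eR] := dR; have [_ eI] := dI.
have [_ eR'] := near_eq_is_derive nR dc.
have [_ eI'] := near_eq_is_derive nI dc.
apply: complexP => /=.
  by rewrite -[LHS]eI eI'.
by apply/eqP; rewrite -oppr_eq0 -[X in X == _]eR eR'.
Qed.

(** By [cint_sechks] the factor [sechpi (lam th)] is an average of the phases [exp (i y
    th)], and each of these phases gives zero. *)
Lemma charf_mul_sechpi H th : cintegrable mu H -> measurable_fun setT th ->
  (forall u, charf H th u = 0) ->
  forall lam, 0 < lam -> cint mu (fun t => H t * (sechpi (lam * th t))%:C%C) = 0.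
Proof.
move=> iH mth h0 lam l0.
have ik : cintegrable (@lebesgue_measure R) (fun y => (sechks lam y)%:C%C).
  by split; [exact: integrable_sechks|exact: integrable0].
have := fourier_swap ik iH mth.
under [in RHS]eq_cint do rewrite cint_sechks //.
move=> <-; transitivity (cint (@lebesgue_measure R) (cst (0 : R[i]))).
  by apply: eq_cint => y; rewrite -/(charf H th y) h0 mulr0.
by apply: complexP => /=; rewrite Rintegral_cst //= mul0r.
Qed.

End char_fun.

Section unique_continuation.
Context {R : realType}.
Local Notation leb := (@lebesgue_measure R).
Variable psi : measurableTypeR R -> R[i].
Hypothesis mpsi : cmeas psi.
Hypothesis ipsi : leb.-integrable setT (EFin \o (fun y => Normc.normc (psi y) * expR (2 * `|y|))).

(** The successive derivatives of the Fourier transform of [psi] are, up to powers of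
    [i], those of the functions [psik k]. *)
Let psik k (y : measurableTypeR R) : R[i] := psi y * (y ^+ k)%:C%C.

Let mpsik k : cmeas (psik k).
Proof. by apply: cmeasM => //; apply: cmeas_real; exact: measurable_funX. Qed.

Let psik_bound k y : Normc.normc (psik k y) * expR `|y| <=
  k`!%:R * (Normc.normc (psi y) * expR (2 * `|y|)).
Proof.
rewrite /psik Normc.normcM normc_real normrX.
rewrite (_ : 2 * `|y| = `|y| + `|y|); last by ring.
rewrite expRD mulrCA -!mulrA ler_wpM2l ?normc_ge0 // mulrA.
by rewrite ler_wpM2r ?expR_ge0 // expn_le_expR.
Qed.

Let ipsik_exp k : leb.-integrable setT (EFin \o (fun y => Normc.normc (psik k y) * expR `|y|)).
Proof.
apply: (@rintegrable_le _ _ _ leb _ _ _ (fun y => k`!%:R * (Normc.normc (psi y) * expR (2 * `|y|)))) => //.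
- apply: measurable_funM; first exact: measurable_normc.
  by under eq_fun do rewrite -[`|_|]mul1r; exact: measurable_fun_expRnorm.
- by move=> y _; rewrite ger0_norm ?mulr_ge0 ?normc_ge0 ?expR_ge0.
- exact: rintegrableZl.
Qed.

Let ipsik k : cintegrable leb (psik k).
Proof.
apply: (cintegrable_le _ _ (ipsik_exp k)); first exact: mpsik.
move=> y.
by rewrite ler_peMr ?normc_ge0 // -expR0 ler_expR.
Qed.

(** All derivatives of the Fourier transform of [psi] vanish at [u]. *)
Let flat u := forall k, charf leb (psik k) id u = 0.

Let psikS k y : psik k y * y%:C%C = psik k.+1 y.
Proof. by rewrite /psik -mulrA -realcM -exprSr. Qed.

Let flat_of_near0 (u : R) : (\forall v \near u, charf leb psi id v = 0) -> flat u.
Proof.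
move=> h0.
suff H k : \forall v \near u, charf leb (psik k) id v = 0 by move=> k; exact: nbhs_singleton (H k).
elim: k => [|k IH].
  apply: filterS h0 => v <-; apply: eq_cint => y.
  by rewrite /psik expr0 mulr1.
have := near_join IH; apply: filterS => v hv.
have := @charf_near0_deriv _ _ R leb (psik k) id v (ipsik k) (@measurable_id _ _ _).
rewrite (_ : (fun t => _) = psik k.+1); last by apply/funext => y; rewrite psikS.
by apply.
Qed.

(** Flatness at [u] says that all moments of [psi y * exp (i u y)] vanish. Expanding
    [exp (i h y)] in its power series gives flatness at [u + h] for [|h| <= 1]; the step
    is uniform, because the exponential moment does not depend on [u]. *)
Let flat_step (u h : R) : `|h| <= 1 -> flat u -> flat (u + h).
Proof.
move=> h1 fu k.
pose A (y : measurableTypeR R) := psik k y * ce (u * y).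
have iA : cintegrable leb A by apply: cintegrable_ce => //; exact: measurable_funM.
have mA := cintegrable_cmeas iA.
have iAe : leb.-integrable setT (EFin \o (fun y => Normc.normc (A y) * expR `|y|)).
  under [fun y => _]eq_fun do rewrite /A Normc.normcM normc_ce mulr1.
  exact: ipsik_exp.
have mom n : cint leb (fun y => A y * (y ^+ n)%:C%C) = 0.
  rewrite -(fu (k + n)%N); apply: eq_cint => y.
  by rewrite /A /psik exprD realcM; ring.
have expm : measurable_fun setT (fun y : R => expR `|y|).
  by under eq_fun do rewrite -[`|_|]mul1r; exact: measurable_fun_expRnorm.
have momR n : (\int[leb]_y (complex.Re (A y) * y ^+ n))%R = 0.
  have /(congr1 (@complex.Re R)) /= := mom n; rewrite [RHS]/= => <-.
  by apply: eq_Rintegral => y _; rewrite [RHS]cReM /= mulr0 subr0.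
have momI n : (\int[leb]_y (complex.Im (A y) * y ^+ n))%R = 0.
  have /(congr1 (@complex.Im R)) /= := mom n; rewrite [RHS]/= => <-.
  by apply: eq_Rintegral => y _; rewrite [RHS]cImM /= mulr0 add0r.
have iRe : leb.-integrable setT (EFin \o (fun y => `|complex.Re (A y)| * expR `|y|)).
  apply: (@rintegrable_le _ _ _ leb _ _ _ _ _ _ iAe) => //.
    by apply: measurable_funM => //; apply: measurableT_comp => //; exact: mA.1.
  by move=> y _; rewrite ger0_norm ?mulr_ge0 ?expR_ge0 // ler_wpM2r ?expR_ge0 ?norm_Re_le.
have iIm : leb.-integrable setT (EFin \o (fun y => `|complex.Im (A y)| * expR `|y|)).
  apply: (@rintegrable_le _ _ _ leb _ _ _ _ _ _ iAe) => //.
    by apply: measurable_funM => //; apply: measurableT_comp => //; exact: mA.2.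
  by move=> y _; rewrite ger0_norm ?mulr_ge0 ?expR_ge0 // ler_wpM2r ?expR_ge0 ?norm_Im_le.
have Rc := moments_vanish_cos mA.1 iRe momR h1.
have Rs := moments_vanish_sin mA.1 iRe momR h1.
have Ic := moments_vanish_cos mA.2 iIm momI h1.
have Is := moments_vanish_sin mA.2 iIm momI h1.
have bi (f g : R -> R) : leb.-integrable setT (EFin \o f) -> measurable_fun setT g ->
    (forall y, `|g y| <= 1) -> leb.-integrable setT (EFin \o (fun y => f y * g y)).
  move=> fi mg gb; apply: (@rintegrable_le _ _ _ leb _ _ _ (fun y => `|f y|)) => //.
  - by apply: measurable_funM => //; exact: rintegrable_measurable fi.
  - by move=> y _; rewrite normrM ler_piMr.
  - exact: integrable_norm.
have mc : measurable_fun setT (fun y : R => cos (h * y)).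
  by apply: measurableT_comp; [apply: continuous_measurable_fun; exact: continuous_cos|exact: measurable_funM].
have ms : measurable_fun setT (fun y : R => sin (h * y)).
  by apply: measurableT_comp; [apply: continuous_measurable_fun; exact: continuous_sin|exact: measurable_funM].
transitivity (cint leb (fun y => A y * ce (h * y))).
  by apply: eq_cint => y; rewrite /A mulrDl ceD mulrA.
apply: complexP => /=.
- under eq_Rintegral do rewrite cReM /=.
  rewrite RintegralB //; [by rewrite Rc Is subrr|apply: bi|apply: bi] => //; [exact: iA.1| |exact: iA.2|];
    by move=> y; rewrite ?cos_max ?sin_max.
- under eq_Rintegral do rewrite cImM /=.
  rewrite RintegralD //; [by rewrite Rs Ic addr0|apply: bi|apply: bi] => //; [exact: iA.1| |exact: iA.2|];
    by move=> y; rewrite ?cos_max ?sin_max.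
Qed.

Lemma charf_unique_continuation (u : R) : (\forall v \near u, charf leb psi id v = 0) ->
  forall v, charf leb psi id v = 0.
Proof.
move=> /flat_of_near0 fu v.
suff : flat v.
  move=> /(_ 0%N) <-; apply: eq_cint => y; by rewrite /psik expr0 mulr1.
(* Enough steps of length at most one to go from [u] to [v]. *)
pose n := (Num.truncn `|v - u|).+1.
have n0 : (0 : R) < n%:R by rewrite ltr0n.
have hn : `|(v - u) / n%:R| <= 1.
  by rewrite normrM normfV (gtr0_norm n0) ler_pdivrMr // mul1r ltW // truncnS_gt.
have H i : flat (u + i%:R * ((v - u) / n%:R)).
  elim: i => [|i IH]; first by rewrite mul0r addr0.
  by rewrite -natr1 mulrDl mul1r addrA; exact: flat_step.
have := H n; rewrite mulrC mulfVK ?gt_eqF //.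
by rewrite addrC subrK.
Qed.

End unique_continuation.

(** * Uniqueness of the Fourier transform *)

Section approximate_identity.
Context {R : realType}.
Local Notation leb := (@lebesgue_measure R).
Implicit Types (x y a b c lam : R).

Lemma ae_imp (P Q : R -> Prop) : (forall t, P t -> Q t) ->
  {ae leb, forall t, P t} -> {ae leb, forall t, Q t}.
Proof. by move=> PQ; apply: filterS => //; exact: (ae_filter_ringOfSetsType leb). Qed.

Lemma ae_imp2 (P1 P2 Q : R -> Prop) : (forall t, P1 t -> P2 t -> Q t) ->
  {ae leb, forall t, P1 t} -> {ae leb, forall t, P2 t} -> {ae leb, forall t, Q t}.
Proof. by move=> PQ; apply: filterS2 => //; exact: (ae_filter_ringOfSetsType leb). Qed.

Lemma atan_le x : 0 <= x -> atan x <= x.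
Proof.
move=> x0.
have [c _] := @MVT_segment R (@atan R) (fun x => (1 + x ^+ 2)^-1) 0 x x0
  (fun x _ => is_derive1_atan x) (continuous_subspaceT (@continuous_atan R)).
rewrite atan0 !subr0 => ->; rewrite ler_piMl // invf_le1 ?lerDl ?sqr_ge0 //.
by rewrite ltr_wpDr ?sqr_ge0.
Qed.

Lemma atan_ge0 x : 0 <= x -> 0 <= atan x.
Proof. by move=> x0; rewrite -atan0 le_atan. Qed.

Lemma atanV_expR y : atan (expR y) + atan (expR (- y)) = pi / 2.
Proof.
have d (x : R) : is_derive x 1 (fun y => atan (expR y) + atan (expR (- y))) 0.
  apply: is_derive_eq; rewrite /GRing.scale /= expRN.
  have := expR_gt0 x; set X := expR x => X0; field.
  by rewrite !gt_eqF //= ?addr_gt0 ?exprn_gt0.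
have := is_derive_0_is_cst y 0 d => ->.
by rewrite oppr0 expR0 atan1; field.
Qed.

Lemma sechpi_gt0 x : 0 < sechpi x.
Proof. by rewrite divr_gt0 ?addr_gt0 ?expR_gt0 // mulr_gt0 // pi_gt0. Qed.

Lemma sechpi_le x : sechpi x <= 2 * pi * expR (- `|pi * x|).
Proof.
rewrite /sechpi (expRN `|_|) ler_pM2l ?mulr_gt0 ?pi_gt0 // lef_pV2 ?posrE ?addr_gt0 ?expR_gt0 //.
have [h|h] := leP 0 (pi * x); first by rewrite ger0_norm // lerDl expR_ge0.
by rewrite ltr0_norm // lerDr expR_ge0.
Qed.

Lemma continuous_sechpi : continuous (@sechpi R).
Proof.
move=> x; apply: cvgM; first exact: cvg_cst.
apply: cvgV; first by rewrite gt_eqF // addr_gt0 // expR_gt0.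
apply: cvgD.
  apply: (@continuous_comp _ _ _ (fun x : R => pi * x) expR); last exact: continuous_expR.
  by apply: cvgM; [exact: cvg_cst|exact: cvg_id].
apply: (@continuous_comp _ _ _ (fun x : R => - (pi * x)) expR); last exact: continuous_expR.
by apply: cvgN; apply: cvgM; [exact: cvg_cst|exact: cvg_id].
Qed.

Lemma sechpi_shift_le lam c x : 1 <= lam ->
  sechpi (lam * (x - c)) <= 2 * pi * expR `|c| * expR (- `|x|).
Proof.
move=> l1; apply: le_trans (sechpi_le _) _.
rewrite -[leRHS]mulrA -expRD ler_pM2l ?mulr_gt0 ?pi_gt0 // ler_expR.
have h : `|x| - `|c| <= `|x - c| := lerB_dist x c.
have : `|x - c| <= `|pi * (lam * (x - c))|.
  rewrite mulrA normrM ler_peMl // ger0_norm; have := @pi_ge2 R; nra.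
lra.
Qed.

(** Up to the factor [2 / lam], the integral of [sechpi (lam (x - c))] over [c] in [[a,
    b]]; as [lam] grows it tends to [pi / 2] times the indicator of the interval. *)
Definition atan_step lam a b x : R :=
  atan (expR (pi * (lam * (x - a)))) - atan (expR (pi * (lam * (x - b)))).

Lemma integral_sechpi_shift lam a b x : 0 < lam -> a < b ->
  (\int[leb]_(c in `[a, b]) (sechpi (lam * (x - c))))%R = 2 / lam * atan_step lam a b x.
Proof.
move=> l0 ab.
have dF (c : R) : is_derive c 1 (fun c => - (2 / lam) * atan (expR (pi * (lam * (x - c)))))
    (sechpi (lam * (x - c))).
  apply: is_derive_eq; rewrite /GRing.scale /= /sechpi expRN.
  have := expR_gt0 (pi * (lam * (x - c))); set X := expR _ => X0; field.
  by rewrite !gt_eqF //= addr_gt0 ?mulr_gt0.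
have cF := continuous_of_derive dF.
rewrite /Rintegral (@continuous_FTC2 _ _ (fun c => - (2 / lam) * atan (expR (pi * (lam * (x - c)))))) //=.
- by rewrite /atan_step; ring.
- apply: continuous_subspaceT => c.
  apply: (@continuous_comp _ _ _ (fun c : R => lam * (x - c)) sechpi); last exact: continuous_sechpi.
  by apply: cvgM; [exact: cvg_cst|apply: cvgB; [exact: cvg_cst|exact: cvg_id]].
- split; first by move=> c _; case: (dF c).
  + exact/cvg_at_right_filter/cF.
  + exact/cvg_at_left_filter/cF.
- by move=> c _; rewrite derive1E; case: (dF c).
Qed.

Lemma atan_step_ge0 lam a b x : 0 < lam -> a < b -> 0 <= atan_step lam a b x.
Proof.
move=> l0 ab; rewrite subr_ge0 le_atan // ler_expR ler_pM2l ?pi_gt0 // ler_pM2l //.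
by rewrite lerD2l lerN2 ltW.
Qed.

Lemma expR_mul_le lam d : 1 <= lam -> d <= 0 -> expR (pi * (lam * d)) <= expR d.
Proof.
move=> l1 d0; rewrite ler_expR mulrA -[leRHS]mul1r ler_wnM2r //.
by have := @pi_ge2 R; nra.
Qed.

(** A domination that does not depend on [lam]: outside the interval the two arctangents
    are either both small or both close to [pi / 2]. *)
Lemma atan_step_le lam a b x : 1 <= lam -> a < b ->
  atan_step lam a b x <= 2 * (expR (`|a| + `|b|) * expR (- `|x|)).
Proof.
move=> l1 ab; have l0 : 0 < lam by apply: lt_le_trans l1.
have pi2 : pi / 2 < 2 :> R := @pihalf_lt2 R.
rewrite -expRD.
have E0 := expR_gt0 (`|a| + `|b| + - `|x|).
have na := normr_ge0 a; have nb := normr_ge0 b.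
have [xa|ax] := leP x a.
  have h1 : atan (expR (pi * (lam * (x - a)))) <= expR (x - a).
    apply: le_trans (atan_le (expR_ge0 _)) _; apply: expR_mul_le => //; lra.
  have h2 := atan_ge0 (expR_ge0 (pi * (lam * (x - b)))).
  have h3 : expR (x - a) <= expR (`|a| + `|b| + - `|x|).
    rewrite ler_expR; have := lerB_dist x a; rewrite [`|x - a|]ler0_norm; lra.
  rewrite /atan_step; lra.
have [bx|xb] := leP b x.
  have h1 := atan_ltpi2 (expR (pi * (lam * (x - a)))).
  have h2 := atanV_expR (pi * (lam * (x - b))).
  have h3 : atan (expR (- (pi * (lam * (x - b))))) <= expR (b - x).
    apply: le_trans (atan_le (expR_ge0 _)) _.
    rewrite (_ : - (pi * (lam * (x - b))) = pi * (lam * (b - x))); last by ring.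
    by apply: expR_mul_le => //; lra.
  have h4 : expR (b - x) <= expR (`|a| + `|b| + - `|x|).
    rewrite ler_expR; have := lerB_dist x b; rewrite [`|x - b|]ger0_norm; lra.
  rewrite /atan_step; lra.
have h1 := atan_ltpi2 (expR (pi * (lam * (x - a)))).
have h2 := atan_ge0 (expR_ge0 (pi * (lam * (x - b)))).
have h3 : 1 <= expR (`|a| + `|b| + - `|x|).
  rewrite -[leLHS]expR0 ler_expR.
  suff : `|x| <= `|a| + `|b| by lra.
  have hb := ler_norm b; have := ler_norm (- a); rewrite normrN ler_norml => ha.
  by apply/andP; split; lra.
rewrite /atan_step; lra.
Qed.

Lemma cvg_atan_expR_neg d : d < 0 ->
  atan (expR (pi * (n.+1%:R * d))) @[n --> \oo] --> (0 : R).
Proof.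
move=> d0.
apply: (@squeeze_cvgr _ _ _ _ (cst 0) (fun n : nat => expR (pi * d) ^+ n.+1)).
- near=> n; rewrite atan_ge0 ?expR_ge0 //= -expRM_natl.
  rewrite (_ : pi * (n.+1%:R * d) = n.+1%:R * (pi * d)); last by ring.
  by rewrite atan_le ?expR_ge0.
- exact: cvg_cst.
- rewrite (cvg_shiftS (fun n => expR (pi * d) ^+ n)); apply: cvg_expr.
  by rewrite ger0_norm ?expR_ge0 // expR_lt1 pmulr_rlt0 // pi_gt0.
Unshelve. all: by end_near. Qed.

Lemma cvg_atan_step a b x : a < b -> x != a -> x != b ->
  atan_step n.+1%:R a b x @[n --> \oo] --> (pi / 2 * \1_(`]a, b[%classic) x : R).
Proof.
move=> ab xa xb.
have pos d : 0 < d -> atan (expR (pi * (n.+1%:R * d))) @[n --> \oo] --> (pi / 2 : R).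
  move=> d0.
  have e : (fun n : nat => atan (expR (pi * (n.+1%:R * d)))) =
      (fun n : nat => pi / 2 - atan (expR (pi * (n.+1%:R * (- d))))).
    by apply/funext => n; rewrite -(atanV_expR (pi * (n.+1%:R * d))) !mulrN addrK.
  have H : pi / 2 - atan (expR (pi * (n.+1%:R * (- d)))) @[n --> \oo] --> (pi / 2 - 0 : R).
    apply: cvgB; first exact: cvg_cst.
    by apply: cvg_atan_expR_neg; rewrite oppr_lt0.
  by rewrite e; rewrite subr0 in H.
rewrite indicE mem_setE in_itv /=.
have [h1|h1] := ltP a x; have [h2|h2] := ltP x b => /=.
- rewrite mulr1 -(subr0 (pi / 2)); apply: cvgB; first by apply: pos; rewrite subr_gt0.
  by apply: cvg_atan_expR_neg; rewrite subr_lt0.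
- rewrite mulr0 -(subrr (pi / 2)); apply: cvgB; apply: pos; rewrite subr_gt0 //.
  by rewrite lt_neqAle h2 eq_sym xb.
- rewrite mulr0 -(subrr 0); apply: cvgB; apply: cvg_atan_expR_neg; rewrite subr_lt0 //.
  by rewrite lt_neqAle h1 xa.
- by have := lt_le_trans ab h2; rewrite ltNge h1.
Qed.

(** Fubini in [(c, t)], with [c] ranging over [[a, b]], shows that [h] is orthogonal to
    [atan_step lam a b (th t)]; then [lam] tends to infinity. The limit is an indicator
    except where [th] takes the value [a] or [b], hence the hypothesis on the fibres of
    [th]. *)
Lemma sechpi_tests_vanish_itv (h th : measurableTypeR R -> R) a b :
  measurable_fun setT h -> measurable_fun setT th ->
  leb.-integrable setT (EFin \o (fun t => `|h t| * expR (- `|th t|))) ->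
  (forall lam c, 1 <= lam -> (\int[leb]_t (h t * sechpi (lam * (th t - c))))%R = 0) ->
  (forall c, {ae leb, forall t, th t = c -> h t = 0}) -> a < b ->
  (\int[leb]_t (h t * \1_(`]a, b[%classic) (th t)))%R = 0.
Proof.
move=> mh mth ih h0 hae ab.
have mst lam c : measurable_fun setT (fun t => sechpi (lam * (th t - c))).
  apply: (@measurableT_comp _ _ _ _ _ _ (@sechpi R)).
    by apply: continuous_measurable_fun; exact: continuous_sechpi.
  by apply: measurable_funM => //; apply: measurable_funB.
have mat lam : measurable_fun setT (fun t => atan_step lam a b (th t)).
  have mA (c : R) : measurable_fun setT (fun t => atan (expR (pi * (lam * (th t - c))))).
    apply: (@measurableT_comp _ _ _ _ _ _ (@atan R)).
      by apply: continuous_measurable_fun; exact: continuous_atan.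
    apply: measurableT_comp => //; apply: measurable_funM => //.
    by apply: measurable_funM => //; apply: measurable_funB.
  exact: measurable_funB.
have ihs lam c : 1 <= lam -> leb.-integrable setT (EFin \o (fun t => h t * sechpi (lam * (th t - c)))).
  move=> l1; apply: (@rintegrable_le _ _ _ leb _ _ _ (fun t => 2 * pi * expR `|c| * (`|h t| * expR (- `|th t|)))) => //.
  - exact: measurable_funM.
  - move=> t _; rewrite normrM mulrCA ler_wpM2l // ger0_norm ?(ltW (sechpi_gt0 _)) //.
    exact: sechpi_shift_le.
  - exact: rintegrableZl.
have iha lam : 1 <= lam -> leb.-integrable setT (EFin \o (fun t => h t * atan_step lam a b (th t))).
  move=> l1; apply: (@rintegrable_le _ _ _ leb _ _ _ (fun t => 2 * expR (`|a| + `|b|) * (`|h t| * expR (- `|th t|)))) => //.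
  - exact: measurable_funM.
  - move=> t _; rewrite normrM mulrCA ler_wpM2l // ger0_norm ?atan_step_ge0 //; last exact: lt_le_trans l1.
    by rewrite -mulrA atan_step_le.
  - exact: rintegrableZl.
have step0 lam : 1 <= lam -> (\int[leb]_t (h t * atan_step lam a b (th t)))%R = 0.
  move=> l1; have l0 : 0 < lam by apply: lt_le_trans l1.
  pose C := 2 * pi * expR (`|a| + `|b|).
  pose g (z : measurableTypeR R * measurableTypeR R) : R :=
    \1_(`[a, b]%classic) z.1 * (h z.2 * sechpi (lam * (th z.2 - z.1))).
  have mg : measurable_fun setT g.
    apply: measurable_funM.
      have mI : measurable_fun setT (fun c : measurableTypeR R => \1_(`[a, b]%classic) c : R).
        exact: measurable_indic.
      exact: measurableT_comp mI _.
    apply: measurable_funM; first by apply: measurableT_comp mh _.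
    apply: (@measurableT_comp _ _ _ _ _ _ (@sechpi R)).
      by apply: continuous_measurable_fun; exact: continuous_sechpi.
    apply: measurable_funM => //; apply: measurable_funB => //.
    by apply: measurableT_comp mth _.
  have ig : (leb \x leb)%E.-integrable setT (EFin \o g).
    have i1 : leb.-integrable setT (EFin \o (fun c => C * \1_(`[a, b]%classic) c)).
      by apply: rintegrableZl => //; exact: integrable_indic_itv.
    apply: (rintegrable_le measurableT mg _ (rintegrable_prod i1 ih)).
    move=> [c t] _; rewrite /g /= normrM (ger0_norm (_ : 0 <= \1_(`[a, b]%classic) c)) // indicE.
    have [|_] := boolP (c \in `[a, b]%classic); last by rewrite !mul0r mulr0 mul0r.
    rewrite mem_setE in_itv /= => /andP[ac cb]; rewrite mul1r mulr1 normrM mulrCA ler_wpM2l //.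
    rewrite ger0_norm ?(ltW (sechpi_gt0 _)) // (le_trans (sechpi_shift_le c (th t) l1)) //.
    rewrite ler_wpM2r ?expR_ge0 // ler_wpM2l ?mulr_ge0 ?pi_ge0 // ler_expR.
    have na := normr_ge0 a; have nb := normr_ge0 b.
    have hb := ler_norm b; have := ler_norm (- a); rewrite normrN ler_norml => ha.
    by apply/andP; split; lra.
  have [_ e1] := Rfubini12 ig; have [_ e2] := Rfubini21 ig.
  have E2 t : (\int[leb]_c g (c, t))%R = 2 / lam * (h t * atan_step lam a b (th t)).
    rewrite mulrCA -integral_sechpi_shift // [X in _ = h t * X]Rintegral_mkcond -RintegralZl //.
      by apply: eq_Rintegral => c _; rewrite /g /= patchE indicE; case: ifP => _; rewrite ?mul1r ?mul0r ?mulr0.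
    apply: (@rintegrable_le _ _ _ leb _ _ _ (fun c => 2 * pi * \1_(`[a, b]%classic) c)) => //.
    - apply/(measurable_restrictT _ _).1 => //; apply: measurable_funTS.
      apply: continuous_measurable_fun => c.
      apply: (@continuous_comp _ _ _ (fun c : R => lam * (th t - c)) sechpi); last exact: continuous_sechpi.
      by apply: cvgM; [exact: cvg_cst|apply: cvgB; [exact: cvg_cst|exact: cvg_id]].
    - move=> c _; rewrite patchE indicE; case: ifP => _; last by rewrite normr0 mulr0.
      rewrite mulr1 ger0_norm ?(ltW (sechpi_gt0 _)) // (le_trans (sechpi_le _)) //.
      by rewrite ler_piMr ?mulr_ge0 ?pi_ge0 // expR_le1 oppr_le0.
    - by apply: rintegrableZl => //; exact: integrable_indic_itv.
  have E1 c : (\int[leb]_t g (c, t))%R = 0.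
    by rewrite /g /= RintegralZl ?h0 ?mulr0 //; exact: ihs.
  move: e2; rewrite -e1.
  under eq_Rintegral do rewrite E2.
  under [in X in _ = X -> _]eq_Rintegral do rewrite E1.
  rewrite Rintegral_cst //= mul0r RintegralZl //; last exact: iha.
  by move/eqP; rewrite mulf_eq0 gt_eqF ?divr_gt0 //= => /eqP.
have mI : measurable_fun setT (fun c : measurableTypeR R => \1_(`]a, b[%classic) c : R).
  exact: measurable_indic.
have mL : measurable_fun setT (fun t => h t * (pi / 2 * \1_(`]a, b[%classic) (th t))).
  by apply: measurable_funM => //; apply: measurable_funM => //; exact: measurableT_comp mI _.
have l1 n : 1 <= n.+1%:R :> R by rewrite ler1n.
have ae1 : {ae leb, forall t, setT t ->
    (EFin \o (fun t => h t * atan_step n.+1%:R a b (th t))) t @[n --> \oo] -->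
    (EFin \o (fun t => h t * (pi / 2 * \1_(`]a, b[%classic) (th t)))) t}.
  have hA := hae a; have hB := hae b; apply: filterS2 hA hB => t ha hb _ /=.
  apply: cvg_EFin; first exact: nearW.
  have [ta|ta] := eqVneq (th t) a; first by rewrite ha // mul0r; under eq_fun do rewrite mul0r; exact: cvg_cst.
  have [tb|tb] := eqVneq (th t) b; first by rewrite hb // mul0r; under eq_fun do rewrite mul0r; exact: cvg_cst.
  by apply: cvgM; [exact: cvg_cst|exact: cvg_atan_step].
have dom : {ae leb, forall t (n : nat), setT t ->
    (`|(EFin \o (fun t => (h t * atan_step n.+1%:R a b (th t))%R)) t| <=
    (EFin \o (fun t => (2 * expR (`|a| + `|b|) * (`|h t| * expR (- `|th t|)))%R)) t)%E}.
  apply: aeW => t n _; rewrite /= lee_fin normrM mulrCA ler_wpM2l // ger0_norm ?atan_step_ge0 //.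
  by rewrite -mulrA atan_step_le.
have [iL _ lim] := @dominated_convergence _ _ _ leb setT measurableT
  (fun n => EFin \o (fun t => h t * atan_step n.+1%:R a b (th t))) _ _
  (fun n => measurable_int _ (iha _ (l1 n)))
  ((measurable_EFinP _ _).2 mL) ae1 (rintegrableZl measurableT _ ih) dom.
have lim0 : [sequence (\int[leb]_t (EFin \o (fun t => (h t * atan_step n.+1%:R a b (th t))%R)) t)%E]_n @ \oo --> 0%E.
  rewrite (_ : [sequence _]_n = cst 0%E); first exact: cvg_cst.
  apply/funext => n; rewrite /= -[RHS]/(0%:E) -(step0 _ (l1 n)) /Rintegral fineK //.
  by apply: integrable_fin_num => //; exact: iha.
have E := cvg_unique _ lim lim0.
have i1 : leb.-integrable setT (EFin \o (fun t => h t * \1_(`]a, b[%classic) (th t))).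
  rewrite (_ : (fun t => _) = (fun t => 2 / pi * (h t * (pi / 2 * \1_(`]a, b[%classic) (th t))))).
    exact: rintegrableZl.
  by apply/funext => t; move: (@pi R) (@pi_gt0 R) => p p0; field; exact: lt0r_neq0.
have : (\int[leb]_t (h t * (pi / 2 * \1_(`]a, b[%classic) (th t))))%R = 0 by rewrite /Rintegral E.
under eq_Rintegral do rewrite mulrCA.
rewrite RintegralZl // => /eqP; rewrite mulf_eq0 gt_eqF ?divr_gt0 ?pi_gt0 //= => /eqP.
exact.
Qed.

(** The primitive of [g] from minus infinity is constant, and by the Lebesgue
    differentiation theorem its derivative is [g] almost everywhere. *)
Lemma ae_eq0_of_itv (g : measurableTypeR R -> R) : leb.-integrable setT (EFin \o g) ->
  (forall a b, a < b -> (\int[leb]_t (g t * \1_(`]a, b[%classic) t))%R = 0) ->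
  {ae leb, forall t, g t = 0}.
Proof.
move=> ig g0.
have igS (A : set (measurableTypeR R)) : measurable A -> leb.-integrable A (EFin \o g).
  by move=> mA; apply: integrableS ig.
have mg := rintegrable_measurable ig.
have lg : locally_integrable setT g by apply: open_integrable_locally; first exact: openT.
have := FTC1Ny (fun y => igS _ (measurable_itv `]-oo, y])) lg.
set F := fun x : R => (\int[leb]_(t in `]-oo, x]) g t)%R.
have Fle x y : x < y -> F y = F x.
  move=> xy; apply/eqP; rewrite -subr_eq0 /F.
  rewrite Rintegral_itvB; [|by apply: igS; exact: measurable_itv|by []|by rewrite bnd_simp ltW].
  rewrite -Rintegral_itv_bndo_bndc; last by apply: igS; exact: measurable_itv.
  rewrite -(g0 x y xy) Rintegral_mkcond; apply/eqP; apply: eq_Rintegral => t _.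
  by rewrite patchE indicE; case: ifP => _; rewrite ?mulr1 ?mulr0.
have FE x y : F y = F x.
  by have [xy|yx|->//] := ltgtP x y; [exact: Fle|apply/esym; exact: Fle].
apply: filterS; first exact: (ae_filter_ringOfSetsType leb).
move=> t [_ <-].
rewrite derive1E (_ : F = cst (F 0)); first by rewrite derive_cst.
by apply/funext => x; exact: FE.
Qed.

Lemma charf_translate d (T : measurableType d) (mu : {sigma_finite_measure set T -> \bar R})
    (H : T -> R[i]) (th : T -> R) (c u : R) : cintegrable mu H -> measurable_fun setT th ->
  charf mu H (fun t => th t - c) u = ce (- (u * c)) * charf mu H th u.
Proof.
move=> iH mth; rewrite /charf -cintZl.
  apply: eq_cint => t; rewrite (_ : u * (th t - c) = - (u * c) + u * th t); last by ring.
  by rewrite (ceD (- (u * c))); ring.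
by apply: cintegrable_ce => //; exact: measurable_funM.
Qed.

Lemma ae_neq_pt (c : R) : {ae leb, forall t : R, t <> c}.
Proof.
exists [set c]; split; [exact: measurable_set1|exact: lebesgue_measure_set1|].
by move=> t /= /contrapT ->.
Qed.

(** The transform of [psi] translated by [c] vanishes as well, so that
    [charf_mul_sechpi] makes [psi] orthogonal to every [sechpi (lam (t - c))]. *)
Lemma charf_eq0_ae (psi : measurableTypeR R -> R[i]) : cintegrable leb psi ->
  (forall u, charf leb psi id u = 0) ->
  {ae leb, forall t, psi t = 0}.
Proof.
move=> ipsi h0.
have key lam c : 1 <= lam -> cint leb (fun t => psi t * (sechpi (lam * (t - c)))%:C%C) = 0.
  move=> l1; apply: (@charf_mul_sechpi _ _ _ leb psi (fun t => t - c)) => //.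
  - exact: measurable_funB.
  - by move=> u; rewrite (@charf_translate _ _ leb psi id) // h0 mulr0.
  - exact: lt_le_trans l1.
have ae0 (h : measurableTypeR R -> R) : leb.-integrable setT (EFin \o h) ->
   (forall lam c, 1 <= lam -> (\int[leb]_t (h t * sechpi (lam * (t - c))))%R = 0) ->
   {ae leb, forall t, h t = 0}.
  move=> ih hk; have mh := rintegrable_measurable ih.
  apply: ae_eq0_of_itv => // a b ab.
  apply: (@sechpi_tests_vanish_itv h id) => //.
  - apply: (@rintegrable_le _ _ _ leb _ _ _ (fun t => `|h t|)) => //.
    + apply: measurable_funM; first exact: measurableT_comp.
      by under eq_fun do rewrite -mulN1r; exact: measurable_fun_expRnorm.
    + by move=> t _; rewrite normrM normr_id ler_piMr // ger0_norm ?expR_ge0 // expR_le1 oppr_le0.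
    + exact: integrable_norm.
  - by move=> c; apply: ae_imp (ae_neq_pt c) => t.
have hR : {ae leb, forall t, complex.Re (psi t) = 0}.
  apply: ae0; first exact: ipsi.1.
  move=> lam c l1; have /(congr1 (@complex.Re R)) := key lam c l1; rewrite [RHS]/= => <- /=.
  by apply: eq_Rintegral => t _; rewrite [RHS]cReM /= mulr0 subr0.
have hI : {ae leb, forall t, complex.Im (psi t) = 0}.
  apply: ae0; first exact: ipsi.2.
  move=> lam c l1; have /(congr1 (@complex.Im R)) := key lam c l1; rewrite [RHS]/= => <- /=.
  by apply: eq_Rintegral => t _; rewrite [RHS]cImM /= mulr0 add0r.
by apply: ae_imp2 hR hI => t h1 h2; apply: complexP; rewrite ?h1 ?h2.
Qed.

End approximate_identity.

(** * The convolution on the critical line *)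

Section sigma_finite_product.
Context d1 d2 (T1 : measurableType d1) (T2 : measurableType d2) (R : realType).
Variables (m1 : {sigma_finite_measure set T1 -> \bar R}) (m2 : {sigma_finite_measure set T2 -> \bar R}).

(** The product measure under a name of its own, so that unification finds the
    sigma-finite structure on it. *)
Definition sfprod : set (T1 * T2)%type -> \bar R := (m1 \x m2)%E.

HB.instance Definition _ := Measure.on sfprod.

Let sfprod_sigma_finite : sigma_finite setT sfprod.
Proof.
have /sigma_finiteP[F [TF ndF Foo]] := sigma_finiteT m1.
have /sigma_finiteP[G [TG ndG Goo]] := sigma_finiteT m2.
exists (fun n => F n `*` G n).
  rewrite -setXTT TF TG predeqE => -[x y]; split.
    move=> [/= [n _ Fnx] [k _ Gky]]; exists (maxn n k) => //; split.
    - by move: x Fnx; exact/subsetPset/ndF/leq_maxl.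
    - by move: y Gky; exact/subsetPset/ndG/leq_maxr.
  by move=> [n _ []/= ? ?]; split; exists n.
move=> k; have [? ?] := Foo k; have [? ?] := Goo k.
split; first exact: measurableX.
by rewrite /sfprod product_measure1E// lte_mul_pinfty// ge0_fin_numE.
Qed.

HB.instance Definition _ := Measure_isSigmaFinite.Build _ _ _ sfprod sfprod_sigma_finite.

End sigma_finite_product.

Section product.
Context {R : realType}.
Local Notation leb := (@lebesgue_measure R).
Local Notation leb2 := (sfprod leb leb).
Local Notation charf2 := (@charf _ (measurableTypeR R * measurableTypeR R)%type R leb2).
Implicit Types (x u tau eta : R).

(** The image under the exponential of a neighbourhood is an interval of positive
    measure, and so is not negligible. *)
Lemma ae_ln_near (P : R -> Prop) u :
  {ae leb, forall x, Rplus x -> P (ln x)} -> ~ (\forall v \near u, ~ P v).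
Proof.
move=> [N [mN N0 PN]] /nbhs_ballP[e /= e0 he].
have sub : `]expR (u - e), expR (u + e)[%classic `<=` N.
  move=> x; rewrite /= in_itv /= => /andP[h1 h2].
  have x0 : 0 < x by rewrite (lt_trans _ h1) ?expR_gt0.
  apply: PN => /(_ x0); apply: (he (ln x)).
  rewrite /ball /= distrC ltr_distl.
  by rewrite -ltr_expR -[X in _ && X]ltr_expR lnK ?posrE // h1 h2.
have : (leb `]expR (u - e), expR (u + e)[%classic <= 0)%E.
  by rewrite -N0; apply: le_measure; rewrite ?inE //; exact: measurable_itv.
have ee : expR (u - e) < expR (u + e) by rewrite ltr_expR; lra.
rewrite lebesgue_measure_itv /= lte_fin ee -EFinB lee_fin; lra.
Qed.

Lemma integrable_quarter_sqr_inv : leb.-integrable setT (EFin \o (fun y : R => (4^-1 + y ^+ 2)^-1)).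
Proof.
have q0 (y : R) : 0 < 4^-1 + y ^+ 2 by rewrite ltr_wpDr ?sqr_ge0.
apply: (@integrable_FTC_line _ _ (fun y => 2 * atan (2 * y)) pi).
- move=> y; apply: cvgV; first by rewrite gt_eqF.
  by apply: cvgD; [exact: cvg_cst|exact: exprn_continuous].
- by move=> y; rewrite invr_ge0 ltW.
- move=> y; apply: is_derive_eq; rewrite /GRing.scale /=.
  have := q0 y => h; field.
  by rewrite !gt_eqF //; have := sqr_ge0 y; nra.
- by move=> y; rewrite normrM gtr0_norm // mulrC -ler_pdivlMr // atan_bound.
Qed.

(** Cauchy-Schwarz in the form [2 ab <= a ^ 2 + b ^ 2]: [F] is the product of [s F s]
    and [1 / s], and both are square integrable on the critical line. *)
Lemma L2_sigma_cintegrable (F : R[i] -> R[i]) : L2_sigma F ->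
  L2_sigma (fun s => s * F s) -> cintegrable leb (fun tau : R => F (sigma tau)).
Proof.
move=> [mF _] [msF isF].
have i1 := @integrable_quarter_sqr_inv.
have i2 : leb.-integrable setT (EFin \o (fun tau : R => Normc.normc (sigma tau * F (sigma tau)) ^+ 2)).
  apply/integrableP; split.
    by apply/measurable_EFinP; apply: measurable_funX; exact: measurable_normc.
  by under eq_integral do rewrite /= ger0_norm ?sqr_ge0 //.
apply: (@cintegrable_le _ (measurableTypeR R) R leb (fun tau => F (sigma tau)) (fun tau => 2^-1 * ((4^-1 + tau ^+ 2)^-1 + Normc.normc (sigma tau * F (sigma tau)) ^+ 2))) => //.
  move=> tau; rewrite Normc.normcM exprMn.
  have sE : Normc.normc (sigma tau) ^+ 2 = 4^-1 + tau ^+ 2.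
    rewrite /Normc.normc /= sqr_sqrtr ?addr_ge0 ?sqr_ge0 //; congr (_ + _); by field.
  rewrite sE; set q := 4^-1 + _.
  have q0 : 0 < q by rewrite ltr_wpDr ?sqr_ge0.
  set n := Normc.normc _.
  have : 0 <= (q * n - 1) ^+ 2 / q by rewrite divr_ge0 ?sqr_ge0 ?(ltW q0).
  have -> : (q * n - 1) ^+ 2 / q = q * n ^+ 2 - 2 * n + q^-1 by field; rewrite gt_eqF.
  lra.
by apply: rintegrableZl => //; exact: rintegrableD.
Qed.

Definition convK tau eta : R := (sechpi tau * sechpi eta / sechpi (tau + eta)) ^+ 2.

Lemma conv_kernel_sigma tau eta : conv_kernel (sigma tau) (sigma eta) = (convK tau eta)%:C%C.
Proof.
have sN x : 1 - sigma x = sigma (- x) :> R[i].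
  by apply: complexP => /=; field.
have hE : 1 / 2 = (2^-1 : R)%:C%C by rewrite mul1r fmorphV rmorph_nat.
have h3E : 3 / 2 = (3 / 2 : R)%:C%C by rewrite fmorph_div !rmorph_nat.
have sD : sigma tau + sigma eta - 1 / 2 = sigma (tau + eta) :> R[i].
  by rewrite hE; apply: complexP => /=; field.
have sDN : 3 / 2 - sigma tau - sigma eta = sigma (- (tau + eta)) :> R[i].
  by rewrite h3E; apply: complexP => /=; field.
rewrite /conv_kernel !sN sD sDN Gamma_reflection.
rewrite -(mulrA (_ %:C)%C) !Gamma_reflection.
by rewrite -realcM -fmorph_div -rmorphXn.
Qed.

(** This is [cosh (a + b) <= 2 cosh a cosh b], valid since the right-hand side is [cosh
    (a + b) + cosh (a - b)]. *)
Lemma convK_bound tau eta : 0 <= convK tau eta <= (2 * pi) ^+ 2.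
Proof.
rewrite sqr_ge0 /= ler_sqr ?nnegrE ?divr_ge0 ?mulr_ge0 ?(ltW (sechpi_gt0 _)) ?pi_ge0 //.
rewrite ler_pdivrMr ?sechpi_gt0 // /sechpi (mulrDr pi tau eta) !expRN !expRD.
have := expR_gt0 (pi * tau); have := expR_gt0 (pi * eta).
have := @pi_gt0 R; move: (expR (pi * tau)) (expR (pi * eta)) => X Y.
move: (@pi R) => p p0 Y0 X0.
have e1 Z : 0 < Z -> 2 * p / (Z + Z^-1) = 2 * p * (Z / (Z ^+ 2 + 1)).
  move=> Z0; have : 0 < Z ^+ 2 + 1 by rewrite ltr_wpDl ?sqr_ge0.
  move=> q0; field; rewrite !gt_eqF //; lra.
rewrite !e1 ?mulr_gt0 //.
have k0 : 0 < 2 * p by rewrite mulr_gt0.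
rewrite mulrACA [leRHS]mulrA ler_pM2l ?mulr_gt0 // mulf_div.
have XX := sqr_ge0 X; have YY := sqr_ge0 Y.
have XY : 0 <= X ^+ 2 * Y ^+ 2 by rewrite mulr_ge0.
rewrite ler_pM2l ?mulr_gt0 // lef_pV2 ?posrE ?exprMn; last 2 first.
- by rewrite mulr_gt0 //; lra.
- by lra.
lra.
Qed.

Lemma cintegralE (f : R -> R[i]) : cintegral setT f = cint leb f.
Proof. by []. Qed.

Lemma cpow_sigma x tau eta : cpow x (- sigma tau - sigma eta) =
  (expR (- ln x))%:C%C * ce (- ln x * (tau + eta)) :> R[i].
Proof.
rewrite /cpow /ce /=; congr (_ * _).
  by congr (expR _)%:C%C; field.
by rewrite (_ : (- tau - eta) * ln x = - ln x * (tau + eta)) //; ring.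
Qed.

Lemma measurable_sechpi : measurable_fun setT (@sechpi R).
Proof. by apply: continuous_measurable_fun; exact: continuous_sechpi. Qed.

Lemma sechpi_le_2pi x : sechpi x <= 2 * pi.
Proof.
by rewrite (le_trans (sechpi_le _)) // ler_piMr ?mulr_ge0 ?pi_ge0.
Qed.

Lemma cintegrable_sechpi2 (F1 : measurableTypeR R -> R[i]) : cintegrable leb F1 ->
  cintegrable leb (fun t => F1 t * (sechpi t ^+ 2)%:C%C).
Proof.
move=> iF; under eq_fun do rewrite mulrC.
apply: (@cintegrableM _ _ _ leb _ _ ((2 * pi) ^+ 2)) => //.
  by apply: cmeas_real; apply: measurable_funX; exact: measurable_sechpi.
move=> t; rewrite normc_real ger0_norm ?sqr_ge0 // ler_sqr ?nnegrE ?mulr_ge0 ?pi_ge0 //.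
exact: sechpi_le_2pi.
Qed.

Lemma measurable_sechpiV : measurable_fun setT (fun x : R => (sechpi x)^-1).
Proof.
apply: continuous_measurable_fun => x.
by apply: cvgV; [rewrite gt_eqF ?sechpi_gt0|exact: continuous_sechpi].
Qed.

Section kernel.
Variables F1 G1 : measurableTypeR R -> R[i].
Hypotheses (iF : cintegrable leb F1) (iG : cintegrable leb G1).

Let H (z : measurableTypeR R * measurableTypeR R) : R[i] := (convK z.1 z.2)%:C%C * F1 z.1 * G1 z.2.

Let mth : measurable_fun setT (fun z : measurableTypeR R * measurableTypeR R => (z.1 + z.2 : R)).
Proof. exact: measurable_funD. Qed.

Let iH : cintegrable leb2 H.
Proof.
apply: (@cintegrable_prod_le _ _ _ _ _ leb leb H (fun x => (2 * pi) ^+ 2 * Normc.normc (F1 x)) (fun x => Normc.normc (G1 x))).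
- apply: cmeasM; [apply: cmeasM|].
  + apply: cmeas_real; apply: measurable_funX; apply: measurable_funM.
      by apply: measurable_funM; apply: (measurableT_comp measurable_sechpi).
    exact: (measurableT_comp measurable_sechpiV).
  + have [h1 h2] := cintegrable_cmeas iF; split; [exact: (measurableT_comp h1 measurable_fst)|exact: (measurableT_comp h2 measurable_fst)].
  + have [h1 h2] := cintegrable_cmeas iG; split; [exact: (measurableT_comp h1 measurable_snd)|exact: (measurableT_comp h2 measurable_snd)].
- move=> x y; rewrite /H /= !Normc.normcM normc_real ger0_norm ?sqr_ge0 //.
  rewrite ler_wpM2r ?normc_ge0 // ler_wpM2r ?normc_ge0 //.
  by have /andP[] := convK_bound x y.
- by apply: rintegrableZl => //; exact: cintegrable_normc.
- exact: cintegrable_normc.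
Qed.

(** Multiplying twice by [sechpi (tau + eta)] clears the denominator of [convK]; what is
    left is a product of a function of [tau] and one of [eta], with a phase that splits
    as well. *)
Lemma charf_kernel_prod : (forall u, charf2 H (fun z => z.1 + z.2) u = 0) ->
  forall u, charf leb (fun t => F1 t * (sechpi t ^+ 2)%:C%C) id u *
            charf leb (fun t => G1 t * (sechpi t ^+ 2)%:C%C) id u = 0.
Proof.
move=> h0 u.
have step (H' : measurableTypeR R * measurableTypeR R -> R[i]) : cintegrable leb2 H' ->
  (forall u, charf2 H' (fun z => z.1 + z.2) u = 0) ->
  forall u, charf2 (fun z => H' z * (sechpi (z.1 + z.2))%:C%C) (fun z => z.1 + z.2) u = 0.
  move=> iH' h v.
  have iHv : cintegrable leb2 (fun z => H' z * ce (v * (z.1 + z.2))).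
    by apply: cintegrable_ce => //; exact: measurable_funM.
  have hw w : charf2 (fun z => H' z * ce (v * (z.1 + z.2))) (fun z => z.1 + z.2) w = 0.
    rewrite -(h (v + w)); apply: eq_cint => z.
    by rewrite -mulrA -ceD -mulrDl.
  rewrite -(charf_mul_sechpi iHv mth hw (@ltr01 R)); apply: eq_cint => z.
  by rewrite mul1r mulrAC.
have iS (H' : measurableTypeR R * measurableTypeR R -> R[i]) : cintegrable leb2 H' ->
  cintegrable leb2 (fun z => H' z * (sechpi (z.1 + z.2))%:C%C).
  move=> i'; under eq_fun do rewrite mulrC.
  apply: (@cintegrableM _ _ _ leb2 _ _ (2 * pi)) => //.
    by apply: cmeas_real; exact: (measurableT_comp measurable_sechpi).
  move=> z; rewrite normc_real gtr0_norm ?sechpi_gt0 //.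
  exact: sechpi_le_2pi.
have h2 := step _ (iS _ iH) (step _ iH h0) u.
pose p (t : measurableTypeR R) := F1 t * (sechpi t ^+ 2)%:C%C * ce (u * t).
pose q (t : measurableTypeR R) := G1 t * (sechpi t ^+ 2)%:C%C * ce (u * t).
have pqE z : H z * (sechpi (z.1 + z.2))%:C%C * (sechpi (z.1 + z.2))%:C%C * ce (u * (z.1 + z.2)) =
   p z.1 * q z.2.
  have -> : H z * (sechpi (z.1 + z.2))%:C%C * (sechpi (z.1 + z.2))%:C%C =
    F1 z.1 * G1 z.2 * (convK z.1 z.2 * sechpi (z.1 + z.2) ^+ 2)%:C%C.
    by rewrite /H expr2 !realcM; ring.
  have -> : convK z.1 z.2 * sechpi (z.1 + z.2) ^+ 2 = sechpi z.1 ^+ 2 * sechpi z.2 ^+ 2.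
    by rewrite /convK -!exprMn divfK // gt_eqF // sechpi_gt0.
  by rewrite mulrDr ceD realcM /p /q; ring.
have ipq : cintegrable leb2 (fun z => p z.1 * q z.2).
  have mu_ : measurable_fun setT (fun z : measurableTypeR R * measurableTypeR R => u * (z.1 + z.2) : R).
    exact: measurable_funM.
  have := cintegrable_ce mu_ (iS _ (iS _ iH)).
  by rewrite (_ : (fun t => _) = (fun z => p z.1 * q z.2)) //; apply/funext => z; exact: pqE.
have [_ e] := cfubini12 ipq.
have ip : cintegrable leb p.
  by apply: cintegrable_ce; [exact: measurable_funM|exact: cintegrable_sechpi2].
have iq : cintegrable leb q.
  by apply: cintegrable_ce; [exact: measurable_funM|exact: cintegrable_sechpi2].
have h3 : cint (leb \x leb)%E (fun z => p z.1 * q z.2) = 0.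
  by rewrite -[RHS]h2; apply: eq_cint => z; rewrite pqE.
rewrite -[RHS]h3 -e.
transitivity (cint leb (fun x => cint leb q * p x)); first by rewrite cintZl // mulrC.
by apply: eq_cint => x /=; rewrite cintZl // mulrC.
Qed.

(** If the first transform is nonzero at a point, it is nonzero nearby, so that the
    second one vanishes near that point and therefore everywhere. *)
Lemma charf_kernel_ae : (forall u, charf2 H (fun z => z.1 + z.2) u = 0) ->
  {ae leb, forall t, F1 t = 0} \/ {ae leb, forall t, G1 t = 0}.
Proof.
move=> /charf_kernel_prod pq0.
have strip (K1 : measurableTypeR R -> R[i]) : cintegrable leb K1 ->
    (forall u, charf leb (fun t => K1 t * (sechpi t ^+ 2)%:C%C) id u = 0) ->
    {ae leb, forall t, K1 t = 0}.
  move=> iK /(charf_eq0_ae (cintegrable_sechpi2 iK)); apply: ae_imp => t /eqP.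
  rewrite mulf_eq0 => /orP[/eqP//|/eqP /(congr1 (@complex.Re R)) /= /eqP].
  by rewrite sqrf_eq0 gt_eqF ?sechpi_gt0.
have iF2 := cintegrable_sechpi2 iF; have iG2 := cintegrable_sechpi2 iG.
have [F0|/existsNP[v0 /eqP F0]] := pselect (forall u, charf leb (fun t => F1 t * (sechpi t ^+ 2)%:C%C) id u = 0).
  by left; exact: strip.
right; apply: strip => //; apply: (@charf_unique_continuation _ _ _ _ v0).
- exact: (cintegrable_cmeas iG2).
- apply: (@rintegrable_le _ _ _ leb _ _ _ (fun y => (2 * pi) ^+ 2 * Normc.normc (G1 y))) => //.
  + apply: measurable_funM; first by apply: measurable_normc; exact: (cintegrable_cmeas iG2).
    exact: measurable_fun_expRnorm.
  + move=> y _; rewrite ger0_norm ?mulr_ge0 ?normc_ge0 ?expR_ge0 // Normc.normcM normc_real.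
    rewrite -mulrA mulrC ler_wpM2r ?normc_ge0 // ger0_norm ?sqr_ge0 //.
    have -> : expR (2 * `|y|) = expR `|y| ^+ 2 by rewrite -expRM_natl.
    rewrite -exprMn ler_sqr ?nnegrE ?mulr_ge0 ?pi_ge0 ?expR_ge0 ?(ltW (sechpi_gt0 _)) //.
    apply: le_trans (ler_wpM2r (expR_ge0 _) (sechpi_le y)) _.
    rewrite -[leLHS]mulrA -expRD ler_piMr ?mulr_ge0 ?pi_ge0 // -expR0 ler_expR normrM (ger0_norm (pi_ge0 R)).
    by have := @pi_ge2 R; have := normr_ge0 y; nra.
  + by apply: rintegrableZl => //; exact: cintegrable_normc.
- have := charf_neq0_near iF2 (@measurable_id _ _ _) F0; apply: filterS => v vF.
  by have /eqP := pq0 v; rewrite mulf_eq0 (negPf vF) => /eqP.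
Qed.

Lemma charf_kernel_eq0 : {ae leb, forall x, Rplus x -> charf2 H (fun z => z.1 + z.2) (- ln x) = 0} ->
  forall u, charf2 H (fun z => z.1 + z.2) u = 0.
Proof.
move=> ae0 u.
have oppE v : charf2 H (fun z => z.1 + z.2) v = charf2 H (fun z => - (z.1 + z.2)) (- v).
  by apply: eq_cint => z; rewrite mulrNN.
apply/eqP/negPn/negP; rewrite oppE => n0.
have mth' : measurable_fun setT (fun z : measurableTypeR R * measurableTypeR R => - (z.1 + z.2) : R).
  exact: measurable_funN.
have := charf_neq0_near iH mth' n0.
move=> nn; apply: (@ae_ln_near (fun y => charf2 H (fun z => - (z.1 + z.2)) y = 0) (- u)).
  apply: ae_imp ae0 => x h x0; by rewrite -[RHS](h x0) oppE opprK.
by apply: filterS nn => v /eqP.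
Qed.

Lemma conv_charf (F G : R[i] -> R[i]) x : F1 = F \o @sigma R -> G1 = G \o @sigma R ->
  mellin_conv F G x = (Num.sqrt x)%:C%C / ((2 * pi)%:C%C * (0 +i* 1)%C) ^+ 2 *
   ((0 +i* 1)%C * (0 +i* 1)%C * (expR (- ln x))%:C%C * charf2 H (fun z => z.1 + z.2) (- ln x)).
Proof.
move=> FE GE; rewrite /mellin_conv; congr (_ * _).
pose h (z : measurableTypeR R * measurableTypeR R) := H z * ce (- ln x * (z.1 + z.2)).
have ih : cintegrable (leb \x leb)%E h.
  apply: cintegrable_ce; last exact: iH.
  exact: measurable_funM.
have [ih1 e] := cfubini21 ih.
have ih2 eta : cintegrable leb (fun tau => h (tau, eta)).
  apply: (@cintegrable_le _ (measurableTypeR R) R leb (fun tau => h (tau, eta)) (fun tau => (2 * pi) ^+ 2 * Normc.normc (G1 eta) * Normc.normc (F1 tau))).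
  - have [m1 m2] := cintegrable_cmeas ih.
    by split; [exact: (measurableT_comp m1 (pair2_measurable eta))|exact: (measurableT_comp m2 (pair2_measurable eta))].
  - move=> tau; rewrite /h Normc.normcM normc_ce mulr1 /H !Normc.normcM normc_real ger0_norm ?sqr_ge0 //.
    rewrite mulrAC ler_wpM2r ?normc_ge0 // ler_wpM2r ?normc_ge0 //.
    by have /andP[] := convK_bound tau eta.
  - by apply: rintegrableZl => //; exact: cintegrable_normc.
have in1 eta : int_sigma (fun s => conv_kernel s (sigma eta) * F s * G (sigma eta) * cpow x (- s - sigma eta)) =
    (0 +i* 1)%C * (expR (- ln x))%:C%C * cint leb (fun tau => h (tau, eta)).
  rewrite /int_sigma cintegralE -mulrA; apply: (congr1 (fun z => (0 +i* 1)%C * z)).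
  rewrite -cintZl //.
  apply: eq_cint => tau; rewrite cpow_sigma conv_kernel_sigma /h /H FE GE /=; ring.
rewrite {1}/int_sigma cintegralE.
transitivity ((0 +i* 1)%C * cint leb (fun eta => (0 +i* 1)%C * (expR (- ln x))%:C%C * cint leb (fun tau => h (tau, eta)))).
  by apply: (congr1 (fun z => (0 +i* 1)%C * z)); apply: eq_cint => eta; exact: in1.
rewrite cintZl // e /charf /h !mulrA.
by apply: (congr1 (fun z => _ * z)); exact: eq_cint.
Qed.

Lemma mellin_conv_ae (F G : R[i] -> R[i]) : F1 = F \o @sigma R -> G1 = G \o @sigma R ->
  ae_eq0 (mellin_conv F G) -> {ae leb, forall t, F1 t = 0} \/ {ae leb, forall t, G1 t = 0}.
Proof.
move=> FE GE h0; apply: charf_kernel_ae; apply: charf_kernel_eq0.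
apply: ae_imp h0 => x h x0; have := h x0; rewrite (conv_charf x FE GE) => /eqP.
rewrite !mulf_eq0 invr_eq0 expf_eq0 /= mulf_eq0.
have re0 (r : R) : r != 0 -> (r%:C%C == 0 :> R[i]) = false.
  by move=> r0; apply/eqP => /(congr1 (@complex.Re R)) /= /eqP; rewrite (negPf r0).
have i0 : ((0 +i* 1)%C == 0 :> R[i]) = false.
  by apply/eqP => /(congr1 (@complex.Im R)) /= /eqP; rewrite oner_eq0.
rewrite !re0 ?i0 /=; first by move/eqP.
- by rewrite gt_eqF ?expR_gt0.
- by rewrite gt_eqF ?mulr_gt0 ?pi_gt0.
- by rewrite gt_eqF ?sqrtr_gt0.
Qed.

End kernel.
End product.

(** * Injectivity of the Mellin transform *)

Section mellin_injective.
Context {R : realType}.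
Local Notation leb := (@lebesgue_measure R).
Local Notation mR := (measurableTypeR R).
Implicit Types (a b c lam u : R).

(** Boundedness makes [sechks] square integrable, as pairing it with functions that are
    small in the mean requires. *)
Lemma sechks_le1 lam y : 1 <= lam -> sechks lam y <= 1.
Proof.
move=> l1; have l0 : 0 < lam by apply: lt_le_trans l1.
rewrite /sechks ler_pdivrMr // mul1r (le_trans _ l1) // /sechk.
rewrite ler_pdivrMr ?oneDexpR_gt0 // mul1r.
have -> : expR (y / lam) = expR (y / lam / 2) ^+ 2.
  by rewrite -expRM_natl; congr expR; field; rewrite gt_eqF.
set X := expR _; have : 0 < X by exact: expR_gt0.
nra.
Qed.

(** The left-hand side is [t] for [t < 1] and [t ^ - 3] for [t >= 1]. *)
Lemma expR_ln_weight (t : R) : 0 < t ->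
  (expR (- (2^-1 * ln t)) * expR (- `|ln t|)) ^+ 2 <= 2 * (4^-1 + t ^+ 2)^-1.
Proof.
move=> t0; rewrite -expRD -expRM_natl.
have q0 : 0 < 4^-1 + t ^+ 2 by rewrite ltr_wpDr ?sqr_ge0.
rewrite ler_pdivlMr //.
have [l0|l0] := leP 0 (ln t).
  rewrite ger0_norm // (_ : 2%:R * _ = - (3%:R * ln t)); last by field.
  have t1 : 1 <= t by rewrite -ler_ln ?posrE // ln1.
  rewrite expRN expRM_natl lnK ?posrE // mulrC ler_pdivrMr ?exprn_gt0 //; nra.
rewrite ltr0_norm // (_ : 2%:R * _ = ln t); last by field.
have t1 : t < 1 by rewrite -ltr_ln ?posrE // ln1.
rewrite lnK ?posrE //; nra.
Qed.

Lemma mem_Rplus (t : R) : (t \in @Rplus R) = (0 < t).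
Proof. by apply/idP/idP; rewrite inE. Qed.

Section weighted.
Variable f : R -> R[i].
Hypothesis f2 : L2_on (@Rplus R) f.

(** The Mellin transform of [f] on the critical line is the Fourier transform of this
    function along [ln t]. It need not be integrable, only locally so on the
    half-line. *)
Definition mellin_density (t : mR) : R[i] :=
  if 0 < t then f t * (expR (- (2^-1 * ln t)))%:C%C else 0.
Local Notation h := mellin_density.

Lemma cmeas_mellin_density : cmeas h.
Proof.
have mw : measurable_fun setT (fun t : R => expR (- (2^-1 * ln t))).
  by apply: measurableT_comp => //; apply: measurable_funN; apply: measurable_funM => //.
have [[m1 m2] _] := f2.
have E (g : R -> R) : measurable_fun (@Rplus R) g ->
    measurable_fun setT (fun t : mR => if 0 < t then g t * expR (- (2^-1 * ln t)) else 0).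
  move=> mg.
  have mgw : measurable_fun (@Rplus R) (fun t => g t * expR (- (2^-1 * ln t))).
    by apply: measurable_funM => //; exact: measurable_funTS.
  move/(measurable_restrictT _ (@measurable_Rplus R)): mgw.
  by apply: eq_measurable_fun => t _; rewrite patchE mem_Rplus.
split.
  apply: eq_measurable_fun (E _ m1) => t _; rewrite /h; case: ifP => // _.
  by rewrite cReM /= mulr0 subr0.
apply: eq_measurable_fun (E _ m2) => t _; rewrite /h; case: ifP => // _.
by rewrite cImM /= mulr0 add0r.
Qed.

(** The weight is a product of two square integrable factors: [f], and [exp (- |ln t|) /
    sqrt t] by [expR_ln_weight]. *)
Lemma integrable_mellin_density :
  leb.-integrable setT (EFin \o (fun t => Normc.normc (h t) * expR (- `|ln t|))).
Proof.
have mh := measurable_normc cmeas_mellin_density.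
have [[m1 m2] fin] := f2.
have iw := rintegrableZl measurableT 2 integrable_quarter_sqr_inv.
have if2 : leb.-integrable setT (EFin \o (fun t => if 0 < t then Normc.normc (f t) ^+ 2 else 0)).
  rewrite (_ : EFin \o _ = (EFin \o (fun t => Normc.normc (f t) ^+ 2)) \_ (@Rplus R)); last first.
    by apply/funext => t; rewrite patchE mem_Rplus /=; case: ifP.
  apply: (@integrable_mkcond _ mR R leb (@Rplus R) (EFin \o (fun t : mR => Normc.normc (f t) ^+ 2)) (@measurable_Rplus R)).1.
  apply/integrableP; split.
    apply/measurable_EFinP; apply: measurable_funX.
    under eq_fun do rewrite normc_sqrtE.
    apply: (@measurableT_comp _ _ _ _ _ _ (@Num.sqrt R)).
      by apply: continuous_measurable_fun; exact: sqrt_continuous.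
    by apply: measurable_funD; apply: measurable_funX.
  by under eq_integral do rewrite /= ger0_norm ?sqr_ge0 //.
apply: (@rintegrable_le _ _ _ leb _ _ _ (fun t => (if 0 < t then Normc.normc (f t) ^+ 2 else 0) + 2 * (4^-1 + t ^+ 2)^-1)) => //.
- apply: measurable_funM => //; apply: measurableT_comp => //; apply: measurable_funN.
  by apply: measurableT_comp => //; exact: measurable_ln.
- move=> t _; rewrite ger0_norm ?mulr_ge0 ?normc_ge0 ?expR_ge0 // /h; case: ifP => [t0|_]; last first.
    rewrite Normc.normc0 mul0r add0r mulr_ge0 // invr_ge0 addr_ge0 ?sqr_ge0 //.
  rewrite Normc.normcM normc_real ger0_norm ?expR_ge0 //.
  have := expR_ln_weight t0; rewrite -mulrA.
  set n := Normc.normc _; set w := expR _ * expR _.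
  (* From [(n - w) ^ 2 >= 0], where [n] is the modulus of [f t] and [w] its weight. *)
  have := sqr_ge0 (n - w); nra.
- exact: rintegrableD.
Qed.

Definition density_itv a (t : mR) : R[i] := h t * (\1_(`[a^-1, a]%classic) t)%:C%C.
Local Notation H := density_itv.

Lemma cmeas_density_itv a : cmeas (H a).
Proof.
apply: cmeasM; first exact: cmeas_mellin_density.
by apply: cmeas_real; exact: measurable_indic.
Qed.

Lemma cintegrable_density_itv a : 0 < a -> cintegrable leb (H a).
Proof.
move=> a0.
apply: (@cintegrable_le _ mR R leb (H a) (fun t => a * (Normc.normc (h t) * expR (- `|ln t|)))).
- exact: cmeas_density_itv.
- move=> t; rewrite /H Normc.normcM normc_real indicE.
  have [ta|] := boolP (t \in _); last by rewrite normr0 mulr0 !mulr_ge0 ?normc_ge0 ?expR_ge0 ?ltW.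
  rewrite normr1 mulr1 mulrCA ler_peMr ?normc_ge0 //.
  move: ta; rewrite inE /= in_itv /= => /andP[h1 h2].
  have t0 : 0 < t by rewrite (lt_le_trans _ h1) ?invr_gt0.
  rewrite -[X in X * _](@lnK _ a) ?posrE // -expRD -expR0 ler_expR subr_ge0 ler_norml.
  rewrite -lnV ?posrE // !ler_ln ?posrE ?invr_gt0 //.
  by rewrite h1 h2.
- by apply: rintegrableZl => //; exact: integrable_mellin_density.
Qed.

Lemma trunc_mellin_charf a tau : 0 < a -> trunc_mellin f a (sigma tau) = charf leb (H a) (@ln R) tau.
Proof.
move=> a0; rewrite /trunc_mellin /charf.
have E (t : R) : `[a^-1, a]%classic t -> f t * cpow t (sigma tau - 1) = H a t * ce (tau * ln t).
  move=> ta; rewrite /H indicE mem_set // mulr1 /h.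
  have t0 : 0 < t by move: ta; rewrite /= in_itv /= => /andP[h1 _]; rewrite (lt_le_trans _ h1) ?invr_gt0.
  rewrite t0 -mulrA; congr (_ * _); rewrite /cpow /ce /=; congr (_ * _); last by rewrite subr0.
  by congr (expR _)%:C%C; field.
rewrite /cintegral /cint; congr (_ +i* _)%C.
  rewrite [RHS](_ : _ = (\int[leb]_(t in `[a^-1, a]) complex.Re (H a t * ce (tau * ln t)))%R).
    by apply: eq_Rintegral => t; rewrite inE => ta; rewrite E.
  rewrite [RHS]Rintegral_mkcond; apply: eq_Rintegral => t _; rewrite patchE.
  case: ifPn => // /negPf ta; by rewrite /H indicE ta mulr0 mul0r.
rewrite [RHS](_ : _ = (\int[leb]_(t in `[a^-1, a]) complex.Im (H a t * ce (tau * ln t)))%R).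
  by apply: eq_Rintegral => t; rewrite inE => ta; rewrite E.
rewrite [RHS]Rintegral_mkcond; apply: eq_Rintegral => t _; rewrite patchE.
case: ifPn => // /negPf ta; by rewrite /H indicE ta mulr0 mul0r.
Qed.

End weighted.

Lemma cvg_Rintegral_pos_itv (g : mR -> R) : leb.-integrable setT (EFin \o g) ->
  (forall t, t <= 0 -> g t = 0) ->
  (\int[leb]_t (g t * \1_(`[n.+1%:R^-1, n.+1%:R]%classic) t))%R @[n --> \oo] --> (\int[leb]_t g t)%R.
Proof.
move=> ig g0.
pose G n (t : mR) := g t * \1_(`[n.+1%:R^-1, n.+1%:R]%classic) t.
have mg := rintegrable_measurable ig.
have mG n : measurable_fun setT (G n).
  by apply: measurable_funM => //; exact: measurable_indic.
have Gle n t : `|G n t| <= `|g t|.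
  by rewrite /G normrM ler_piMr // indicE; case: (_ \in _); rewrite ?normr1 ?normr0.
have iG n : leb.-integrable setT (EFin \o G n).
  by apply: (@rintegrable_le _ _ _ leb _ _ _ (fun t => `|g t|)) => //; exact: integrable_norm.
have ae1 : {ae leb, forall t, setT t -> (EFin \o G n) t @[n --> \oo] --> (EFin \o g) t}.
  apply: aeW => t _; apply: cvg_EFin; first exact: nearW.
  have [t0|t0] := leP t 0.
    by rewrite /= /G g0 //; under eq_fun do rewrite mul0r; exact: cvg_cst.
  apply: cvg_near_cst; near=> n.
  rewrite /= /G indicE mem_set ?mulr1 //= in_itv /=; apply/andP; split.
    rewrite invf_ple ?posrE ?ltr0n // ltW // (lt_le_trans (truncnS_gt _)) // ler_nat ltnS.
    by near: n; exact: nbhs_infty_ge.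
  rewrite ltW // (lt_le_trans (truncnS_gt _)) // ler_nat ltnS.
  by near: n; exact: nbhs_infty_ge.
have dom : {ae leb, forall t (n : nat), setT t -> (`|(EFin \o G n) t| <= (EFin \o (fun t => `|g t|%R)) t)%E}.
  by apply: aeW => t n _; rewrite /= lee_fin Gle.
have [_ _ lim] := @dominated_convergence _ _ _ leb setT measurableT (fun n => EFin \o G n) (EFin \o g) _
  (fun n => measurable_int _ (iG n)) (measurable_int _ ig) ae1 (integrable_norm ig) dom.
have fE : (\int[leb]_t (EFin \o g) t)%E = (fine (\int[leb]_t (EFin \o g) t)%E)%:E.
  by rewrite fineK //; exact: integrable_fin_num.
rewrite fE in lim.
exact: (fine_cvg lim).
Unshelve. all: by end_near.
Qed.

(** Cauchy-Schwarz, in the form [k m <= (d k ^ 2 + m ^ 2 / d) / 2] with a parameter [d]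
    to be chosen small. *)
Lemma cvg_pairing0 (k : mR -> R) (m : nat -> mR -> R) : (forall y, 0 <= k y <= 1) ->
  leb.-integrable setT (EFin \o k) -> (forall n, measurable_fun setT (m n)) ->
  (\int[leb]_y ((m n y ^+ 2)%:E))%E @[n --> \oo] --> 0%E ->
  (\int[leb]_y (k y * m n y))%R @[n --> \oo] --> (0 : R).
Proof.
move=> k01 ik mm /fine_cvgP[fin lim].
have mk := rintegrable_measurable ik.
set K := (\int[leb]_y k y)%R.
have K0 : 0 <= K by apply: Rintegral_ge0 => y _; have /andP[] := k01 y.
have K1 : 0 < K + 1 by rewrite ltr_wpDl.
apply/cvgrPdist_le => e e0.
have d0 : 0 < e / (K + 1) by rewrite divr_gt0.
set d := e / (K + 1) in d0.
have de : 0 < d * e by rewrite mulr_gt0.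
move/cvgrPdist_le : lim => /(_ _ de) lim.
near=> n.
have fn : (\int[leb]_y (m n y ^+ 2)%:E)%E \is a fin_num by near: n.
have im2 : leb.-integrable setT (EFin \o (fun y => m n y ^+ 2)).
  apply/integrableP; split; first by apply/measurable_EFinP; exact: measurable_funX.
  under eq_integral do rewrite /= ger0_norm ?sqr_ge0 //.
  by rewrite ltey_eq fn.
have bnd y : `|k y * m n y| <= 2^-1 * (d * k y + d^-1 * m n y ^+ 2).
  have /andP[k0 k1] := k01 y.
  have kk : k y ^+ 2 <= k y by rewrite expr2 ler_piMr.
  have : 0 <= (d * k y - `|m n y|) ^+ 2 / d by rewrite divr_ge0 ?sqr_ge0 ?(ltW d0).
  have -> : (d * k y - `|m n y|) ^+ 2 / d = d * k y ^+ 2 - 2 * (k y * `|m n y|) + d^-1 * `|m n y| ^+ 2.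
    by field; rewrite gt_eqF.
  rewrite normrM (ger0_norm k0) real_normK ?num_real //.
  have := ler_wpM2l (ltW d0) kk; lra.
have ib : leb.-integrable setT (EFin \o (fun y => 2^-1 * (d * k y + d^-1 * m n y ^+ 2))).
  by apply: rintegrableZl => //; apply: rintegrableD => //; exact: rintegrableZl.
have ikm : leb.-integrable setT (EFin \o (fun y => k y * m n y)).
  by apply: rintegrable_le ib => //; exact: measurable_funM.
rewrite sub0r normrN.
apply: (le_trans (le_normr_Rintegral measurableT ikm)).
apply: (@le_trans _ _ (\int[leb]_y (2^-1 * (d * k y + d^-1 * m n y ^+ 2)))%R).
  by apply: le_Rintegral => //; exact: integrable_norm.
rewrite RintegralZl //; last by apply: rintegrableD => //; exact: rintegrableZl.
rewrite RintegralD //; [|exact: rintegrableZl|exact: rintegrableZl].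
rewrite !RintegralZl // -/K.
have h1 : d * K <= e by rewrite /d mulrAC ler_pdivrMr // ler_pM2l // lerDl.
have h2 : d^-1 * (\int[leb]_y (m n y ^+ 2))%R <= e.
  rewrite ler_pdivrMl //.
  have : `|0 - fine (\int[leb]_y (m n y ^+ 2)%:E)%E| <= d * e by near: n.
  by rewrite sub0r normrN; apply: le_trans; rewrite ler_norm.
rewrite (_ : e = 2^-1 * (e + e)); last by field.
by rewrite ler_pM2l ?invr_gt0 //; exact: lerD.
Unshelve. all: by end_near.
Qed.

(** Real and imaginary parts are treated at once, as the uniqueness results concern real
    functions. *)
Definition cpart (b : bool) (z : R[i]) : R := if b then complex.Re z else complex.Im z.

Lemma cpartM p z (r : R) : cpart p (z * r%:C%C) = cpart p z * r.
Proof. by case: p; rewrite /cpart ?cReM ?cImM /= mulr0 ?subr0 ?add0r. Qed.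

Lemma norm_cpart_le p z : `|cpart p z| <= Normc.normc z.
Proof. by case: p; [exact: norm_Re_le|exact: norm_Im_le]. Qed.

Lemma cpart_cint p (f : mR -> R[i]) : cpart p (cint leb f) = (\int[leb]_t cpart p (f t))%R.
Proof. by case: p. Qed.

Lemma measurable_cpart p (f : mR -> R[i]) : cmeas f -> measurable_fun setT (fun t => cpart p (f t)).
Proof. by case: p => -[]. Qed.

Lemma measurable_charf_part p (H : mR -> R[i]) (th : mR -> R) : cintegrable leb H ->
  measurable_fun setT th -> measurable_fun setT (fun u : mR => cpart p (charf leb H th u)).
Proof.
by move=> iH mth; have [cR cI] := continuous_charf iH mth; case: p; exact: continuous_measurable_fun.
Qed.

Section injective.
Variables (f : R -> R[i]) (F : R[i] -> R[i]).
Hypotheses (f2 : L2_on (@Rplus R) f) (fF : is_mellin f F).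
Hypothesis F0 : {ae leb, forall t, F (sigma t) = 0}.
Local Notation h := (mellin_density f).
Local Notation H := (density_itv f).
Let mln : measurable_fun setT (@ln R : mR -> R) := @measurable_ln R.

Lemma trunc_mellin_L2_cvg0 :
  (\int[leb]_y (Normc.normc (charf leb (H n.+1%:R) (@ln R) y) ^+ 2)%:E)%E @[n --> \oo] --> 0%E.
Proof.
have [[mF _] lim] := fF.
have an : (n.+1%:R : R) @[n --> \oo] --> +oo.
  by have := @cvgr_idn R; rewrite -cvg_shiftS.
have lim1 := cvg_comp _ _ an lim.
rewrite (_ : (fun n => _) = (fun n : nat => sqnorm2 setT (fun tau : R => F (sigma tau) - trunc_mellin f n.+1%:R (sigma tau)))) //.
apply/funext => n; rewrite /sqnorm2.
have n0 : (0 : R) < n.+1%:R by [].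
have iH := cintegrable_density_itv f2 n0.
have [cR cI] := continuous_charf iH mln.
have mM : cmeas (fun y : mR => charf leb (H n.+1%:R) (@ln R) y).
  by split; apply: continuous_measurable_fun.
apply: ae_eq_integral => //.
- apply/measurable_EFinP; apply: measurable_funX; exact: measurable_normc.
- apply/measurable_EFinP; apply: measurable_funX.
  have : cmeas (fun tau : mR => F (sigma tau) - trunc_mellin f n.+1%:R (sigma tau)).
    rewrite (_ : (fun tau => _) = (fun tau : mR => F (sigma tau) - charf leb (H n.+1%:R) (@ln R) tau)); last first.
      by apply/funext => tau; rewrite trunc_mellin_charf.
    have [m1 m2] := mF.
    by split; (under eq_fun do rewrite raddfB); apply: measurable_funB => //; exact: continuous_measurable_fun.
  exact: measurable_normc.
- apply: ae_imp F0 => t Ft _; rewrite Ft sub0r trunc_mellin_charf //.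
  by case: (charf _ _ _ _) => x y; rewrite /Normc.normc /= !sqrrN.
Qed.

(** Truncated to [[1/a, a]], the integral equals by [fourier_swap] the pairing of
    [sechks lam] with the truncated Mellin transform of [f], up to a phase from the
    shift by [c]; that pairing tends to zero with the mean square. *)
Lemma mellin_density_sechpi0 lam c p : 1 <= lam ->
  (\int[leb]_t (cpart p (h t) * sechpi (lam * (ln t - c))))%R = 0.
Proof.
move=> l1; have l0 : 0 < lam by apply: lt_le_trans l1.
pose th (t : mR) : R := ln t - c.
have mth : measurable_fun setT th by exact: measurable_funB.
have ms : measurable_fun setT (fun t : mR => sechpi (lam * th t)).
  by apply: (measurableT_comp (@measurable_sechpi R)); exact: measurable_funM.
have mh := cmeas_mellin_density f2.
have ig : leb.-integrable setT (EFin \o (fun t => cpart p (h t) * sechpi (lam * (ln t - c)))).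
  apply: (@rintegrable_le _ _ _ leb _ _ _ (fun t => 2 * pi * expR `|c| * (Normc.normc (h t) * expR (- `|ln t|)))) => //.
  - by apply: measurable_funM => //; exact: measurable_cpart.
  - move=> t _; rewrite normrM mulrCA ler_pM ?norm_cpart_le // ger0_norm ?(ltW (sechpi_gt0 _)) //.
    exact: sechpi_shift_le.
  - by apply: rintegrableZl => //; exact: integrable_mellin_density.
have g0 (t : R) : t <= 0 -> cpart p (h t) * sechpi (lam * (ln t - c)) = 0.
  by move=> t0; rewrite /mellin_density ltNge t0 /= /cpart; case: (p); rewrite mul0r.
have lim1 := cvg_Rintegral_pos_itv ig g0.
have an0 n : (0 : R) < n.+1%:R by [].
have k01 y : 0 <= sechks lam y <= 1 by rewrite sechks_ge0 // sechks_le1.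
have mk n : measurable_fun setT (fun y : mR => cpart p (charf leb (H n.+1%:R) th y)).
  by apply: measurable_charf_part => //; exact: cintegrable_density_itv.
have lim2 := cvg_pairing0 k01 (integrable_sechks l0) mk.
suff lim3 : (\int[leb]_t (cpart p (h t) * sechpi (lam * (ln t - c)) *
    \1_(`[n.+1%:R^-1, n.+1%:R]%classic) t))%R @[n --> \oo] --> (0 : R).
  exact: (cvg_unique _ lim1 lim3).
rewrite (_ : (fun n => _) = (fun n => \int[leb]_y (sechks lam y * cpart p (charf leb (H n.+1%:R) th y)))%R).
  apply: lim2.
  apply: (@squeeze_cvge _ _ _ _ (cst 0%E) _ (fun n => \int[leb]_y (Normc.normc (charf leb (H n.+1%:R) (@ln R) y) ^+ 2)%:E)%E).
  - apply: nearW => n; apply/andP; split.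
      by apply: integral_ge0 => y _; rewrite lee_fin sqr_ge0.
    have [cR cI] := continuous_charf (cintegrable_density_itv f2 (an0 n)) mln.
    apply: ge0_le_integral => //.
    + by move=> y _; rewrite lee_fin sqr_ge0.
    + by apply/measurable_EFinP; exact: measurable_funX.
    + apply/measurable_EFinP; apply: measurable_funX; apply: measurable_normc.
      by split; exact: continuous_measurable_fun.
    + move=> y _; rewrite lee_fin /th (charf_translate _ _ (cintegrable_density_itv f2 (an0 n)) mln).
      rewrite -real_normK ?num_real // ler_sqr ?nnegrE ?normc_ge0 //.
      apply: (le_trans (norm_cpart_le _ _)).
      by rewrite Normc.normcM normc_ce mul1r.
  - exact: cvg_cst.
  - exact: trunc_mellin_L2_cvg0.
apply/funext => n.
have ik : cintegrable leb (fun y => (sechks lam y)%:C%C).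
  by split; [exact: integrable_sechks|exact: integrable0].
have iH := cintegrable_density_itv f2 (an0 n).
have e := fourier_swap ik iH mth.
transitivity (cpart p (cint leb (fun t => H n.+1%:R t * cint leb (fun y => (sechks lam y)%:C%C * ce (y * th t))))).
  apply: (etrans _ (esym (cpart_cint p _))).
  apply: eq_Rintegral => t _; rewrite (cint_sechks (th t) l0).
  rewrite (cpartM p (H n.+1%:R t)) (cpartM p (h t)).
  by rewrite mulrAC.
apply: (etrans (congr1 (cpart p) (esym e))).
apply: (etrans (cpart_cint p _)).
by apply: eq_Rintegral => y _; rewrite mulrC (cpartM p (charf _ _ _ _)) mulrC.
Qed.

(** The integral of [h] over every set [a < ln t < b] vanishes. Localizing to [|ln t| <
    n] makes [h] integrable on the line, and intersecting with an interval [a < t < b]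
    gives a set of the same shape. *)
Lemma mellin_density_ae0 p : {ae leb, forall t, cpart p (h t) = 0}.
Proof.
pose g (t : mR) : R := cpart p (h t).
have mg : measurable_fun setT g by apply: measurable_cpart; exact: cmeas_mellin_density.
have iw : leb.-integrable setT (EFin \o (fun t => `|g t| * expR (- `|ln t|))).
  apply: (@rintegrable_le _ _ _ leb _ _ _ (fun t => Normc.normc (h t) * expR (- `|ln t|))) => //.
  - apply: measurable_funM; first exact: measurableT_comp.
    apply: measurableT_comp => //; apply: measurable_funN.
    exact: (measurableT_comp (@normr_measurable R setT) mln).
  - by move=> t _; rewrite ger0_norm ?mulr_ge0 ?expR_ge0 // ler_wpM2r ?expR_ge0 ?norm_cpart_le.
  - exact: integrable_mellin_density.
have g0 (t : R) : t <= 0 -> g t = 0.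
  by move=> t0; rewrite /g /mellin_density ltNge t0 /= /cpart; case: (p).
have fib c : {ae leb, forall t, ln t = c -> g t = 0}.
  apply: ae_imp (ae_neq_pt (expR c)) => t tc lc; have [t0|t0] := leP t 0; first exact: g0.
  by case: tc; rewrite -lc lnK.
have itv0 a b : a < b -> (\int[leb]_t (g t * \1_(`]a, b[%classic) (ln t)))%R = 0.
  apply: sechpi_tests_vanish_itv => //.
  by move=> lam c l1; exact: mellin_density_sechpi0.
have n_itv n : {ae leb, forall t, g t * \1_(`]- n%:R, n%:R[%classic) (ln t) = 0}.
  have mI : measurable_fun setT (fun t : mR => \1_(`]- n%:R, n%:R[%classic) (ln t) : R).
    by apply: measurableT_comp mln; exact: measurable_indic.
  apply: ae_eq0_of_itv.
    apply: (@rintegrable_le _ _ _ leb _ _ _ (fun t => expR n%:R * (`|g t| * expR (- `|ln t|)))) => //.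
    - exact: measurable_funM.
    - move=> t _; rewrite normrM indicE; case: (boolP (_ \in _)) => [tn|_]; last first.
        by rewrite normr0 mulr0 !mulr_ge0 ?expR_ge0.
      rewrite normr1 mulr1 mulrCA ler_peMr // -expRD -[leLHS]expR0 ler_expR subr_ge0.
      by move: tn; rewrite inE /= in_itv /= -ltr_norml => /ltW.
    - exact: rintegrableZl.
  move=> a b ab.
  (* On the half-line, [a < t < b] and [|ln t| < n] together mean that [ln t] lies
     between [a'] and [b']. *)
  pose a' := if 0 < a then Num.max (- n%:R) (ln a) else - n%:R.
  pose b' := Num.min n%:R (ln b).
  have memE (l r x : R) : (x \in `]l, r[%classic) = (l < x < r).
    by apply/idP/idP; rewrite inE /= in_itv.
  have E (t : R) : g t * \1_(`]- n%:R, n%:R[%classic) (ln t) * \1_(`]a, b[%classic) t =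
      if 0 < b then g t * \1_(`]a', b'[%classic) (ln t) else 0.
    have [t0|t0] := leP t 0; first by rewrite g0 // !mul0r; case: ifP.
    case: ifPn => [b0|b0].
      rewrite -mulrA !indicE -natrM mulnb !memE lt_min -!andbA.
      congr (_ * (nat_of_bool _)%:R); rewrite (@ltr_ln _ t b) ?posrE //.
      rewrite /a'; case: ifPn => a0.
        rewrite gt_max (@ltr_ln _ a t) ?posrE //.
        by case: (_ < _); case: (_ < _); case: (_ < _).
      by rewrite (le_lt_trans _ t0) ?leNgt //.
    rewrite [X in _ * X]indicE memE (_ : (a < t < b) = false) ?mulr0 //.
    by apply/negbTE; apply: contra b0 => /andP[_]; exact: lt_trans.
  under eq_Rintegral do rewrite E.
  case: (0 < b); last by rewrite Rintegral_cst //= mul0r.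
  have [ab'|ba'] := ltP a' b'; first exact: itv0.
  rewrite (_ : (fun t => _) = cst 0); first by rewrite Rintegral_cst //= mul0r.
  by apply/funext => t; rewrite set_itv_ge ?indic0 ?mulr0 // -leNgt.
have all0 : {ae leb, forall t, forall n : nat, g t * \1_(`]- n%:R, n%:R[%classic) (ln t) = 0}.
  exact/ae_foralln.
apply: ae_imp all0 => t gt.
have := gt (Num.truncn `|ln t|).+1; rewrite indicE mem_set ?mulr1 //=.
by rewrite in_itv /= -ltr_norml truncnS_gt.
Qed.

Lemma mellin_injective : ae_eq0 f.
Proof.
have hR := mellin_density_ae0 true; have hI := mellin_density_ae0 false.
apply: ae_imp2 hR hI => t; rewrite /cpart => hR hI t0.
have : h t = 0 by exact: complexP.
rewrite /mellin_density t0 => /eqP; rewrite mulf_eq0 => /orP[/eqP//|/eqP /(congr1 (@complex.Re R)) /= /eqP].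
by rewrite gt_eqF ?expR_gt0.
Qed.

End injective.
End mellin_injective.

Theorem theorem3 (R : realType) (f g : R -> R[i]) (F G : R[i] -> R[i])
  (hf : L2_on (@Rplus R) f) (hg : L2_on (@Rplus R) g)
  (hF : is_mellin f F) (hG : is_mellin g G)
  (hsF : L2_sigma (fun s : R[i] => s * F s))
  (hsG : L2_sigma (fun s : R[i] => s * G s))
  (hfg : ae_eq0 (mellin_conv F G)) :
  ae_eq0 f \/ ae_eq0 g.
Proof.
have iF := L2_sigma_cintegrable hF.1 hsF; have iG := L2_sigma_cintegrable hG.1 hsG.
have [F0|G0] := mellin_conv_ae iF iG (erefl _) (erefl _) hfg.
  by left; exact: mellin_injective hF F0.
by right; exact: mellin_injective hG G0.
Qed.
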